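(* Let $g\ge 3$. The maximal cells of the moduli space $T_g^{\operatorname{trop},(3)}$ of $3$-edge connected tropical trigonal curves of genus $g$ are those associated to the graphs $(G,\underline 0)$ with $G=(G_T)^{\operatorname{st}}$, where $G_T$ is a $3$-ladder constructed from a tree $T$ with $g$ vertices.
   Context: Graphs are finite and connected, possibly with multiple edges and loops; valence counts loops twice. A weighted graph $(G,w)$ is a graph with $w:V(G)\to\mathbb Z_{\ge0}$; its genus is $\sum_v w(v)+|E(G)|-|V(G)|+1$; $\underline 0$ is the zero weight. The weighted contraction of an edge $e=uv$ replaces $e$ and its ends by one vertex, of weight $w(u)+w(v)$ if $u\ne v$ and $w(u)+1$ if $e$ is a loop; contraction of a set of edges is the composition. $(G,w)$ is stable if every vertex of weight $0$ has valence $\ge3$ and every vertex of weight $1$ has valence $\geq 1$. $G^{\operatorname{st}}$ is obtained from $G$ by contracting all leaves and then, for every vertex of weight $0$ and valence $2$, contracting one of its two adjacent edges. $G^w$ is the weightless graph obtained from $(G,w)$ by attaching $w(v)$ loops at each vertex $v$. A graph is $3$-edge connected if it remains connected after removing any $2$ edges. Harmonic morphisms. A morphism of graphs $\varphi:G\to G'$ sends vertices to vertices and each edge $e=xy$ either to a vertex $\varphi(e)=\varphi(x)=\varphi(y)$ or to an edge $\varphi(x)\varphi(y)$; it carries indices $\mu_\varphi(e)\in\mathbb Z_{\ge0}$, zero iff $e$ is sent to a vertex. It is harmonic if for all $x\in V(G)$ the sum $m_\varphi(x)$ of $\mu_\varphi(e)$ over edges $e\ni x$ with $\varphi(e)=e'$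 is independent of the edge $e'$ at $\varphi(x)$; non-degenerate if no loop is contracted and $m_\varphi(x)\ge1$ for all $x$; its degree is $\sum_{\varphi(e)=e'}\mu_\varphi(e)$ for any edge $e'$ of $G'$. Trigonal types. A $3$-edge connected trigonal type is $(G,w,\varphi)$ with $(G,w)$ a $3$-edge connected stable graph and $\varphi:G_\varphi\to T$ a non-degenerate harmonic morphism of degree $3$ from a graph $G_\varphi$ with $(G_\varphi)^{\operatorname{st}}=G^w$ to a tree $T$ such that $\varphi^{-1}(t)\cap V(G)\ne\emptyset$ for every $t\in V(T)$; then $(G,w)$ is called a $3$-edge connected trigonal graph. Let $\sim_\varphi$ be the equivalence relation on $E(G_\varphi)$ in which two edges are equivalent iff they have the same image edge in $T$ (each edge sent to a vertex of $T$ forms a class by itself). A $\varphi$-contraction is the weighted contraction in $G_\varphi$ of a set $S_\varphi$ which is a union of $\sim_\varphi$-classes; it determines a new trigonal type $(\tilde G,\tilde w,\tilde\varphi)$ with $(\tilde G,\tilde w)$ the weighted contraction of $S_\varphi\cap E(G)$ in $(G,w)$. The induced weighted contraction $(G,w)\to(\tilde G,\tilde w)$ is called a trigonal contraction. $\mathcal T_g^{(3)}$ is the category of $3$-edge connected trigonal graphs of genus $g$ with trigonal contractions as morphisms. Cones. On $E(G)$ set $e_1\le_\varphi e_2$ if there is $e\in E(G_\varphi)$ with $e\subseteq e_2$ (i.e. $e$ is a piece of $e_2$ in the refinement) and $e_1\sim_\varphi e$; set $e_1=_\varphi e_2$ if $e_1,e_2\in E(G_\varphi)$ and $e_1\sim_\varphi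 e_2$. The cone $\tau_{(G,w,\varphi)}=\mathbb R_{>0}^{|E(G)/\le_\varphi|}\subseteq\mathbb R_{>0}^{|E(G)|}$ parametrizes length functions on $(G,w)$ satisfying the constraints given by $\le_\varphi$. These constraints are to be understood as follows: $\varphi$ is viewed as a morphism of metric graphs on a metric graph with model $G_\varphi$, so that $\sim_\varphi$-equivalent edges of $G_\varphi$ have the same length, and accordingly $e_1\le_\varphi e_2$ imposes $l(e_1)\le l(e_2)$ and $e_1=_\varphi e_2$ imposes $l(e_1)=l(e_2)$. Put $\tau_G=\bigcup_{\varphi}\tau_{(G,w,\varphi)}$, over all $\varphi$ such that $(G,w,\varphi)$ is a $3$-edge connected trigonal type. Faces of the closure $\overline\tau_G$ parametrize degenerations obtained through trigonal contractions, which give face morphisms. $T_g^{\operatorname{trop},(3)}$ is the colimit of the $\overline\tau_G$ over $(G,w)\in\mathcal T_g^{(3)}$. Maximal cells are those associated to trigonal graphs that are maximal, i.e. that cannot be obtained as a trigonal contraction of any other trigonal graph of the same genus. $3$-ladders. Let $T$ be a non-trivial tree with all vertices of valence $\le3$ and vertices $v_1,\dots,v_n$. Take three disjoint copies $T^{(1)},T^{(2)},T^{(3)}$ of $T$, with $v_j^{(i)}$ the copy of $v_j$ in $T^{(i)}$. For each $j$: if $\operatorname{val}(v_j)=2$, choose two of the three copies and connect $v_j^{(i_1)},v_j^{(i_2)}$ by an edge; if $\operatorname{val}(v_j)=1$, connect the three vertices $v_j^{(1)},v_j^{(2)},v_j^{(3)}$ by two non-parallel edges. If $T$ is a path, it is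 moreover required, if possible, that the edges added over the vertices of valence $2$ do not all have their endpoints in the same two copies of $T$. Any resulting graph $G_T$ is called a $3$-ladder. *)

(* Defs.v *)
From HB Require Import structures.
From mathcomp Require Import all_boot all_order all_algebra.
From mathcomp Require Import classical_sets reals topology normedtype.
From Stdlib Require Import Relation_Operators.

Set Implicit Arguments.
Unset Strict Implicit.
Unset Printing Implicit Defensive.

Import numFieldNormedType.Exports.

(* Finite multigraphs: the ends of an edge form a set with two elements, or
   with one element if the edge is a loop. Connectedness is a separate
   predicate. *)
Record graph := Graph {
  vert : finType;
  edge : finType;
  ends : edge -> {set vert};
  card_ends : forall e, 0 < #|ends e| <= 2 }.

Definition loop (G : graph) (e : edge G) : bool := #|ends e| == 1.

Definition valence (G : graph) (x : vert G) : nat :=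
  \sum_(e : edge G | x \in ends e) (if loop e then 2 else 1).

Definition adj_without (G : graph) (S : {set edge G}) : rel (vert G) :=
  fun x y => [exists e : edge G,
    [&& e \notin S, x \in ends e & y \in ends e]].

Definition connected_without (G : graph) (S : {set edge G}) : Prop :=
  0 < #|vert G| /\ forall x y : vert G, connect (adj_without S) x y.

Definition connected_graph (G : graph) : Prop := connected_without (@finset.set0 (edge G)).

(* Removing at most two edges, so that a graph with a bridge and fewer than two
   edges is not vacuously 3-edge connected. *)
Definition three_edge_connected (G : graph) : Prop :=
  forall S : {set edge G}, #|S| <= 2 -> connected_without S.

Definition is_tree (T : graph) : Prop :=
  connected_graph T /\ #|vert T| = #|edge T|.+1.

Record giso (G H : graph) := GIso {
  gisoV : vert G -> vert H;
  gisoE : edge G -> edge H;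
  gisoV_bij : bijective gisoV;
  gisoE_bij : bijective gisoE;
  giso_ends : forall e, ends (gisoE e) = [set gisoV x | x in ends e] }.

(* Contraction of the edge e; the vertex replacing e and its ends is
   represented by the end v of e. *)
Section Contract.
Variables (G : graph) (e : edge G) (v : vert G).

Definition kept_vert : pred (vert G) := fun x => (x == v) || (x \notin ends e).

Definition contract_vert := {x : vert G | kept_vert x}.
Definition contract_edge := {f : edge G | f != e}.

Lemma kept_vert_end : kept_vert v. Proof. by rewrite /kept_vert eqxx. Qed.

Definition contract_proj (x : vert G) : contract_vert :=
  insubd (exist _ v kept_vert_end : contract_vert) x.

Definition contract_ends (f : contract_edge) : {set contract_vert} :=
  [set contract_proj x | x in ends (val f)].

Lemma card_contract_ends f : 0 < #|contract_ends f| <= 2.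
Proof.
have /andP[f_gt0 f_le2] := card_ends (val f).
rewrite (leq_trans (leq_imset_card _ _) f_le2) andbT card_gt0.
by rewrite imset_eq0 -card_gt0.
Qed.

Definition contract : graph := Graph card_contract_ends.

End Contract.

(* smoothing K G: a sequence of contractions, each of one of the two edges
   adjacent to a vertex of valence 2, from G to a graph without such vertices,
   and an identification of the latter with K. *)
Inductive smoothing (K G : graph) : Type :=
| SmoothDone (a : giso K G) (no_val2 : forall x : vert G, valence x != 2)
| SmoothStep (x y : vert G) (e f : edge G)
    (val_x : valence x = 2) (ney : y != x) (ends_e : ends e = [set x; y])
    (x_f : x \in ends f) (nef : f != e) (s : smoothing K (contract e y)).

(* stabilization K G: an identification of K with G^st, for weightless G. The
   contraction of leaves is repeated until there are no leaves. *)
Inductive stabilization (K G : graph) : Type :=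
| PruneDone (no_leaf : forall x : vert G, valence x != 1) (s : smoothing K G)
| PruneLeaf (x y : vert G) (e : edge G)
    (val_x : valence x = 1) (ney : y != x) (ends_e : ends e = [set x; y])
    (s : stabilization K (contract e y)).

(* The inclusion of V(K) in V(G). *)
Fixpoint smooth_vert (K G : graph) (s : smoothing K G) : vert K -> vert G :=
  match s with
  | SmoothDone a _ => gisoV a
  | SmoothStep _ _ _ _ _ _ _ _ _ s' => fun k => val (smooth_vert s' k)
  end.

Fixpoint stab_vert (K G : graph) (s : stabilization K G) : vert K -> vert G :=
  match s with
  | PruneDone _ s' => smooth_vert s'
  | PruneLeaf _ _ _ _ _ _ s' => fun k => val (stab_vert s' k)
  end.

(* stab_piece s h k: in the refinement G of K, the edge h is a piece of the
   edge k. Contracting e at a vertex of valence 2 whose other edge is f makes e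
   a piece of the edge containing f. *)
Fixpoint smooth_piece (K G : graph) (s : smoothing K G) :
    edge G -> edge K -> bool :=
  match s with
  | SmoothDone a _ => fun h k => h == gisoE a k
  | SmoothStep _ _ e f _ _ _ _ nef s' => fun h k =>
      smooth_piece s' (insubd (exist _ f nef : contract_edge e) h) k
  end.

Fixpoint stab_piece (K G : graph) (s : stabilization K G) :
    edge G -> edge K -> bool :=
  match s with
  | PruneDone _ s' => smooth_piece s'
  | PruneLeaf _ _ e _ _ _ s' => fun h k =>
      if (insub h : option (contract_edge e)) is Some h' then stab_piece s' h' k
      else false
  end.

Record wgraph := WGraph { gr :> graph; wt : vert gr -> nat }.

Definition genus (G : wgraph) : int :=
  (Posz (\sum_(v : vert G) wt v) + Posz #|edge G| - Posz #|vert G| + 1)%R.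

Definition stable (G : wgraph) : Prop :=
  forall v : vert G,
    (wt v = 0 -> 3 <= valence v) /\ (wt v = 1 -> 1 <= valence v).

Record wiso (G H : wgraph) := WIso {
  wiso_giso :> giso G H;
  wiso_wt : forall v, wt (gisoV wiso_giso v) = wt v }.

Definition wcontract (G : wgraph) (e : edge G) (v : vert G) : wgraph :=
  @WGraph (contract e v) (fun x : contract_vert e v =>
    if val x == v then
      if loop e then wt v + 1 else \sum_(u in ends e) wt u
    else wt (val x)).

(* wcontraction H S: an identification of H with the weighted contraction of
   the set of edges S of G. *)
Inductive wcontraction (H G : wgraph) (S : {set edge G}) : Type :=
| ContractDone (S0 : S = finset.set0) (a : wiso H G)
| ContractStep (e : edge G) (v : vert G) (eS : e \in S) (ve : v \in ends e)
    (c : @wcontraction H (wcontract e v)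
           [set f : contract_edge e | val f \in S]).

Fixpoint wcontraction_edge (H G : wgraph) (S : {set edge G})
    (c : wcontraction H S) : edge H -> edge G :=
  match c with
  | ContractDone _ a => gisoE a
  | ContractStep _ _ _ _ c' => fun h => val (wcontraction_edge c' h)
  end.

(* G^w *)
Section Weightless.
Variable G : wgraph.

Definition weightless_edge := (edge G + {v : vert G & 'I_(wt v)})%type.

Definition weightless_ends (e : weightless_edge) : {set vert G} :=
  match e with inl e' => ends e' | inr l => [set tag l] end.

Lemma card_weightless_ends e : 0 < #|weightless_ends e| <= 2.
Proof. by case: e => [e|l] /=; [exact: card_ends | rewrite cards1]. Qed.

Definition weightless : graph := Graph card_weightless_ends.

End Weightless.

(* An edge is sent either to a vertex (inl) or to an edge (inr). *)
Record morphism (G G' : graph) := Morphism {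
  morV : vert G -> vert G';
  morE : edge G -> vert G' + edge G';
  index : edge G -> nat;
  mor_ends : forall e,
    match morE e with
    | inl t => [set morV x | x in ends e] = [set t]
    | inr e' => [set morV x | x in ends e] = ends e'
    end;
  index_eq0 : forall e, index e = 0 <-> exists t, morE e = inl t }.

Section Harmonic.
Variables (G G' : graph) (phi : morphism G G').

(* m_phi(x), computed at the edge e' adjacent to phi(x) *)
Definition local_degree (x : vert G) (e' : edge G') : nat :=
  \sum_(e : edge G | (x \in ends e) && (morE phi e == inr e')) index phi e.

Definition harmonic : Prop :=
  forall (x : vert G) (e1 e2 : edge G'),
    morV phi x \in ends e1 -> morV phi x \in ends e2 ->
    local_degree x e1 = local_degree x e2.

Definition nondegenerate : Prop :=
  (forall e : edge G, loop e -> exists e', morE phi e = inr e') /\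
  (forall (x : vert G) (e' : edge G'),
     morV phi x \in ends e' -> 1 <= local_degree x e').

(* The degree is read on the edges of G', so G' must have at least one edge. *)
Definition has_degree (d : nat) : Prop :=
  0 < #|edge G'| /\
  forall e' : edge G', \sum_(e : edge G | morE phi e == inr e') index phi e = d.

Definition sim (e1 e2 : edge G) : Prop :=
  e1 = e2 \/ exists e', morE phi e1 = inr e' /\ morE phi e2 = inr e'.

End Harmonic.

(* The morphisms phi such that (G, w, phi) is a 3-edge connected trigonal
   type; source is G_phi. *)
Record trigonal_type (G : wgraph) := TrigonalType {
  source : graph;
  target : graph;
  phi : morphism source target;
  stab : stabilization (weightless G) source;
  trig_3conn : three_edge_connected G;
  trig_stable : stable G;
  trig_connected : connected_graph source;
  trig_tree : is_tree target;
  trig_harmonic : harmonic phi;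
  trig_nondegenerate : nondegenerate phi;
  trig_degree : has_degree phi 3;
  trig_surj : forall t : vert target,
    exists v : vert (weightless G), morV phi (stab_vert stab v) = t }.

Definition trigonal_graph (g : nat) (G : wgraph) : Prop :=
  inhabited (trigonal_type G) /\ genus G = Posz g.

Section TrigonalType.
Variables (G : wgraph) (tau : trigonal_type G).

Definition piece (e : edge (source tau)) (e2 : edge G) : bool :=
  stab_piece (stab tau) e (inl e2).

Definition sim_closed (S : {set edge (source tau)}) : Prop :=
  forall e1 e2, sim (phi tau) e1 e2 -> e1 \in S -> e2 \in S.

(* The intersection of S with E(G): an edge of G is contracted when it is
   contracted in the refinement G_phi, that is, when all its pieces are. *)
Definition trace (S : {set edge (source tau)}) : {set edge G} :=
  [set e2 : edge G | [forall e, piece e e2 ==> (e \in S)]].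

(* The edge e1 of G is the edge e of G_phi. *)
Definition same_edge (e1 : edge G) (e : edge (source tau)) : Prop :=
  forall f, piece f e1 = (f == e).

Definition le_phi (e1 e2 : edge G) : Prop :=
  exists e e' : edge (source tau),
    [/\ same_edge e1 e', piece e e2 & sim (phi tau) e' e].

Definition eq_phi (e1 e2 : edge G) : Prop :=
  exists f1 f2 : edge (source tau),
    [/\ same_edge e1 f1, same_edge e2 f2 & sim (phi tau) f1 f2].

End TrigonalType.

Record trigonal_contraction (G H : wgraph) := TrigonalContraction {
  tc_type : trigonal_type G;
  tc_set : {set edge (source tc_type)};
  tc_closed : sim_closed tc_set;
  tc_map : wcontraction H (trace tc_set) }.

Definition maximal_trigonal (g : nat) (G : wgraph) : Prop :=
  trigonal_graph g G /\
  forall G' : wgraph, trigonal_graph g G' ->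
    inhabited (trigonal_contraction G' G) -> inhabited (wiso G' G).

Section Moduli.
Variable R : realType.

Local Open Scope ring_scope.
Local Open Scope classical_set_scope.

Definition cone_type (G : wgraph) (tau : trigonal_type G) :
    set {ptws edge G -> R} :=
  [set l | [/\ forall e, 0 < l e,
               forall e1 e2, le_phi tau e1 e2 -> l e1 <= l e2
             & forall e1 e2, eq_phi tau e1 e2 -> l e1 = l e2]].

Definition cone (G : wgraph) : set {ptws edge G -> R} :=
  [set l | exists tau : trigonal_type G, cone_type tau l].

Definition closed_cone (G : wgraph) : set {ptws edge G -> R} := closure (@cone G).

(* Extension of a length function by 0 on the contracted edges. *)
Definition face_map (H G : wgraph) (S : {set edge G}) (c : wcontraction H S)
    (l : {ptws edge H -> R}) : {ptws edge G -> R} :=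
  fun e => if [pick h | wcontraction_edge c h == e] is Some h then l h else 0.

(* Points before gluing; the colimit is taken on underlying sets. *)
Definition curve := {G : wgraph & {ptws edge G -> R}}.

Definition valid_curve (g : nat) (p : curve) : Prop :=
  trigonal_graph g (projT1 p) /\ closed_cone (projT2 p).

Inductive face (g : nat) : curve -> curve -> Prop :=
| Face (G H : wgraph) (c : trigonal_contraction G H) (l : {ptws edge H -> R}) :
    valid_curve g (existT _ H l) ->
    valid_curve g (existT _ G (face_map (tc_map c) l)) ->
    face g (existT _ H l) (existT _ G (face_map (tc_map c) l)).

Definition curve_class (g : nat) (p : curve) : curve -> Prop :=
  clos_refl_sym_trans curve (face g) p.

(* The set T_g^{trop,(3)}: the colimit of the closed cones, i.e. the quotient
   of their disjoint union by the equivalence relation generated by the face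
   morphisms; a point is an equivalence class. *)
Definition moduli (g : nat) (x : curve -> Prop) : Prop :=
  exists2 p : curve, valid_curve g p & x = curve_class g p.

(* The cell associated to (G, w): the image of the closed cone of (G, w). *)
Definition cell (g : nat) (G : wgraph) (x : curve -> Prop) : Prop :=
  moduli g x /\
  exists2 l : {ptws edge G -> R}, closed_cone l &
    x = curve_class g (existT _ G l).

Definition maximal_cell (g : nat) (C : (curve -> Prop) -> Prop) : Prop :=
  exists2 G : wgraph, maximal_trigonal g G & C = cell g G.

End Moduli.

Section Ladder.
Variable T : graph.

(* An edge added over the vertex j joins two of the three copies of j; it is
   encoded by the pair of copies. Distinct edges over j are non-parallel. *)
Definition rungs := vert T -> {set {set 'I_3}}.

Definition valid_rungs (r : rungs) : Prop :=
  forall j : vert T,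
    (forall P, P \in r j -> #|P| = 2) /\
    #|r j| = (if valence j == 2 then 1 else if valence j == 1 then 2 else 0).

Definition all_same_copies (r : rungs) : Prop :=
  exists P : {set 'I_3}, forall j : vert T, valence j = 2 -> r j = [set P].

Definition is_path : Prop := forall j : vert T, valence j <= 2.

Variable r : rungs.
Hypothesis r_valid : valid_rungs r.

Definition ladder_vert := (vert T * 'I_3)%type.
Definition ladder_edge :=
  (edge T * 'I_3 + {p : vert T * {set 'I_3} | p.2 \in r p.1})%type.

Definition ladder_ends (e : ladder_edge) : {set ladder_vert} :=
  match e with
  | inl (f, i) => [set (x, i) | x in ends f]
  | inr p => [set ((val p).1, i) | i in (val p).2]
  end.

Lemma card_ladder_ends e : 0 < #|ladder_ends e| <= 2.
Proof.
case: e => [[f i]|[[j P] /= Pj]] /=.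
  by rewrite card_imset ?card_ends // => x y [].
rewrite card_imset; last by move=> x y [].
by have [/(_ _ Pj) -> _] := r_valid j.
Qed.

Definition ladder : graph := Graph card_ladder_ends.

End Ladder.

(* G is (G_T)^st with zero weight, for a 3-ladder G_T constructed from a tree
   T with g vertices. *)
Definition ladder_graph (g : nat) (G : wgraph) : Prop :=
  (forall v : vert G, wt v = 0) /\
  exists (T : graph) (r : rungs T) (r_valid : valid_rungs r),
    [/\ is_tree T /\ 1 < #|vert T|,
        forall j : vert T, valence j <= 3,
        is_path T ->
          (exists2 r' : rungs T, valid_rungs r' & ~ all_same_copies r') ->
          ~ all_same_copies r,
        #|vert T| = g
      & inhabited (stabilization G (ladder r_valid))].

(* Main.v *)
Require Import Defs.
From Stdlib Require Import FunctionalExtensionality.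
From mathcomp Require Import classical_sets reals topology.
From mathcomp Require Import all_boot fingroup perm all_algebra zify.

Set Implicit Arguments.
Unset Strict Implicit.
Unset Printing Implicit Defensive.

(** A stable graph of genus [g] has at most [3g - 3] edges, so a trigonal graph
    with [3g - 3] edges is maximal; this settles ladder graphs, which are
    trivalent and are mapped to [T] by the projection of the 3-ladder.

    Conversely, 3-edge connectedness forces every edge of the target tree to
    have exactly three preimages, all of index 1: a trigonal type consists of
    three copies of the tree with some vertices over a common vertex identified
    and with vertical edges added. Identifications are contracted vertical
    edges ("rungs"). Splitting the vertices of the tree distributes the rungs
    until valence plus number of rungs is 3 everywhere, so every trigonal graph
    is a trigonal contraction of a ladder graph, to which it is isomorphic if
    it is maximal. *)

(** * Degrees and valences *)

(** The number three over an edge of the target tree comes from two opposite bounds: degree 3 with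
    positive indices allows at most three edges, while the edges of [G] with a piece above that tree
    edge separate [G], so they are at least three. The same count makes each of these three edges a
    piece of an edge of [G], which excludes pruned leaves and positive weights. Smoothing is
    inductive and leaves a free choice at each vertex of valence 2, so different sets of edges can
    be contracted to reach the same graph. The proof therefore works with [contr], the contraction
    of a forest, in which the chosen edge at such a vertex can be exchanged; a contraction onto a
    graph with all valences at least 3 then factors through any smoothing. A last obstacle is the
    clause on paths, that the rungs over vertices of valence 2 should not all use the same two
    copies if this can be avoided. The expansion of the tree does not control these pairs, so an
    offending ladder is replaced by another one with the same stabilization. *)

Lemma sum_sig (T : finType) (P : pred T) (F : T -> nat) :
  \sum_(u : {x | P x}) F (val u) = \sum_(x | P x) F x.
Proof.
rewrite [RHS](reindex_omap (val : {x | P x} -> T) insub) => [|x Px]; last by rewrite insubT.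
by apply: eq_bigl => u; rewrite valP valK eqxx.
Qed.

Section Degree.
Variable G : graph.
Implicit Types (e f h : edge G) (x y z : vert G) (S : {set edge G}).

(** The multiplicity of [x] as an end of [e]. With [degE] it is a sum over the two ends, so that
    loops need no separate case in counting arguments. *)
Definition deg e x : nat := (x \in ends e) * (if loop e then 2 else 1).

Lemma ends_pair e : exists a b, ends e = [set a; b].
Proof.
have /andP[gt0] := card_ends e.
rewrite leq_eqVlt => /orP[/cards2P[a [b [_ ->]]]|]; first by exists a, b.
rewrite ltnS => le1.
have /cards1P[a ->] : #|ends e| == 1 by rewrite eqn_leq le1.
by exists a, a; rewrite setUid.
Qed.

Lemma degE e a b x : ends e = [set a; b] -> deg e x = (x == a) + (x == b).
Proof.
move=> E; rewrite /deg /loop E !inE cards2.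
by case: (eqVneq a b) => [<-|ab] /=; case: eqVneq => // xa;
  case: eqVneq => // xb; rewrite -xa -xb eqxx in ab.
Qed.

Lemma valenceE x : valence x = \sum_e deg e x.
Proof.
rewrite /valence big_mkcond; apply: eq_bigr => e _; rewrite /deg.
by case: (x \in ends e) => //=; rewrite mul1n.
Qed.

Lemma deg_gt0 e x : (0 < deg e x) = (x \in ends e).
Proof. by rewrite /deg; case: (x \in ends e) => //=; case: loop. Qed.

Lemma deg_eq0 e x : x \notin ends e -> deg e x = 0.
Proof. by rewrite /deg => /negbTE ->. Qed.

Lemma sum_deg e : \sum_x deg e x = 2.
Proof.
have [a [b E]] := ends_pair e.
under eq_bigr do rewrite (degE _ E).
rewrite big_split /= (bigD1 a) //= eqxx big1 => [|i /negbTE-> //].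
by rewrite (bigD1 b) //= eqxx big1 => [|i /negbTE-> //].
Qed.

Lemma handshake : \sum_(x : vert G) valence x = 2 * #|edge G|.
Proof.
under eq_bigr do rewrite valenceE.
rewrite exchange_big /=; under eq_bigr do rewrite sum_deg.
by rewrite sum_nat_const mulnC.
Qed.

Lemma deg_le_valence e x : deg e x <= valence x.
Proof. by rewrite valenceE (bigD1 e) //= leq_addr. Qed.

Lemma deg2_le_valence e f x : e != f -> deg e x + deg f x <= valence x.
Proof.
by move=> ef; rewrite valenceE (bigD1 e) //= (bigD1 f) 1?eq_sym //= addnA leq_addr.
Qed.

Lemma other_end e x : x \in ends e -> exists y, ends e = [set x; y].
Proof.
have [a [b E]] := ends_pair e; rewrite E !inE => /orP[]/eqP->.
  by exists b.
by exists a; rewrite setUC.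
Qed.

Lemma pair_loop e x y : ends e = [set x; y] -> loop e = (x == y).
Proof. by rewrite /loop => ->; rewrite cards2; case: (x == y). Qed.

Section Valence2.
Variables (x y : vert G) (e f : edge G).
Hypotheses (val_x : valence x = 2) (ney : y != x) (ends_e : ends e = [set x; y])
  (x_f : x \in ends f) (nef : f != e).

Lemma val2_edges h : x \in ends h -> h = e \/ h = f.
Proof.
move=> xh; case: (eqVneq h e) => [|he]; first by left.
case: (eqVneq h f) => [|hf]; first by right.
have xe : x \in ends e by rewrite ends_e !inE eqxx.
have := valenceE x; rewrite (bigD1 e) //= (bigD1 f) //= (bigD1 h) /= ?he ?hf //.
have := xh; rewrite -deg_gt0; have := x_f; rewrite -deg_gt0.
have := xe; rewrite -deg_gt0; lia.
Qed.

Lemma val2_other_end : exists2 z, ends f = [set x; z] & z != x.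
Proof.
have [z E] := other_end x_f; exists z => //; apply/eqP => zx.
have xe : x \in ends e by rewrite ends_e !inE eqxx.
have := deg2_le_valence x nef; rewrite val_x (degE _ E) zx eqxx.
by have := xe; rewrite -deg_gt0; lia.
Qed.

End Valence2.

End Degree.

Section ContractNonloop.
Variables (G : graph) (e : edge G) (x y : vert G).
Hypotheses (ney : y != x) (ends_e : ends e = [set x; y]).
Local Notation proj := (contract_proj e y).

Lemma kept_vertE v : kept_vert e y v = (v != x).
Proof.
rewrite /kept_vert ends_e !inE negb_or.
by case: (eqVneq v y) => [->|]; rewrite ?ney //= andbT.
Qed.

Lemma val_proj v : val (proj v) = if v == x then y else v.
Proof.
rewrite /contract_proj val_insubd kept_vertE /=.
by case: eqP.
Qed.

Lemma proj_val (v : contract_vert e y) : proj (val v) = v.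
Proof. by apply: val_inj; rewrite val_proj; have := valP v; rewrite kept_vertE => /negbTE->. Qed.

Lemma val_neq (v : contract_vert e y) : val v != x.
Proof. by have := valP v; rewrite kept_vertE. Qed.

Lemma proj_xy : proj x = proj y.
Proof. by apply: val_inj; rewrite !val_proj eqxx (negbTE ney). Qed.

Lemma val_proj_neq v : v != x -> val (proj v) = v.
Proof. by rewrite val_proj => /negbTE->. Qed.

Lemma contract_ends_pair (h : contract_edge e) a b :
  ends (val h) = [set a; b] -> ends (h : edge (contract e y)) = [set proj a; proj b].
Proof. by rewrite /= /contract_ends => ->; rewrite imsetU1 imset_set1. Qed.

Lemma eq_proj (v : contract_vert e y) a :
  (v == proj a) = if val v == y then (a == x) || (a == y) else val v == a.
Proof.
rewrite -val_eqE val_proj; have := val_neq v.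
case: (eqVneq a x) => [->|ax] vx /=.
  by rewrite (negbTE vx); case: eqP.
by case: (eqVneq (val v) y) => [->|] //=; rewrite eq_sym.
Qed.

Lemma deg_contract (h : contract_edge e) (v : contract_vert e y) :
  deg (h : edge (contract e y)) v =
  deg (val h) (val v) + (if val v == y then deg (val h) x else 0).
Proof.
have [a [b E]] := ends_pair (val h).
rewrite (degE _ (contract_ends_pair E)) !(degE _ E) !eq_proj.
case: ifP => [/eqP ->|]; last by rewrite addn0.
by move: ney; rewrite !(eq_sym x) !(eq_sym y) => ney';
  case: (eqVneq a x) => [->|]; case: (eqVneq b x) => [->|] => /=;
  rewrite ?(eq_sym x) ?(negbTE ney); lia.
Qed.

Lemma sum_contract_edge (F : edge G -> nat) :
  \sum_(h : edge (contract e y)) F (val h) = \sum_(h | h != e) F h.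
Proof. exact: sum_sig. Qed.

Lemma valence_contract (v : contract_vert e y) :
  valence (v : vert (contract e y)) =
  if val v == y then valence x + valence y - 2 else valence (val v).
Proof.
rewrite valenceE; under eq_bigr do rewrite deg_contract.
rewrite big_split /= (sum_contract_edge (fun h => deg h (val v))).
rewrite (sum_contract_edge (fun h => if val v == y then deg h x else 0)).
rewrite !valenceE; rewrite [\sum_e0 deg e0 x](bigD1 e) //= [\sum_e0 deg e0 y](bigD1 e) //=.
rewrite [\sum_e0 deg e0 (val v)](bigD1 e) //= !(degE _ ends_e).
move: (sval v) (val_neq v : sval v != x) => u /negbTE ux.
rewrite !eqxx (eq_sym x) (negbTE ney) ux.
by case: (eqVneq u y) => [->|uy]; rewrite ?big1_eq; lia.
Qed.

Lemma card_contract_vert : #|vert (contract e y)|.+1 = #|vert G|.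
Proof.
have -> : #|vert (contract e y)| = #|[pred v | kept_vert e y v]| by rewrite /= card_sig.
have: #|[pred v | kept_vert e y v]| = #|predC1 x| by apply: eq_card => v; rewrite !inE kept_vertE.
by move=> ->; rewrite cardC1 prednK //; apply/card_gt0P; exists x.
Qed.

End ContractNonloop.

(** * Smoothing *)

(** Connectedness is handled through colourings of the vertices that are constant on the ends of
    each edge, rather than through paths: colourings are easily pulled back along contractions and
    modified at single vertices. *)
Definition const_on (T : finType) (C : Type) (f : T -> C) (A : {set T}) : Prop :=
  forall a b, a \in A -> b \in A -> f a = f b.

Lemma const_on_pair (T : finType) (C : Type) (f : T -> C) a b :
  f a = f b -> const_on f [set a; b].
Proof. by move=> E u v; rewrite !inE => /orP[]/eqP-> /orP[]/eqP->. Qed.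

Lemma const_on_comp (T U : finType) (C : Type) (g : T -> U) (f : U -> C) (A : {set T}) :
  const_on f (g @: A) -> const_on (f \o g) A.
Proof. by move=> c a b aA bA; apply: c; rewrite imset_f. Qed.

Section Colour.
Variable G : graph.
Implicit Types (S : {set edge G}).

Lemma connect_colour (C : Type) (F : vert G -> C) S x y :
  (forall e, e \notin S -> const_on F (ends e)) ->
  connect (adj_without S) x y -> F x = F y.
Proof.
move=> cF /connectP[p]; elim: p x => [|z p IH] x /= => [_ ->//|].
by move=> /andP[/existsP[e /and3P[eS xe ze]] /IH h /h <-]; apply: cF eS _ _ xe ze.
Qed.

Lemma adj_without_sym S : symmetric (adj_without S).
Proof.
by move=> x y; apply: eq_existsb => e; rewrite [(x \in _) && _]andbC.
Qed.

(** The colouring to test is membership in the component of [x]. *)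
Lemma colour_connect S x y :
  (forall F : vert G -> bool, (forall e, e \notin S -> const_on F (ends e)) -> F x = F y) ->
  connect (adj_without S) x y.
Proof.
move=> h; rewrite -(h (connect (adj_without S) x)) ?connect0 // => e eS a b ae be.
have ab : connect (adj_without S) a b.
  by apply: connect1; apply/existsP; exists e; rewrite eS ae be.
apply/idP/idP => xa; first exact: connect_trans ab.
by apply: connect_trans xa _; rewrite (sym_connect_sym (adj_without_sym S)).
Qed.

Lemma connected_colour (C : Type) (F : vert G -> C) :
  connected_graph G -> (forall e, const_on F (ends e)) -> forall x y, F x = F y.
Proof. by move=> [_ c] cF x y; apply: connect_colour (c x y) => e _. Qed.

Lemma colour_connected :
  0 < #|vert G| ->
  (forall F : vert G -> bool, (forall e, const_on F (ends e)) -> forall x y, F x = F y) ->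
  connected_graph G.
Proof.
by move=> n0 h; split=> // x y; apply: colour_connect => F cF; apply: h => e; apply: cF; rewrite inE.
Qed.

End Colour.

Lemma giso_deg (G H : graph) (a : giso G H) e x :
  deg (gisoE a e) (gisoV a x) = deg e x.
Proof.
have [u [v E]] := ends_pair e.
have E' : ends (gisoE a e) = [set gisoV a u; gisoV a v].
  by rewrite giso_ends E imsetU1 imset_set1.
by rewrite (degE _ E) (degE _ E') !(inj_eq (bij_inj (gisoV_bij a))).
Qed.

Lemma giso_valence (G H : graph) (a : giso G H) x : valence (gisoV a x) = valence x.
Proof.
rewrite !valenceE (reindex (gisoE a)) /=; last exact/onW_bij/gisoE_bij.
by apply: eq_bigr => e _; rewrite giso_deg.
Qed.

Section SmoothStep.
Variables (G : graph) (x y : vert G) (e f : edge G).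
Hypotheses (val_x : valence x = 2) (ney : y != x) (ends_e : ends e = [set x; y])
  (x_f : x \in ends f) (nef : f != e).
Local Notation proj := (contract_proj e y).

(** This is the term by which [smooth_piece] passes to the contracted graph: the lost edge [e] is
    replaced by [f]. *)
Definition smooth_cast (h : edge G) : contract_edge e :=
  insubd (exist _ f nef : contract_edge e) h.

Lemma val_smooth_cast h : val (smooth_cast h) = if h == e then f else h.
Proof. by rewrite /smooth_cast val_insubd; case: eqP. Qed.

Lemma smooth_castK (h : contract_edge e) : smooth_cast (val h) = h.
Proof. by apply: val_inj; rewrite val_smooth_cast (negbTE (valP h)). Qed.

Lemma x_ends_e : x \in ends e. Proof. by rewrite ends_e !inE eqxx. Qed.
Lemma y_ends_e : y \in ends e. Proof. by rewrite ends_e !inE eqxx orbT. Qed.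

Lemma ends_contract (h : contract_edge e) z :
  z \in ends (val h) -> proj z \in ends (h : edge (contract e y)).
Proof. by move=> zh; apply: imset_f. Qed.

Lemma ends_smooth_cast h z :
  z \in ends h -> z != x -> proj z \in ends (smooth_cast h : edge (contract e y)).
Proof.
move=> zh zx; case: (eqVneq h e) => [he|he]; last first.
  by apply: ends_contract; rewrite val_smooth_cast (negbTE he).
have -> : z = y by move: zh; rewrite he ends_e !inE (negbTE zx) => /eqP.
rewrite -(proj_xy ney ends_e); apply: ends_contract.
by rewrite val_smooth_cast he eqxx.
Qed.

(** The only incidence that the contraction creates is that of [f] with [y]; before the contraction
    it is witnessed by [e]. *)
Lemma ends_smooth_lift (h : edge (contract e y)) v : v \in ends h ->
  exists2 h', val v \in ends h' & h' = val h \/ h' = e /\ val h = f.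
Proof.
move=> /imsetP[z zh ->]; rewrite (val_proj ney ends_e).
case: (eqVneq z x) => [zx|_]; last by exists (val h); auto.
exists e; first exact: y_ends_e.
right; split=> //; rewrite zx in zh.
by have [E|//] := val2_edges val_x ney ends_e x_f nef zh; have := valP h; rewrite E eqxx.
Qed.

Lemma valence_smooth (v : vert (contract e y)) : valence v = valence (val v).
Proof.
rewrite (valence_contract ney ends_e) val_x; case: eqP => // ->.
by rewrite addKn.
Qed.

Lemma connected_contract : connected_graph G -> connected_graph (contract e y).
Proof.
move=> c; apply: colour_connected => [|F cF u v].
  by apply/card_gt0P; exists (proj y).
rewrite -(proj_val ney ends_e u) -(proj_val ney ends_e v).
apply: (connected_colour (F := F \o proj)) => // h.
case: (eqVneq h e) => [->|he].
  by rewrite ends_e; apply: const_on_pair; rewrite /= (proj_xy ney ends_e).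
exact: const_on_comp (cF (exist _ h he)).
Qed.

End SmoothStep.

Section Smoothing.
Variable K : graph.

Lemma smooth_vert_valence G (s : smoothing K G) u : valence (smooth_vert s u) = valence u.
Proof.
elim: s => {G} [G a nv|G x y e f vx ney Ee xf nef s IH] /=; first exact: giso_valence.
by rewrite -IH (valence_smooth vx ney Ee).
Qed.

Lemma smooth_vert_onto G (s : smoothing K G) x :
  valence x != 2 -> exists u, smooth_vert s u = x.
Proof.
elim: s x => {G} [G a nv|G x y e f vx ney Ee xf nef s IH] /= z vz.
  by have [b _ ab] := gisoV_bij a; exists (b z).
have zx : z != x by apply: contraNneq vz => ->; rewrite vx.
have E := val_proj_neq ney Ee zx.
have [|u Eu] := IH (contract_proj e y z).
  by rewrite (valence_smooth vx ney Ee) E.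
by exists u; rewrite Eu.
Qed.

Lemma smoothed_valence G (s : smoothing K G) (u : vert K) : valence u != 2.
Proof.
elim: s => {G} [G a nv|//]; rewrite -(giso_valence a); exact: nv.
Qed.

Lemma smooth_piece_fun G (s : smoothing K G) h :
  exists k, forall k', smooth_piece s h k' = (k' == k).
Proof.
elim: s h => {G} [G a nv|G x y e f vx ney Ee xf nef s IH] /= h; last exact: IH.
have [b ba ab] := gisoE_bij a; exists (b h) => k.
by apply/eqP/eqP => [->|->]; rewrite ?ab ?ba.
Qed.

Fixpoint smooth_rep G (s : smoothing K G) : edge K -> edge G :=
  match s with
  | SmoothDone a _ => gisoE a
  | SmoothStep _ _ _ _ _ _ _ _ _ s' => fun k => val (smooth_rep s' k)
  end.

Lemma smooth_rep_piece G (s : smoothing K G) k : smooth_piece s (smooth_rep s k) k.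
Proof.
elim: s => {G} [G a nv|G x y e f vx ney Ee xf nef s IH] /=; first exact: eqxx.
by rewrite -/(smooth_cast nef _) smooth_castK.
Qed.

Lemma smooth_piece_ends G (s : smoothing K G) h k u :
  smooth_piece s h k -> smooth_vert s u \in ends h -> u \in ends k.
Proof.
elim: s h => {G} [G a nv|G x y e f vx ney Ee xf nef s IH] /= h.
  by move=> /eqP->; rewrite giso_ends mem_imset //; exact/bij_inj/gisoV_bij.
rewrite -/(smooth_cast nef h) => ph uh; apply: IH ph _.
rewrite -(proj_val ney Ee (smooth_vert s u)).
exact: (ends_smooth_cast ney Ee xf) (uh) (val_neq ney Ee _).
Qed.

Lemma smooth_piece_adj G (s : smoothing K G) h1 h2 k z :
  valence z = 2 -> z \in ends h1 -> z \in ends h2 ->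
  smooth_piece s h1 k -> smooth_piece s h2 k.
Proof.
elim: s h1 h2 z => {G} [G a nv|G x y e f vx ney Ee xf nef s IH] /= h1 h2 z vz z1 z2.
  by have := nv z; rewrite vz eqxx.
rewrite -/(smooth_cast nef h1) -/(smooth_cast nef h2).
case: (eqVneq z x) => [zx|zx]; last first.
  apply: (IH _ _ (contract_proj e y z)); last 2 first.
  - exact: (ends_smooth_cast ney Ee xf).
  - exact: (ends_smooth_cast ney Ee xf).
  by rewrite (valence_smooth vx ney Ee) (val_proj_neq ney Ee).
have cf h : x \in ends h -> smooth_cast nef h = smooth_cast nef f.
  move=> /(val2_edges vx ney Ee xf nef)[->|->//].
  by apply: val_inj; rewrite !val_smooth_cast eqxx (negbTE nef).
by rewrite zx in z1 z2; rewrite (cf _ z1) (cf _ z2).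
Qed.

(* The pieces of an edge form a class of the equivalence relation generated by
   sharing a vertex of valence 2. *)
Lemma smooth_piece_ind (C : Type) G (s : smoothing K G) (g : edge G -> C) :
  (forall z h1 h2, valence z = 2 -> z \in ends h1 -> z \in ends h2 -> g h1 = g h2) ->
  forall h1 h2 k, smooth_piece s h1 k -> smooth_piece s h2 k -> g h1 = g h2.
Proof.
elim: s g => {G} [G a nv|G x y e f vx ney Ee xf nef s IH] /= g gP h1 h2 k.
  by move=> /eqP-> /eqP->.
rewrite -/(smooth_cast nef h1) -/(smooth_cast nef h2) => p1 p2.
have gef : g f = g e by apply: (gP x) => //; exact: x_ends_e Ee.
have gc h : g (val (smooth_cast nef h)) = g h.
  by rewrite val_smooth_cast; case: eqP => // ->.
rewrite -gc -(gc h2); apply: (IH (g \o val)) p1 p2 => z h h' vz.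
rewrite (valence_smooth vx ney Ee) in vz.
move=> /(ends_smooth_lift vx ney Ee xf nef)[i zi Ei].
move=> /(ends_smooth_lift vx ney Ee xf nef)[j zj Ej] /=.
have := gP _ _ _ vz zi zj.
by case: Ei => [->|[-> ->]]; case: Ej => [->|[-> ->]] //; rewrite ?gef.
Qed.

(** Undoing a smoothing step, one has to colour [x]. If [e] is in [S], it takes the colour of [y].
    Otherwise [e] is allowed to change colour: [x] takes the colour of its neighbour along [f], and
    the recursive call drops the merged edge from the set. *)
Lemma smooth_extend (C : Type) G (s : smoothing K G) (S : {set edge G}) (c : vert K -> C) :
  (forall k, (forall h, smooth_piece s h k -> h \in S) -> const_on c (ends k)) ->
  exists2 F : vert G -> C, forall u, F (smooth_vert s u) = c u &
    forall h, h \in S -> const_on F (ends h).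
Proof.
elim: s S => {G} [G a nv|G x y e f vx ney Ee xf nef s IH] /= S cS.
  have [b ba ab] := gisoV_bij a; have [b' ba' ab'] := gisoE_bij a.
  exists (c \o b) => [u|h hS] /=; first by rewrite ba.
  have cb : const_on c (ends (b' h)) by apply: cS => h' /eqP->; rewrite ab'.
  move=> u v uh vh /=; rewrite -(ab' h) giso_ends in uh vh.
  by move: uh vh => /imsetP[u' uh ->] /imsetP[v' vh ->]; rewrite !ba; apply: cb.
case: (boolP (e \in S)) => eS.
  have [|F Fs FS] := IH [set h | val h \in S].
    move=> k kS; apply: cS => h /kS; rewrite inE -/(smooth_cast nef h) val_smooth_cast.
    by case: eqP => // ->.
  exists (F \o contract_proj e y) => [u|h hS] /=; first by rewrite (proj_val ney Ee).
  case: (eqVneq h e) => [->|he].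
    by rewrite Ee; apply: const_on_pair; rewrite /= (proj_xy ney Ee).
  by apply: const_on_comp (FS (exist _ h he) _); rewrite inE.
have [z0 Ef z0x] := val2_other_end vx ney Ee xf nef.
have [|F Fs FS] := IH [set h | (val h \in S) && (val h != f)].
  move=> k kS; apply: cS => h /kS; rewrite inE -/(smooth_cast nef h) val_smooth_cast.
  by case: eqP; rewrite ?eqxx ?andbF // => _ /andP[].
exists (fun z => F (contract_proj e y (if z == x then z0 else z))) => [u|h hS] /=.
  by rewrite (negbTE (val_neq ney Ee _)) (proj_val ney Ee).
have he : h != e by apply: contraNneq eS => <-.
case: (eqVneq h f) => [->|hf].
  by rewrite Ef; apply: const_on_pair; rewrite eqxx (negbTE z0x).
have xh z : z \in ends h -> z == x = false.
  apply: contraTF => /eqP->; apply: contraNN he.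
  by move/(val2_edges vx ney Ee xf nef) => [->//|E]; rewrite E eqxx in hf.
move=> u v uh vh; rewrite !xh //.
by apply: (FS (exist _ h he)); rewrite ?inE /= ?hS //; apply: imset_f.
Qed.

End Smoothing.

Lemma giso_refl (G : graph) : giso G G.
Proof.
exists (fun v => v) (fun e => e); [by exists id|by exists id|move=> e].
by rewrite imset_id.
Defined.

(** A vertex of valence other than 2 excludes cycles, which cannot be smoothed: a loop at a vertex
    of valence 2 makes that vertex a component of its own, hence the whole graph. *)
Lemma smoothing_exists n G : #|vert G| <= n -> connected_graph G ->
  (exists x : vert G, valence x != 2) -> exists K, inhabited (smoothing K G).
Proof.
elim: n G => [|n IH] G.
  by move=> n0 [c _]; rewrite leqNgt c in n0.
move=> nG cG [x0 vx0].
have [/existsP[x /eqP vx]|/existsPn nv] := boolP [exists x : vert G, valence x == 2]; last first.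
  by exists G; constructor; apply: SmoothDone (giso_refl G) _ => x; apply: nv.
have [e xe] : exists e : edge G, x \in ends e.
  apply/existsP; apply: contra_eqT vx => /existsPn h.
  by rewrite valenceE big1 // => e _; apply: deg_eq0.
have [y Ee] := other_end xe.
have := valenceE x; rewrite vx (bigD1 e) //= (degE _ Ee) eqxx.
case: (eqVneq y x) => [yx|ney] s2.
  suff E : x0 == x by rewrite (eqP E) vx in vx0.
  have : (x == x) = (x0 == x); last by rewrite eqxx => <-.
  apply: (connected_colour (F := fun z => z == x)) => // h.
  case: (eqVneq h e) => [->|he]; first by rewrite Ee yx; apply: const_on_pair.
  have xh : x \notin ends h.
    rewrite -deg_gt0 -leqNgt; move: s2.
    by rewrite (bigD1 h) //=; lia.
  have nx a : a \in ends h -> (a == x) = false by apply: contraTF => /eqP->.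
  by move=> a b /nx-> /nx->.
have [f xf nef] : exists2 f, x \in ends f & f != e.
  have [f /andP[nef xf]|none] := pickP [pred f | (f != e) && (x \in ends f)]; first by exists f.
  move: s2; rewrite big1 // => f nef.
  by apply: deg_eq0; have := none f; rewrite /= nef => /= ->.
have [||K [s]] := IH (contract e y) _ (connected_contract ney Ee cG).
- by rewrite -ltnS (card_contract_vert ney Ee).
- exists (contract_proj e y x0); rewrite (valence_smooth vx ney Ee).
  by rewrite (val_proj_neq ney Ee) //; apply: contraNneq vx0 => ->; rewrite vx.
by exists K; constructor; apply: SmoothStep vx ney Ee xf nef s.
Qed.

(** * Contractions of forests *)

(* G' is obtained from G by contracting the forest S; the last field says that
   S is a forest. *)
Record contr (G G' : graph) (S : {set edge G}) (q : vert G -> vert G')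
    (psi : edge G' -> edge G) : Prop := Contr {
  contr_onto : forall z, exists x, q x = z;
  contr_inj : injective psi;
  contr_in : forall e, (e \in S) = (e \notin codom psi);
  contr_ends : forall h, ends h = q @: ends (psi h);
  contr_const : forall e, e \in S -> const_on q (ends e);
  contr_fib : forall x y, q x = q y -> connect (adj_without (~: S)) x y;
  contr_card : #|vert G| = #|vert G'| + #|S| }.

(** [adj_without (~: S)] walks along the edges of [S] only; this expresses connectedness inside the
    contracted forest. *)
Lemma in_connect_colour (G : graph) (C : Type) (F : vert G -> C) (S : {set edge G}) x y :
  (forall e, e \in S -> const_on F (ends e)) ->
  connect (adj_without (~: S)) x y -> F x = F y.
Proof. by move=> cF; apply: connect_colour => e; rewrite inE negbK; apply: cF. Qed.

Lemma in_colour_connect (G : graph) (S : {set edge G}) x y :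
  (forall F : vert G -> bool, (forall e, e \in S -> const_on F (ends e)) -> F x = F y) ->
  connect (adj_without (~: S)) x y.
Proof.
move=> h; apply: colour_connect => F cF; apply: h => e eS; apply: cF.
by rewrite inE eS.
Qed.

Section Rank.
Variable G : graph.
Implicit Types (S : {set edge G}).

(** If [x] reaches neither end of [e] without using [e], its component without [e] is closed under
    all edges of [S]. *)
Lemma connect_rem S e x y a b : ends e = [set a; b] -> 
  connect (adj_without (~: S)) x y ->
  [\/ connect (adj_without (~: (S :\ e))) x y,
      connect (adj_without (~: (S :\ e))) a x |
      connect (adj_without (~: (S :\ e))) b x].
Proof.
move=> E xy; set r := adj_without _.
have sr : connect_sym r by apply: sym_connect_sym; apply: adj_without_sym.
case: (boolP (connect r a x)) => [|ax]; first by constructor 2.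
case: (boolP (connect r b x)) => [|bx]; first by constructor 3.
constructor 1; rewrite -(in_connect_colour (F := connect r x) _ xy) ?connect0 // => h hS u v uh vh.
case: (eqVneq h e) => [he|he]; last first.
  have uv : connect r u v.
    by apply: connect1; apply/existsP; exists h; rewrite !inE negbK he hS uh vh.
  apply/idP/idP => xu; apply: connect_trans xu _ => //; by rewrite sr.
by move: uh vh; rewrite he E !inE => /orP[]/eqP-> /orP[]/eqP->; rewrite !(sr x) ?(negbTE ax) ?(negbTE bx).
Qed.

(** One edge lowers the number of components by at most one. When [e] is deleted in the induction,
    the component that now contains [a] receives the additional label [None]. *)
Lemma rank_le S (W : finType) (q : vert G -> W) :
  (forall x y, q x = q y -> connect (adj_without (~: S)) x y) ->
  #|vert G| <= #|W| + #|S|.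
Proof.
have [n] := ubnP #|S|; elim: n S W q => // n IH S W q Sn qS.
have [S0|[e eS]] := set_0Vmem S.
  rewrite S0 cards0 addn0; apply: (leq_card q) => x y /qS.
  by apply: (in_connect_colour (F := id)) => e; rewrite S0 inE.
have [a [b E]] := ends_pair e.
rewrite (cardsD1 e) eS add1n addnS -addSn.
pose q' x := if connect (adj_without (~: (S :\ e))) a x then None else Some (q x).
have := IH (S :\ e) (option W) q'; rewrite card_option; apply.
  by move: Sn; rewrite (cardsD1 e) eS.
have sr : connect_sym (adj_without (~: (S :\ e))) by apply: sym_connect_sym; apply: adj_without_sym.
move=> x y; rewrite /q'.
case: ifPn => ax; case: ifPn => ay //.
  by move=> _; apply: connect_trans ay; rewrite sr.
move=> [/qS xy].
have [//|ax'|bx] := connect_rem E xy; first by rewrite ax' in ax.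
have yx : connect (adj_without (~: S)) y x.
  by rewrite (sym_connect_sym (adj_without_sym _)).
have [|ay'|by_] := connect_rem E yx; first by rewrite sr.
  by rewrite ay' in ay.
by apply: connect_trans by_; rewrite sr.
Qed.

Lemma ends_nonempty (e : edge G) : exists x, x \in ends e.
Proof. by have /andP[/card_gt0P] := card_ends e. Qed.

Definition end1 (e : edge G) : vert G := xchoose (ends_nonempty e).

Lemma end1P e : end1 e \in ends e. Proof. exact: xchooseP. Qed.

End Rank.

Section ContrTheory.
Variables (G G' : graph) (S : {set edge G}) (q : vert G -> vert G') (psi : edge G' -> edge G).
Hypothesis c : contr S q psi.

Lemma contr_psi h : psi h \notin S.
Proof. by rewrite (contr_in c) negbK codom_f. Qed.

Lemma contr_psi_ex e : e \notin S -> exists h, psi h = e.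
Proof. by rewrite (contr_in c) negbK => /codomP[h ->]; exists h. Qed.

Lemma contr_card_edge : #|edge G| = #|edge G'| + #|S|.
Proof.
rewrite -(cardC (mem S)) addnC; congr (_ + _).
rewrite -(card_codom (contr_inj c)); apply: eq_card => e.
by rewrite !inE (contr_in c) negbK.
Qed.

Lemma contr_ends_in x h : x \in ends (psi h) -> q x \in ends h.
Proof. by move=> xh; rewrite (contr_ends c) imset_f. Qed.

(** A loop could be deleted from [S] without disconnecting any fibre, and [rank_le] would then
    contradict the count [contr_card]. *)
Lemma contr_nonloop e : e \in S -> ~~ loop e.
Proof.
move=> eS; apply/negP => le.
have /(rank_le (S := S :\ e)) : forall x y, q x = q y -> connect (adj_without (~: (S :\ e))) x y.
  move=> x y /(contr_fib c) xy; apply: in_colour_connect => F cF.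
  apply: in_connect_colour xy => h hS; case: (eqVneq h e) => [->|he].
    by move: le => /cards1P[u ->] a b; rewrite !inE => /eqP-> /eqP->.
  by apply: cF; rewrite !inE he.
have := contr_card c; rewrite [#|S|](cardsD1 e) eS; lia.
Qed.

Definition fibre_edges z : {set edge G} := [set e in S | q (end1 e) == z].

(** This is [rank_le] for the map [p] that collapses the fibre to [None] and keeps all other
    vertices apart. *)
Lemma card_fibre_le z : #|[set x | q x == z]| <= #|fibre_edges z|.+1.
Proof.
pose p x : option {x | q x != z} := insub x.
have /(rank_le (S := fibre_edges z) (q := p)) :
    forall x y, p x = p y -> connect (adj_without (~: fibre_edges z)) x y.
  move=> x y; rewrite /p.
  case: (boolP (q x == z)) => [qx|qx]; last first.
    rewrite insubT; case: insubP => // u _ <- [<-]; exact: connect0.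
  rewrite insubN ?qx //; case: insubP => // /negPn/eqP qy _.
  have /(contr_fib c) xy : q x = q y by rewrite qy (eqP qx).
  apply: in_colour_connect => F cF.
  have := @in_connect_colour _ _ (fun v => if q v == z then F v else true) _ _ _ _ xy.
  rewrite qx qy eqxx; apply => e eS a b ae be.
  have eq_q u : u \in ends e -> q u = q (end1 e).
    by move=> ue; apply: (contr_const c eS) => //; apply: end1P.
  rewrite !eq_q //; case: eqP => // qz.
  by apply: (cF e) => //; rewrite inE eS; apply/eqP.
rewrite card_option card_sig addSn -addnS.
rewrite -[#|vert G|](cardsC [set x | q x == z]).
have -> : #|~: [set x | q x == z]| = #|[pred x | q x != z]|.
  by apply: eq_card => x; rewrite !inE.
lia.
Qed.

Lemma sum_card_fibre : \sum_z #|[set x | q x == z]| = #|vert G|.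
Proof.
rewrite -[RHS]sum1_card (partition_big q predT) //=; apply: eq_bigr => z _.
by rewrite -sum1_card; apply: eq_bigl => x; rewrite inE.
Qed.

Lemma sum_card_fibre_edges : \sum_z #|fibre_edges z| = #|S|.
Proof.
rewrite -[RHS]sum1_card (partition_big (q \o @end1 G) predT) //=; apply: eq_bigr => z _.
by rewrite -sum1_card; apply: eq_bigl => x; rewrite inE.
Qed.

(** The inequalities [card_fibre_le] add up to the equality [contr_card], so each of them is sharp:
    every fibre is a tree. *)
Lemma card_fibre z : #|[set x | q x == z]| = #|fibre_edges z|.+1.
Proof.
have le := fun z => card_fibre_le z.
have E : \sum_z #|[set x | q x == z]| = \sum_z #|fibre_edges z|.+1.
  rewrite sum_card_fibre (contr_card c) -sum_card_fibre_edges.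
  under [RHS]eq_bigr do rewrite -add1n.
  by rewrite big_split /= sum1_card.
apply/eqP; rewrite eqn_leq le /= leqNgt; apply/negP => lt.
move: E; rewrite (bigD1 z) //= [in RHS](bigD1 z) //=.
have : \sum_(i | i != z) #|[set x | q x == i]| <= \sum_(i | i != z) #|fibre_edges i|.+1.
  by apply: leq_sum.
lia.
Qed.

Lemma sum_deg_fibre e a b z : ends e = [set a; b] ->
  \sum_(x | q x == z) deg e x = (q a == z) + (q b == z).
Proof.
move=> E; under eq_bigr do rewrite (degE _ E).
rewrite big_split /=; congr (_ + _).
- rewrite big_mkcond (bigD1 a) //= eqxx big1 ?addn0; first by case: eqP.
  by move=> i /negbTE->; case: ifP.
- rewrite big_mkcond (bigD1 b) //= eqxx big1 ?addn0; first by case: eqP.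
  by move=> i /negbTE->; case: ifP.
Qed.

Lemma sum_valence_fibre z :
  \sum_(x | q x == z) valence x = valence z + 2 * #|fibre_edges z|.
Proof.
under eq_bigr do rewrite valenceE.
rewrite exchange_big /= (bigID (mem S)) /= addnC; congr (_ + _); last first.
  rewrite mulnC -sum_nat_const big_mkcond [RHS]big_mkcond; apply: eq_bigr => e _.
  rewrite inE; case: (boolP (e \in S)) => //= eS.
  have [a [b E]] := ends_pair e; rewrite (sum_deg_fibre _ E).
  have -> : q a = q (end1 e) by apply: (contr_const c eS); rewrite ?end1P // E !inE eqxx.
  have -> : q b = q (end1 e) by apply: (contr_const c eS); rewrite ?end1P // E !inE eqxx orbT.
  by case: eqP.
rewrite valenceE.
transitivity (\sum_(e in psi @: setT) \sum_(x | q x == z) deg e x).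
  apply: eq_bigl => e; rewrite (contr_in c) negbK.
  by apply/codomP/imsetP => [[h ->]|[h _ ->]]; exists h.
rewrite big_imset /=; last by move=> h h' _ _; apply: (contr_inj c).
rewrite big_mkcond; apply: eq_bigr => h _; rewrite inE.
have [a [b E]] := ends_pair (psi h); rewrite (sum_deg_fibre _ E).
have E' : ends h = [set q a; q b] by rewrite (contr_ends c) E imsetU1 imset_set1.
by rewrite (degE _ E') !(eq_sym z).
Qed.

(** The edges inside a fibre are one fewer than its vertices, and each of them uses up two of the
    total valence. The lower bound on valences keeps the truncated subtraction exact. *)
Lemma sum_excess_fibre z : (forall x : vert G, 2 <= valence x) ->
  \sum_(x | q x == z) (valence x - 2) + 2 = valence z.
Proof.
move=> v2; have := sum_valence_fibre z; have := card_fibre z.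
rewrite -sum1_card (eq_bigl (fun x => q x == z)); last by move=> x; rewrite inE.
have -> : \sum_(x | q x == z) valence x =
    \sum_(x | q x == z) (valence x - 2) + 2 * \sum_(x | q x == z) 1.
  by rewrite big_distrr /= -big_split; apply: eq_bigr => x _ /=; have := v2 x; lia.
by move=> ->; lia.
Qed.

Lemma contr_valence2 x : (forall x : vert G, 2 <= valence x) ->
  valence (q x) = 2 -> valence x = 2.
Proof.
move=> v2; rewrite -(sum_excess_fibre _ v2) (bigD1 x) //=.
by have := v2 x; lia.
Qed.

Lemma contr_valence_ge4 x y : (forall x : vert G, 2 <= valence x) ->
  x != y -> q x = q y -> 3 <= valence x -> 3 <= valence y -> 4 <= valence (q x).
Proof.
move=> v2 xy E vx vy; rewrite -(sum_excess_fibre _ v2) (bigD1 x) //= (bigD1 y) /=; last first.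
  by rewrite E eqxx eq_sym.
lia.
Qed.

End ContrTheory.

Lemma contr_comp (G1 G2 G3 : graph) S1 S2 (q1 : vert G1 -> vert G2) (q2 : vert G2 -> vert G3) psi1 psi2 :
  contr S1 q1 psi1 -> contr S2 q2 psi2 ->
  contr (S1 :|: psi1 @: S2) (q2 \o q1) (psi1 \o psi2).
Proof.
move=> c1 c2; split.
- move=> z; have [y <-] := contr_onto c2 z; have [x <-] := contr_onto c1 y.
  by exists x.
- exact: inj_comp (contr_inj c1) (contr_inj c2).
- move=> e; rewrite inE; apply/orP/idP => [[eS|/imsetP[h hS ->]]|].
  + apply/codomP => [[k /= E]]; have := contr_psi c1 (psi2 k).
    by rewrite -E eS.
  + apply/codomP => [[k /= /(contr_inj c1) E]]; have := contr_psi c2 k.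
    by rewrite -E hS.
  + move=> ne; case: (boolP (e \in S1)) => [|/(contr_psi_ex c1)[h E]]; [by left|right].
    rewrite -E; apply: imset_f; rewrite (contr_in c2); apply: contraNN ne.
    by move=> /codomP[k hk]; apply/codomP; exists k; rewrite /= -hk.
- by move=> h; rewrite (contr_ends c2) (contr_ends c1) imset_comp.
- move=> e; rewrite inE => /orP[eS|/imsetP[h hS ->]] a b ae be /=.
    by rewrite (contr_const c1 eS ae be).
  by apply: (contr_const c2 hS); apply: (contr_ends_in c1).
- move=> x y /= /(contr_fib c2) E; apply: in_colour_connect => F cF.
  (* A colouring of [G1] that is constant on [S1] is constant on the fibres of [q1], so it descends
     to [G2] along a section [r]. *)
  have [r rK] : exists r : vert G2 -> vert G1, forall z, q1 (r z) = z.
    by apply: (fin_all_exists (P := fun z x => q1 x = z)); apply: (contr_onto c1).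
  have Fq a b : q1 a = q1 b -> F a = F b.
    by move/(contr_fib c1); apply: in_connect_colour => e eS; apply: cF; rewrite inE eS.
  have Fr a : F (r (q1 a)) = F a by apply: Fq; rewrite rK.
  rewrite -Fr -(Fr y); apply: (in_connect_colour (F := F \o r) _ E) => h hS u v.
  rewrite (contr_ends c1) => /imsetP[a ah ->] /imsetP[b bh ->] /=; rewrite !Fr.
  by apply: (cF (psi1 h)) => //; rewrite inE imset_f // orbT.
- rewrite (contr_card c1) (contr_card c2) cardsU.
  rewrite (card_imset _ (contr_inj c1)).
  have -> : S1 :&: psi1 @: S2 = set0.
    apply/setP => e; rewrite !inE; apply/negP => /andP[eS /imsetP[h _ E]].
    by have := contr_psi c1 h; rewrite -E eS.
  by rewrite cards0; lia.
Qed.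

Lemma contr_giso (G G' : graph) (a : giso G G') :
  exists2 psi, cancel psi (gisoE a) & contr (@set0 (edge G)) (gisoV a) psi.
Proof.
have [b' ba' ab'] := gisoE_bij a; have [b ba ab] := gisoV_bij a.
exists b' => //; split.
- by move=> z; exists (b z).
- exact: can_inj ab'.
- by move=> e; rewrite inE; apply/esym/negbTE; rewrite negbK; apply/codomP; exists (gisoE a e).
- by move=> h; rewrite -giso_ends ab'.
- by move=> e; rewrite inE.
- by move=> x y /(can_inj ba)->; apply: connect0.
- by rewrite cards0 addn0; apply: bij_eq_card (gisoV_bij a).
Qed.

Lemma giso_contr (G G' : graph) (q : vert G -> vert G') psi :
  contr (@set0 (edge G)) q psi ->
  exists2 a : giso G' G, gisoE a =1 psi & cancel (gisoV a) q.
Proof.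
move=> c.
have qi : injective q.
  move=> x y /(contr_fib c); apply: (in_connect_colour (F := id)) => e.
  by rewrite inE.
have qb : bijective q by apply: inj_card_bij => //; rewrite (contr_card c) cards0 addn0.
have pb : bijective psi.
  by apply: inj_card_bij; rewrite ?(contr_card_edge c) ?cards0 ?addn0 //; apply: contr_inj c.
have [r qr rq] := qb.
have rb : bijective r by exists q.
have Er e : ends (psi e) = [set r x | x in ends e].
  by rewrite (contr_ends c) -imset_comp (eq_imset _ (qr : r \o q =1 id)) imset_id.
by exists (GIso rb pb Er).
Qed.

Lemma contr_contract (G : graph) (e : edge G) x y : y != x -> ends e = [set x; y] ->
  contr [set e] (contract_proj e y : _ -> vert (contract e y)) (val : edge (contract e y) -> _).
Proof.
move=> ney E; split.
- by move=> z; exists (val z); rewrite (proj_val ney E).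
- exact: val_inj.
- move=> h; rewrite in_set1; apply/eqP/negP => [-> /codomP[k Ek]|nk].
    by have := valP k; rewrite -Ek eqxx.
  by apply/eqP/negPn/negP => he; apply: nk; apply/codomP; exists (exist _ h he).
- by [].
- by move=> h; rewrite inE => /eqP->; rewrite E; apply: const_on_pair; apply: (proj_xy ney E).
- move=> u v E'; apply: in_colour_connect => F cF.
  have Exy : F x = F y by apply: (cF e); rewrite ?inE // E !inE eqxx ?orbT.
  have Fp z : F z = F (val (contract_proj e y z)).
    by rewrite (val_proj ney E); case: eqP => // ->.
  by rewrite Fp E' -Fp.
- by rewrite cards1 addn1 (card_contract_vert ney E).
Qed.

(** The piece [smooth_rep s k] is the one that survives all the contractions, which is why it serves
    as the edge map. *)
Lemma contr_smoothing (K G : graph) (s : smoothing K G) :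
  exists S q, contr S q (smooth_rep s).
Proof.
elim: s => {G} [G a nv|G x y e f vx ney Ee xf nef s [S [q c]]] /=.
  (* The contraction has to go from [G] to [K] with edge map exactly [gisoE a]; it is obtained from
     the inverse isomorphism [b]. *)
  have [b [bi ib]] : exists b : giso G K, cancel (gisoE a) (gisoE b) /\ cancel (gisoE b) (gisoE a).
    have [psi psiK c] := contr_giso a.
    have [b Eb _] := giso_contr c.
    exists b; split; last by move=> e; rewrite Eb psiK.
    have pi : injective psi by apply: can_inj psiK.
    move=> e; rewrite Eb; apply: (bij_inj (gisoE_bij a)); exact: psiK.
  have [psi psiK c] := contr_giso b.
  exists set0, (gisoV b).
  have E : psi =1 gisoE a by move=> e; rewrite -{2}(psiK e) ib.
  case: c => o i inS en co fi ca; split=> //.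
  - by exact/bij_inj/gisoE_bij.
  - by move=> e; rewrite inS (eq_codom E).
  - by move=> h; rewrite -E.
have := contr_comp (contr_contract ney Ee) c.
by exists ([set e] :|: val @: S), (q \o contract_proj e y).
Qed.

Lemma contr_pre (G G' : graph) S (q : vert G -> vert G') psi e x y :
  contr S q psi -> e \in S -> y != x -> ends e = [set x; y] ->
  exists psi', contr [set h : edge (contract e y) | val h \in S] (q \o val) psi'.
Proof.
move=> c eS ney E.
have ne h : psi h != e by apply: contraNneq (contr_psi c h) => ->.
have qxy : q x = q y by apply: (contr_const c eS); rewrite E !inE eqxx ?orbT.
have qp z : q (val (contract_proj e y z)) = q z.
  by rewrite (val_proj ney E); case: eqP => // ->.
exists (fun h => exist _ (psi h) (ne h)); split.
- move=> z; have [u <-] := contr_onto c z; exists (contract_proj e y u); exact: qp.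
- by move=> h k /(congr1 val) /= /(contr_inj c).
- move=> h; rewrite inE (contr_in c); congr (~~ _); apply/codomP/codomP => [[k Ek]|[k ->]].
    by exists k; apply: val_inj.
  by exists k.
- move=> h; rewrite /= /contract_ends -imset_comp (contr_ends c) /=.
  by apply: eq_imset => z /=; rewrite qp.
- move=> h; rewrite inE => hS u v /imsetP[a ah ->] /imsetP[b bh ->] /=.
  by rewrite !qp; apply: (contr_const c hS).
- move=> u v /(contr_fib c) uv; apply: in_colour_connect => F cF.
  rewrite -(proj_val ney E u) -(proj_val ney E v).
  apply: (in_connect_colour (F := F \o contract_proj e y) _ uv) => h hS.
  case: (eqVneq h e) => [->|he].
    by rewrite E; apply: const_on_pair; rewrite /= (proj_xy ney E).
  by apply: const_on_comp (cF (exist _ h he) _); rewrite inE.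
- apply: succn_inj; rewrite (card_contract_vert ney E) (contr_card c) -addnS; congr (_ + _).
  rewrite (cardsD1 e) eS add1n; congr _.+1.
  rewrite -[RHS](card_imset _ val_inj); apply: eq_card => h; rewrite !inE.
  apply/andP/imsetP => [[he hS]|[k]]; first by exists (exist _ h he); rewrite ?inE.
  by rewrite inE => kS ->; rewrite (valP k).
Qed.

(** Of two edges in series either one may be the contracted one. Contracting [e] instead of [f]
    moves [x] into the fibre of [y], and the edge of [G'] that [e] represented is now represented by
    [f]. *)
Lemma contr_exchange (G G' : graph) (S : {set edge G}) (q : vert G -> vert G') psi x y e f :
  valence x = 2 -> y != x -> ends e = [set x; y] -> x \in ends f -> f != e ->
  e \notin S -> f \in S -> contr S q psi ->
  exists q' psi', @contr G G' (e |: (S :\ f)) q' psi'.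
Proof.
move=> vx ney Ee xf nef eS fS c.
have [z Ef zx] := val2_other_end vx ney Ee xf nef.
have qxz : q x = q z by apply: (contr_const c fS); rewrite Ef !inE eqxx ?orbT.
have xh h u : h != e -> h != f -> u \in ends h -> (u == x) = false.
  move=> he hf uh; apply: contraTF uh => /eqP->; apply/negP.
  by move=> /(val2_edges vx ney Ee xf nef)[hE|hE]; rewrite hE eqxx in he hf.
pose q' v := if v == x then q y else q v.
pose psi' k := if psi k == e then f else psi k.
have nf k : psi k != f by apply: contraNneq (contr_psi c k) => ->.
exists q', psi'; split.
- move=> w; have [u <-] := contr_onto c w; rewrite /q'.
  case: (eqVneq u x) => [->|ux]; first by exists z; rewrite (negbTE zx).
  by exists u; rewrite (negbTE ux).
- move=> h k; rewrite /psi'; case: eqP => hE; case: eqP => kE.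
  + by move=> _; apply: (contr_inj c); rewrite hE kE.
  + by move=> E; have := nf k; rewrite -E eqxx.
  + by move=> E; have := nf h; rewrite E eqxx.
  + exact: (contr_inj c).
- move=> h; rewrite !inE; apply/idP/negP => [hS /codomP[k]|nh].
     rewrite /psi'; case: eqP => [_ E|/eqP E Eh].
      by move: hS; rewrite E eqxx (negbTE nef).
    by move: hS; rewrite Eh (negbTE E) nf (negbTE (contr_psi c k)).
  case: eqP => //= he; case: eqP => [hf|_] /=.
    have [k Ek] := contr_psi_ex c eS.
    by case: nh; apply/codomP; exists k; rewrite /psi' Ek eqxx.
  apply/negPn/negP => /(contr_psi_ex c)[k Ek]; case: nh; apply/codomP; exists k.
  by rewrite /psi' Ek; case: eqP.
- move=> h; rewrite (contr_ends c) /psi'; case: eqP => [->|/eqP he].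
    by rewrite Ee Ef !imsetU1 !imset_set1 /q' eqxx (negbTE zx) qxz setUC.
  by apply: eq_in_imset => u uh; rewrite /q' (xh _ _ he (nf h) uh).
- move=> h; rewrite !inE => /orP[/eqP->|/andP[hf hS]].
    by rewrite Ee; apply: const_on_pair; rewrite /q' eqxx (negbTE ney).
  have he : h != e by apply: contraNneq eS => <-.
  move=> u v uh vh; rewrite /q' !(xh _ _ he hf) //; exact: (contr_const c hS).
- move=> u v E; apply: in_colour_connect => F cF.
  (* [F] respects [e] but perhaps not [f]; giving [x] the colour of [z] makes it respect [f], and
     hence the old forest. *)
  pose F' v := if v == x then F z else F v.
  have F'q a b : q a = q b -> F' a = F' b.
    move=> /(contr_fib c); apply: in_connect_colour => h hS.
    have he : h != e by apply: contraNneq eS => <-.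
    case: (eqVneq h f) => [->|hf].
      by rewrite Ef; apply: const_on_pair; rewrite /F' eqxx (negbTE zx).
    move=> a' b' ah bh; rewrite /F' !(xh _ _ he hf) //.
    by apply: (cF h); rewrite ?inE ?hf ?hS ?orbT.
  have Fx : F x = F y by apply: (cF e); rewrite ?inE ?eqxx // Ee !inE eqxx ?orbT.
  pose st a := if a == x then y else a.
  have Fst a : F a = F' (st a).
    rewrite /F' /st; case: (eqVneq a x) => [->|/negbTE ->] //.
    by rewrite (negbTE ney).
  rewrite !Fst; apply: F'q; move: E; rewrite /q' /st.
  by case: eqP; case: eqP.
- rewrite cardsU1 !inE (negbTE eS) andbF /= (contr_card c); congr (_ + _).
  by rewrite (cardsD1 f) fS.
Qed.

(** * Factoring a contraction through a smoothing *)

Section SmoothContr.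
Variables (G : graph).
Hypothesis G3 : forall z : vert G, 3 <= valence z.

Definition full_pieces K L (s : smoothing K L) (U : {set edge L}) : {set edge K} :=
  [set k | [forall h, smooth_piece s h k ==> (h \in U)]].

(** If neither edge at [x] were contracted, [x] would be an entire fibre and its image a vertex of
    valence 2 in [G]. *)
Lemma contr_val2 (L : graph) U (q : vert L -> vert G) psi x y e f :
  contr U q psi -> valence x = 2 -> y != x -> ends e = [set x; y] -> x \in ends f -> f != e ->
  e \notin U -> f \in U.
Proof.
move=> c vx ney Ee xf nef eU; apply/negPn/negP => fU.
have [z Ef zx] := val2_other_end vx ney Ee xf nef.
have fib u : q u = q x -> u = x.
  move=> /(contr_fib c) ux; apply/eqP.
  have E := in_connect_colour (F := fun v => v == x) _ ux.
  rewrite eqxx in E; rewrite E // => h hU {E}; have nx a : a \in ends h -> (a == x) = false.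
    apply: contraTF => /eqP->; apply/negP => /(val2_edges vx ney Ee xf nef)[E|E].
      by rewrite -E hU in eU.
    by rewrite -E hU in fU.
  by move=> a b /nx-> /nx->.
have := sum_valence_fibre c (q x); have := G3 (q x).
rewrite (eq_bigl (fun u => u == x)); last by move=> u; apply/eqP/eqP => [/fib|->].
rewrite big_pred1_eq vx; lia.
Qed.

(** At each smoothed vertex [e] or [f] is contracted, and after an exchange one may assume that [e]
    is, as in the smoothing. The exchange is harmless for [full_pieces], because the merged edge is
    contracted in [K] only if both [e] and [f] were in [U]. *)
Lemma smooth_contr K L (s : smoothing K L) U (q : vert L -> vert G) psi :
  contr U q psi -> exists q' psi', @contr K G (full_pieces s U) q' psi'.
Proof.
elim: s U q psi => {L} [L a nv|L x y e f vx ney Ee xf nef s IH] U q psi c.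
  have [phi phiK ca] := contr_giso a.
  have := contr_comp ca c.
  have -> : set0 :|: phi @: U = full_pieces (SmoothDone a nv) U.
    apply/setP => k; rewrite !inE /=; apply/imsetP/forallP => [[h hU ->] h'|hk].
      by apply/implyP => /eqP->; rewrite phiK.
    exists (gisoE a k); last by apply: (bij_inj (gisoE_bij a)); rewrite phiK.
    by have := hk (gisoE a k); rewrite eqxx.
  by move=> cc; exists (q \o gisoV a), (phi \o psi).
have [z Ef zx] := val2_other_end vx ney Ee xf nef.
case: (boolP (e \in U)) => eU.
  have [psi' c'] := contr_pre c eU ney Ee.
  have [q2 [psi2 c2]] := IH _ _ _ c'; exists q2, psi2.
  suff <- : full_pieces s [set h | val h \in U] = full_pieces (SmoothStep vx ney Ee xf nef s) U by [].
  apply/setP => k; rewrite !inE; apply/forallP/forallP => hk h; apply/implyP => ph.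
    have := hk (smooth_cast nef h); rewrite [X in X ==> _]ph inE val_smooth_cast /=.
    by case: eqP => // ->.
  by have := hk (val h); rewrite /= -/(smooth_cast nef _) smooth_castK ph inE.
have fU := contr_val2 c vx ney Ee xf nef eU.
have [q1 [psi1 c1]] := contr_exchange vx ney Ee xf nef eU fU c.
have eU' : e \in e |: (U :\ f) by rewrite !inE eqxx.
have [psi' c'] := contr_pre c1 eU' ney Ee.
have [q2 [psi2 c2]] := IH _ _ _ c'; exists q2, psi2.
set U' := [set h | _] in c2.
suff <- : full_pieces s U' = full_pieces (SmoothStep vx ney Ee xf nef s) U by [].
apply/setP => k; rewrite !inE; apply/forallP/forallP => hk h; apply/implyP => ph.
  have := hk (smooth_cast nef h); rewrite [X in X ==> _]ph !inE val_smooth_cast /=.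
  by case: (eqVneq h e) => [_|/negbTE he]; rewrite ?(negbTE nef) ?he ?eqxx //= => /andP[].
rewrite !inE (negbTE (valP h)) /=.
have pk h' : smooth_cast nef h' = h -> h' \in U.
  by move=> E; have := hk h'; rewrite /= -/(smooth_cast nef _) E ph.
rewrite pk ?smooth_castK // andbT; apply/negP => /eqP hf.
suff /pk : smooth_cast nef e = h by rewrite (negbTE eU).
by apply: val_inj; rewrite val_smooth_cast eqxx.
Qed.

(* The pieces of an edge of K that are not in S all lie in one edge of G, whose
   representative therefore lies in the same edge of K. *)
Lemma contr_full_pieces K L L' (s1 : smoothing K L) (s2 : smoothing G L') S
    (q : vert L -> vert L') psi :
  (forall x : vert L, 2 <= valence x) -> contr S q psi ->
  exists q' psi', @contr K G (full_pieces s1 S) q' psi'.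
Proof.
move=> v2 c; have [S2 [q2 c2]] := contr_smoothing s2.
have cc := contr_comp c c2; set U := _ :|: _ in cc.
suff <- : full_pieces s1 U = full_pieces s1 S by apply: smooth_contr cc.
apply/setP => k; rewrite !inE; apply/forallP/forallP => hk h; apply/implyP => ph; last first.
  by have := hk h; rewrite ph inE => /= ->.
apply/negPn/negP => /(contr_psi_ex c)[h' Eh].
have [k2 k2P] := smooth_piece_fun s2 h'.
pose r := smooth_rep s2 k2.
have [p1 p1P] : exists p1 : edge L -> edge K, forall h k, smooth_piece s1 h k = (k == p1 h).
  by apply: (fin_all_exists (P := fun h k => forall k', smooth_piece s1 h k' = (k' == k))); apply: smooth_piece_fun.
have E : p1 (psi h') = p1 (psi r).
  apply: (smooth_piece_ind (s := s2) (g := p1 \o psi) _ (k := k2)); last 2 first.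
  - by rewrite k2P.
  - exact: smooth_rep_piece.
  move=> z h1 h2 vz z1 z2 /=.
  have fib x : q x = z -> valence x = 2 by move=> qx; apply: (contr_valence2 c v2); rewrite qx.
  (* At a vertex of valence 2 both edges are pieces of the same edge of [K], and [col] names it. All
     vertices of the fibre over [z] have valence 2, so [col] is constant along its forest. The
     default value concerns isolated vertices only. *)
  pose col x := p1 (if [pick e | x \in ends e] is Some e then e else psi h').
  have colE x e : q x = z -> x \in ends e -> p1 e = col x.
    move=> qx xe; rewrite /col; case: pickP => [e' xe'|/(_ e)]; last by rewrite xe.
    apply/eqP; rewrite eq_sym -p1P.
    by apply: smooth_piece_adj (fib _ qx) xe' xe _; rewrite p1P.
  rewrite (contr_ends c) in z1; rewrite (contr_ends c) in z2.
  case/imsetP: z1 => x1 x1h zx1; case/imsetP: z2 => x2 x2h zx2.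
  rewrite (colE x1) // (colE x2) //.
  have /(contr_fib c) x12 : q x1 = q x2 by rewrite -zx1.
  have := in_connect_colour (F := fun x => if q x == z then col x else col x1) _ x12.
  rewrite -zx1 -zx2 eqxx; apply => e eS a b ae be.
  rewrite (contr_const c eS ae be); case: (eqVneq (q b) z) => // qb.
  have qa : q a = z by rewrite (contr_const c eS ae be).
  by rewrite -(colE a e) // -(colE b e).
have := hk (psi r); rewrite p1P -E Eh -p1P ph inE /=.
case/orP => [|/imsetP[t tS /(contr_inj c) Er]]; first by rewrite (negbTE (contr_psi c _)).
by have := contr_psi c2 k2; rewrite -/r Er tS.
Qed.

End SmoothContr.

(** The edges of a forest are contracted one at a time. None of them is a loop, so no weight is ever
    created. *)
Lemma wcontraction_contr n (G H : wgraph) (S : {set edge G}) (q : vert G -> vert H) psi :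
  #|S| <= n -> (forall v : vert G, wt v = 0) -> (forall v : vert H, wt v = 0) ->
  contr S q psi -> inhabited (wcontraction H S).
Proof.
elim: n G S q psi => [|n IH] G S q psi Sn wG wH c; have [S0|[e eS]] := set_0Vmem S.
- rewrite S0 in c *; have [a _ _] := giso_contr c; constructor.
  by apply: ContractDone => //; exists a => v; rewrite wG wH.
- by move: Sn; rewrite leqn0 cards_eq0 => /eqP S0; rewrite S0 inE in eS.
- rewrite S0 in c *; have [a _ _] := giso_contr c; constructor.
  by apply: ContractDone => //; exists a => v; rewrite wG wH.
have [x [y E]] := ends_pair e.
have ney : y != x by rewrite eq_sym -(pair_loop E) (contr_nonloop c eS).
have [psi' c'] := contr_pre c eS ney E.
have S'n : #|[set h : edge (contract e y) | val h \in S]| <= n.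
  rewrite -ltnS (leq_trans _ Sn) // [X in _ < X](cardsD1 e) eS add1n ltnS.
  rewrite -(card_imset _ val_inj); apply/subset_leq_card/subsetP => h /imsetP[k].
  by rewrite !inE => kS ->; rewrite kS (valP k).
have wG' v : wt (w := wcontract e y) v = 0.
  by rewrite /= (negbTE (contr_nonloop c eS)); case: eqP => // _; rewrite big1.
have [w] := IH (wcontract e y) _ _ _ S'n wG' wH c'.
constructor; apply: ContractStep eS _ w.
by rewrite E !inE eqxx orbT.
Qed.

(** * Trees *)

Section Cross.
Variable G : graph.
Implicit Types (F : vert G -> bool) (e : edge G).

Definition cross F e : bool :=
  [exists a in ends e, exists b in ends e, F a && ~~ F b].

Lemma crossPn F e : reflect (const_on F (ends e)) (~~ cross F e).
Proof.
apply: (iffP idP) => [nc a b ae be|c].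
  have h u v : u \in ends e -> v \in ends e -> F u -> F v.
    move=> ue ve Fu; apply: contraNT nc => Fv.
    by apply/exists_inP; exists u => //; apply/exists_inP; exists v; rewrite ?Fu.
  by apply/idP/idP; apply: h.
apply/exists_inP => [[a ae /exists_inP[b be]]]; rewrite (c a b) //.
by rewrite andbN.
Qed.

Lemma cross_pair F e a b : ends e = [set a; b] -> cross F e = (F a != F b).
Proof.
move=> E; apply/idP/idP; last first.
  apply: contraNT => /crossPn c; apply/eqP.
  by apply: c; rewrite E !inE eqxx ?orbT.
by apply: contraTT => /negPn/eqP h; apply/crossPn; rewrite E; apply: const_on_pair.
Qed.

Lemma eq_in_cross F F' e : {in ends e, F =1 F'} -> cross F e = cross F' e.
Proof.
have [a [b E]] := ends_pair e => h; rewrite !(cross_pair _ E) !h // E !inE eqxx ?orbT //.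
Qed.

Lemma sum_valence_set (X : {set vert G}) :
  \sum_(x in X) valence x =
  2 * #|[set e : edge G | ends e \subset X]| + #|[set e | cross (mem X) e]|.
Proof.
under eq_bigr do rewrite valenceE.
rewrite exchange_big /= mulnC -sum_nat_const -sum1_card.
rewrite [X in _ = X + _]big_mkcond [X in _ = _ + X]big_mkcond -big_split /=; apply: eq_bigr => e _.
have [a [b E]] := ends_pair e; rewrite !inE (cross_pair _ E) /=.
under eq_bigr do rewrite (degE _ E).
rewrite big_split /= -!big_mkcondr /=.
have sum1 c : \sum_(i in X | i == c) 1 = (c \in X).
  case: (boolP (c \in X)) => cX.
    by rewrite (bigD1 c) ?cX ?eqxx //= big1 // => i /andP[/andP[_ ->]].
  by rewrite big1 // => i /andP[iX /eqP ic]; rewrite -ic iX in cX.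
rewrite !sum1 E subUset !sub1set.
by case: (a \in X); case: (b \in X).
Qed.

Lemma connected_cross F x y : connected_graph G -> F x != F y -> exists e, cross F e.
Proof.
move=> cG xy; apply/existsP; apply: contraNT xy => /existsPn h.
by apply/eqP; apply: (connected_colour cG) => e; apply/crossPn.
Qed.

End Cross.

Section Tree.
Variable T : graph.
Hypothesis tT : is_tree T.

(* A tree is exhausted by adding, one at a time, an edge with one end in the
   part already built. *)
Lemma tree_ind (r : vert T) (Q : {set vert T} -> {set edge T} -> Prop) :
  Q [set r] set0 ->
  (forall (A : {set vert T}) (B : {set edge T}) a b e, a \in A -> b \notin A -> e \notin B -> ends e = [set a; b] ->
     (forall e', e' \in B -> ends e' \subset A) -> Q A B -> Q (b |: A) (e |: B)) ->
  Q setT setT.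
Proof.
move=> Q0 QS; have [cT eT] := tT.
have step n : n < #|vert T| -> exists (A : {set vert T}) (B : {set edge T}), [/\ #|A| = n.+1, #|B| = n,
    forall e', e' \in B -> ends e' \subset A & Q A B].
  elim: n => [_|n IH nT].
    by exists [set r], set0; split; rewrite ?cards1 ?cards0 // => e; rewrite inE.
  have [A [B [cA cB sB QAB]]] := IH (ltnW nT).
  have [x xA] : exists x, x \in A by apply/card_gt0P; rewrite cA.
  have [y yA] : exists y, y \notin A.
    apply/existsP; apply: contraTT nT => /existsPn h; rewrite -leqNgt -cA.
    by apply/subset_leq_card/subsetP => y _; apply/negPn.
  have [|e /exists_inP[a ae /exists_inP[b be /andP[aA bA]]]] :=
      @connected_cross _ (mem A) x y cT.
    by rewrite /= xA (negbTE yA).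
  have E : ends e = [set a; b].
    have [b' E] := other_end ae; move: be; rewrite E !inE.
    by case/orP => /eqP bE; [rewrite bE aA in bA|rewrite bE].
  have eB : e \notin B.
    by apply: contraNN bA => /sB /subsetP /(_ b be).
  exists (b |: A), (e |: B); split.
  - by rewrite cardsU1 bA cA.
  - by rewrite cardsU1 eB cB.
  - move=> e'; rewrite !inE => /orP[/eqP->|/sB/subset_trans-> //]; last exact: subsetUr.
    by rewrite E subUset !sub1set !inE eqxx (aA : a \in A) orbT.
  - exact: QS E sB QAB.
have n0 : #|vert T|.-1 < #|vert T| by rewrite prednK // eT.
have [A [B [cA cB _ QAB]]] := step _ n0.
have -> : setT = A.
  by apply/esym/eqP; rewrite eqEcard subsetT cardsT cA prednK ?leqnn // eT.
have -> // : setT = B.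
by apply/esym/eqP; rewrite eqEcard subsetT cardsT cB eT leqnn.
Qed.

Lemma tree_root : exists r : vert T, True.
Proof. by have [[/card_gt0P[r _]]] := tT; exists r. Qed.

Lemma tree_edge_ends e : exists a b : vert T, ends e = [set a; b] /\ a != b.
Proof.
have [r _] := tree_root.
have := tree_ind (r := r) (Q := fun A B => forall e, e \in B -> exists a b : vert T, ends e = [set a; b] /\ a != b).
apply; rewrite ?inE //; first by move=> e'; rewrite inE.
move=> A B a b e' aA bA _ E _ IH e2; rewrite !inE => /orP[/eqP->|/IH//].
by exists a, b; split=> //; apply: contraNneq bA => <-.
Qed.

Lemma tree_nonloop (e : edge T) : ~~ loop e.
Proof. by have [a [b [E ab]]] := tree_edge_ends e; rewrite (pair_loop E). Qed.

Lemma tree_deg (e : edge T) x : deg e x = (x \in ends e).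
Proof. by rewrite /deg (negbTE (tree_nonloop e)) muln1. Qed.

Lemma tree_valence x : valence x = #|[set e : edge T | x \in ends e]|.
Proof.
rewrite valenceE -sum1_card big_mkcond /=.
by rewrite [RHS]big_mkcond; apply: eq_bigr => e _; rewrite tree_deg inE; case: (_ \in _).
Qed.

(** While the tree grows, the newest edge is cut off by its new leaf, and an older cut is extended
    by giving the new leaf the colour of its neighbour. *)
Lemma tree_cut e : exists F : vert T -> bool, forall e', cross F e' = (e' == e).
Proof.
have [r _] := tree_root.
have := tree_ind (r := r) (Q := fun A B => forall e, e \in B ->
  exists F : vert T -> bool, forall e', e' \in B -> cross F e' = (e' == e)).
move=> /(_ _ _ e) [e'|A B a b e0 aA bA e0B E sB IH e1||F FP]; first by rewrite inE.
- have nb e' : e' \in B -> b \notin ends e'.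
    by move=> /sB /subsetP sub; apply: contraNN bA => /sub.
  have nab : (a == b) = false by apply: contraNF bA => /eqP<-.
  rewrite !inE => /orP[/eqP->|e1B].
    exists (pred1 b) => e'; rewrite !inE => /orP[/eqP->|e'B].
      by rewrite (cross_pair _ E) /= !eqxx nab.
    rewrite [RHS](_ : _ = false); last by apply: contraNF e0B => /eqP<-.
    apply/negbTE/crossPn => u v ue ve /=.
    by rewrite (negbTE (memPn (nb _ e'B) _ ue)) (negbTE (memPn (nb _ e'B) _ ve)).
  have [F FP] := IH _ e1B.
  exists (fun z => if z == b then F a else F z) => e'; rewrite !inE => /orP[/eqP->|e'B].
    rewrite (cross_pair _ E) eqxx nab eqxx /=; apply/esym/negbTE.
    by apply: contraNneq e0B => ->.
  rewrite -(FP _ e'B); apply: eq_in_cross => z ze.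
  by rewrite (negbTE (memPn (nb _ e'B) _ ze)).
- by rewrite inE.
- by exists F => e'; rewrite FP ?inE.
Qed.

Lemma tree_sub_edges (X : {set vert T}) : X != set0 ->
  #|[set e : edge T | ends e \subset X]| < #|X|.
Proof.
have [r _] := tree_root.
have := tree_ind (r := r) (Q := fun A B => X :&: A != set0 ->
  #|[set e in B | ends e \subset X]| < #|X :&: A|).
rewrite setIT => h X0; have {h} := h _ _ X0.
rewrite (_ : [set e in [set: edge T] | ends e \subset X] = [set e | ends e \subset X]); last first.
  by apply/setP => e; rewrite !inE.
apply=> [h|A B a b e aA bA eB E sB IH h].
  rewrite (_ : [set e in set0 | _] = set0) ?cards0 ?card_gt0 //.
  by apply/setP => e; rewrite !inE.
case: (boolP (b \in X)) => bX; last first.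
  have -> : X :&: (b |: A) = X :&: A.
    by apply/setP => z; rewrite !inE; case: eqP => [->|]; rewrite ?(negbTE bX).
  rewrite (_ : [set e0 in e |: B | ends e0 \subset X] = [set e0 in B | ends e0 \subset X]).
    apply: IH; apply: contraNneq h => h; apply/eqP/setP => z.
    move/setP: h => /(_ z); rewrite !inE; case: eqP => [->|]; by rewrite ?(negbTE bX).
  apply/setP => e0; rewrite !inE; case: eqP => //= ->.
  by rewrite (negbTE eB) E subUset !sub1set (negbTE bX) andbF.
have -> : X :&: (b |: A) = b |: (X :&: A).
  by apply/setP => z; rewrite !inE; case: eqP => [->|]; rewrite ?bX.
rewrite cardsU1 inE (negbTE bA) andbF /= add1n ltnS.
have [XA|XA] := eqVneq (X :&: A) set0.
  rewrite XA cards0 leqn0 cards_eq0; apply/eqP/setP => e0; rewrite !inE; apply/negP.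
  have nX z : z \in A -> z \notin X.
    by move=> zA; move/setP: XA => /(_ z); rewrite !inE zA andbT => ->.
  case/andP=> [/orP[/eqP->|/sB/subsetP e0A]]; first by rewrite E subUset !sub1set (negbTE (nX _ aA)).
  have [z ze] := ends_nonempty e0; move/subsetP => /(_ _ ze).
  by rewrite (negbTE (nX _ (e0A _ ze))).
apply: leq_trans (IH XA); apply: (@leq_trans #|e |: [set e0 in B | ends e0 \subset X]|).
  by apply/subset_leq_card/subsetP => e0; rewrite !inE; case: eqP.
by rewrite cardsU1; case: (_ \in _).
Qed.

(** Since [X] spans at most [#|X| - 1] edges, at least 2 edges leave it, plus the total excess of
    the valences in [X] over 2. *)
Lemma tree_cross_ge (X : {set vert T}) : X != set0 ->
  \sum_(x in X) valence x + 2 <= 2 * #|X| + #|[set e | cross (mem X) e]|.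
Proof. by move=> /tree_sub_edges; rewrite sum_valence_set; lia. Qed.

Hypothesis T2 : 1 < #|vert T|.

Lemma tree_valence_gt0 (x : vert T) : 0 < valence x.
Proof.
have [y yx] : exists y, y != x.
  have : #|[set~ x]| != 0 by rewrite cardsC1; case: #|vert T| T2 => [|[]].
  by rewrite -lt0n => /card_gt0P[y]; rewrite !inE; exists y.
have [cT _] := tT.
have [|e ce] := @connected_cross _ (pred1 x) x y cT; first by rewrite /= eqxx (negbTE yx).
apply: leq_trans (deg_le_valence e x); rewrite deg_gt0.
by move: ce => /exists_inP[a ae /exists_inP[b _ /andP[/eqP <-]]].
Qed.

Lemma tree_valence_edge (x : vert T) : exists e, x \in ends e.
Proof.
have := tree_valence_gt0 x; rewrite tree_valence => /card_gt0P[e].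
by rewrite inE; exists e.
Qed.

Lemma sum_tree_valence : \sum_(x : vert T) valence x + 2 = 2 * #|vert T|.
Proof. by rewrite handshake; have [_ ->] := tT; lia. Qed.

Lemma tree_leaf : exists a : vert T, valence a = 1.
Proof.
suff /existsP[a /eqP va] : [exists a : vert T, valence a == 1] by exists a.
apply: contraT => /existsPn h.
have := sum_tree_valence.
have : \sum_(x : vert T) 2 <= \sum_(x : vert T) valence x.
  by apply: leq_sum => x _; have := h x; have := tree_valence_gt0 x; case: valence => [|[]].
have -> : \sum_(x : vert T) 2 = 2 * #|vert T| by rewrite sum_nat_const mulnC.
lia.
Qed.

End Tree.

(** * Ladders over a tree *)

Lemma pair3 (P : {set 'I_3}) : #|P| = 2 -> exists k, P = [set~ k].
Proof.
move=> P2; have /cards1P[k E] : #|~: P| == 1.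
  by rewrite -(eqn_add2l #|P|) cardsC card_ord P2.
by exists k; rewrite -(setCK P) E.
Qed.

Lemma third3 (k l : 'I_3) : exists m : 'I_3, (m != k) && (m != l).
Proof.
have : #|~: [set k; l]| != 0.
  have := cardsC [set k; l]; rewrite card_ord cards2; case: (k != l) => /=; lia.
by rewrite -lt0n => /card_gt0P[m]; rewrite !inE negb_or; exists m.
Qed.

Section Lad.
Variables (T : graph) (N : finType) (pos : N -> vert T) (pr : N -> {set 'I_3}).
Hypothesis pr2 : forall n, #|pr n| = 2.

Definition lad_ends (e : edge T * 'I_3 + N) : {set vert T * 'I_3} :=
  match e with
  | inl (f, i) => [set (x, i) | x in ends f]
  | inr n => [set (pos n, i) | i in pr n]
  end.

Lemma card_lad_ends e : 0 < #|lad_ends e| <= 2.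
Proof.
case: e => [[f i]|n] /=; rewrite card_imset ?card_ends ?pr2 //.
  by move=> x y [].
by move=> x y [].
Qed.

(** A ladder whose rungs form an arbitrary finite type, placed by [pos] and [pr]. The rungs thus
    keep their identity while the tree below them is expanded, which [rungs T] would not allow. *)
Definition lad : graph := Graph card_lad_ends.

Lemma lad_ends_inl f i a b : ends f = [set a; b] ->
  ends (inl (f, i) : edge lad) = [set (a, i); (b, i)].
Proof. by move=> E; rewrite /= E imsetU1 imset_set1. Qed.

Lemma mem_lad_inl f i x k : ((x, k) \in ends (inl (f, i) : edge lad)) = (x \in ends f) && (k == i).
Proof.
apply/imsetP/andP => [[y yf [-> ->]]|[xf /eqP->]]; first by rewrite eqxx.
by exists x.
Qed.

Lemma mem_lad_inr n x k : ((x, k) \in ends (inr n : edge lad)) = (x == pos n) && (k \in pr n).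
Proof.
apply/imsetP/andP => [[y yf [-> ->]]|[/eqP-> kn]]; first by rewrite eqxx.
by exists k.
Qed.

Lemma lad_nonloop_inr n : ~~ loop (inr n : edge lad).
Proof. by rewrite /loop /= card_imset ?pr2 // => x y []. Qed.

Lemma deg_lad_inr n x k : deg (inr n : edge lad) (x, k) = (x == pos n) && (k \in pr n).
Proof. by rewrite /deg mem_lad_inr (negbTE (lad_nonloop_inr n)) muln1. Qed.

Lemma deg_lad_inl f i x k : deg (inl (f, i) : edge lad) (x, k) = (k == i) * deg f x.
Proof.
have [a [b E]] := ends_pair f.
rewrite (degE _ (lad_ends_inl i E)) (degE _ E) !xpair_eqE.
by case: (k == i); rewrite ?andbT ?andbF ?mul1n.
Qed.

Lemma lad_valence x k :
  valence ((x, k) : vert lad) = valence x + #|[set n | (pos n == x) && (k \in pr n)]|.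
Proof.
rewrite !valenceE big_sumType /=; congr (_ + _).
  rewrite (eq_bigr (fun p : edge T * 'I_3 => (k == p.2) * deg p.1 x)); last first.
    by move=> [f i] _; rewrite deg_lad_inl.
  rewrite -(pair_bigA _ (fun f i => (k == i) * deg f x)) /=; apply: eq_bigr => f _.
  rewrite (bigD1 k) //= eqxx mul1n big1 ?addn0 // => i.
  by rewrite eq_sym => /negbTE->.
rewrite -sum1_card [RHS]big_mkcond; apply: eq_bigr => n _.
by rewrite deg_lad_inr inE eq_sym; case: (_ && _).
Qed.

Lemma sum_cross_lad (F : vert lad -> bool) :
  #|[set e | cross F e]| =
  \sum_i #|[set f | cross (fun x => F (x, i)) f]| + #|[set n | cross F (inr n : edge lad)]|.
Proof.
have sumE (I : finType) (P : pred I) : #|[set i | P i]| = \sum_i P i.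
  rewrite -sum1_card big_mkcond; apply: eq_bigr => i _; rewrite inE; by case: (P i).
rewrite !sumE big_sumType /=; congr (_ + _).
under [RHS]eq_bigr do rewrite sumE.
rewrite exchange_big pair_bigA /=; apply: eq_bigr => [[f i]] _ /=.
by have [a [b E]] := ends_pair f; rewrite (cross_pair _ (lad_ends_inl i E)) (cross_pair _ E).
Qed.

(** The total 3 encodes the rule for rungs: 2, 1 or 0 of them over a vertex of valence 1, 2 or 3.
    Injectivity says that rungs over the same vertex are non-parallel. *)
Record lad_valid : Prop := LadValid {
  lad_tree : is_tree T;
  lad_T2 : 1 < #|vert T|;
  lad_three : forall x : vert T, valence x + #|[set n | pos n == x]| = 3;
  lad_inj : injective (fun n => (pos n, pr n)) }.

Hypothesis v : lad_valid.
Let tT := lad_tree v.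
Let T2 := lad_T2 v.

Lemma lad_pos_ge1 (x : vert T) : 0 < valence x. Proof. exact: tree_valence_gt0. Qed.

Lemma lad_leaf a : valence a = 1 -> exists n n', [/\ n != n', pos n = a, pos n' = a,
  pr n != pr n' & forall m, pos m = a -> m = n \/ m = n'].
Proof.
move=> va; have := lad_three v a; rewrite va => -[/eqP/cards2P[n [n' [nn' E]]]].
have pn : pos n = a by have : n \in [set n | pos n == a]; [rewrite E !inE eqxx|rewrite inE => /eqP].
have pn' : pos n' = a by have : n' \in [set n | pos n == a]; [rewrite E !inE eqxx orbT|rewrite inE => /eqP].
exists n, n'; split=> //.
  apply: contraNneq nn' => prE; apply/eqP/(lad_inj v); by rewrite pn pn' prE.
move=> m pm; have : m \in [set n | pos n == a] by rewrite inE pm.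
by rewrite E !inE => /orP[]/eqP->; auto.
Qed.

Lemma lad_val2 x : valence x = 2 -> exists2 n, pos n = x & forall m, pos m = x -> m = n.
Proof.
move=> vx; have := lad_three v x; rewrite vx => -[/eqP/cards1P[n E]].
exists n; first by have : n \in [set n | pos n == x]; [rewrite E !inE eqxx|rewrite inE => /eqP].
move=> m pm; have : m \in [set n | pos n == x] by rewrite inE pm.
by rewrite E !inE => /eqP.
Qed.

Lemma lad_valence_cases (y : vert lad) : valence y = 2 \/ valence y = 3.
Proof.
case: y => x k; rewrite lad_valence; have := lad_three v x; have := lad_pos_ge1 x.
case E : (valence x) => [//|[|[|m]]] _.
- have [n [n' [nn' pn pn' prn all]]] := lad_leaf E.
  have [a Ea] := pair3 (pr2 n); have [b Eb] := pair3 (pr2 n').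
  have ab : a != b by apply: contraNneq prn => ab; rewrite Ea Eb ab.
  have -> : [set n | (pos n == x) && (k \in pr n)] =
            (if k != a then [set n] else set0) :|: (if k != b then [set n'] else set0).
    apply/setP => m; rewrite !inE; apply/andP/orP.
      move=> [/eqP/all[]->]; rewrite ?Ea ?Eb !inE => ->; rewrite inE eqxx; auto.
    by case; case: ifP => h; rewrite !inE // => /eqP->; rewrite ?pn ?pn' ?Ea ?Eb !inE eqxx h.
  case: (eqVneq k a) => [->|ka] /=.
    by rewrite ab set0U cards1; auto.
  case: (eqVneq k b) => kb /=; first by rewrite setU0 cards1; auto.
  by rewrite cards2 nn'; auto.
- have [n pn all] := lad_val2 E => _.
  have : #|[set n | (pos n == x) && (k \in pr n)]| <= #|[set n]|.
    by apply/subset_leq_card/subsetP => m; rewrite !inE => /andP[/eqP/all->].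
  by rewrite cards1; case: #|_| => [|[|]]; auto.
- move=> h; have -> : #|[set n | (pos n == x) && (k \in pr n)]| = 0.
    apply/eqP; rewrite -leqn0; apply: leq_trans (_ : #|[set n | pos n == x]| <= 0); last by lia.
    by apply/subset_leq_card/subsetP => m'; rewrite !inE => /andP[].
  by right; lia.
Qed.

Lemma lad_valence_ge2 (y : vert lad) : 2 <= valence y.
Proof. by have [->|->] := lad_valence_cases y. Qed.

(** Such a vertex survives smoothing, so every vertex of [T] has a vertex of the smoothed graph
    above it. *)
Lemma lad_valence3 x : exists i, valence ((x, i) : vert lad) = 3.
Proof.
have := lad_three v x; have := lad_pos_ge1 x.
case E : (valence x) => [//|[|[|m]]] _.
- have [n [n' [nn' pn pn' prn all]]] := lad_leaf E => _.
  have [a Ea] := pair3 (pr2 n); have [b Eb] := pair3 (pr2 n').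
  have [k /andP[ka kb]] := third3 a b; exists k.
  have : #|[set n; n']| <= #|[set n | (pos n == x) && (k \in pr n)]|.
    apply/subset_leq_card/subsetP => m; rewrite !inE.
    by case/orP=> /eqP->; rewrite ?pn ?pn' ?Ea ?Eb !inE ?eqxx ?ka ?kb.
  rewrite cards2 nn'.
  by case: (lad_valence_cases (x, k)) => //; rewrite lad_valence E /= => h1 h2; exfalso; lia.
- have [n pn all] := lad_val2 E => _.
  have [k kn] : exists k, k \in pr n by apply/card_gt0P; rewrite pr2.
  exists k; have : 0 < #|[set n | (pos n == x) && (k \in pr n)]|.
    by apply/card_gt0P; exists n; rewrite inE pn eqxx.
  by case: (lad_valence_cases (x, k)) => //; rewrite lad_valence E /= => h1 h2; exfalso; lia.
- by exists ord0; case: (lad_valence_cases (x, ord0)) => //; rewrite lad_valence E /= => h1; exfalso; lia.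
Qed.

(** Two different pairs among three copies share a copy [m], and each of the other two copies is
    joined to [m] by a rung. *)
Lemma lad_leaf_const (F : vert lad -> bool) a i k : valence a = 1 ->
  (forall n, pos n = a -> ~~ cross F (inr n : edge lad)) -> F (a, i) = F (a, k).
Proof.
move=> va c; have [n [n' [_ pn pn' prn _]]] := lad_leaf va.
have [b Eb] := pair3 (pr2 n); have [b' Eb'] := pair3 (pr2 n').
have bb' : b != b' by apply: contraNneq prn => E; rewrite Eb Eb' E.
have [m /andP[mb mb']] := third3 b b'.
suff h l : F (a, l) = F (a, m) by rewrite !h.
case: (eqVneq l b) => lb.
  move/crossPn: (c _ pn') => /(_ (a, l) (a, m)); apply; rewrite mem_lad_inr pn' eqxx Eb' !inE //.
  by rewrite lb.
by move/crossPn: (c _ pn) => /(_ (a, l) (a, m)); apply; rewrite mem_lad_inr pn eqxx Eb !inE.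
Qed.

(* Let X be the set of vertices of one copy of T on which F differs from its
   value at the leaves. At least two edges of that copy leave X, at least three
   when X contains a vertex of valence 3, and a vertex of valence 2 contributes
   its rung. *)
Lemma lad_three_conn (F : vert lad -> bool) :
  #|[set e | cross F e]| <= 2 ->
  (forall n, valence (pos n) = 1 -> ~~ cross F (inr n : edge lad)) ->
  forall y z : vert lad, valence y != 2 -> valence z != 2 -> F y = F z.
Proof.
rewrite sum_cross_lad => C2 hub.
pose d i := #|[set f | cross (fun x => F (x, i)) f]|.
have [D DE] : exists D, D = \sum_(k < 3) d k by exists (\sum_(k < 3) d k).
have [M ME] : exists M, M = #|[set n | cross F (inr n : edge lad)]|.
  by exists #|[set n | cross F (inr n : edge lad)]|.
have {}C2 : D + M <= 2 by rewrite DE ME.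
have sd : D = d ord0 + d (lift ord0 ord0) + d ord_max.
  rewrite DE !big_ord_recl big_ord0 addn0 addnA; congr (_ + _ + d _); exact: val_inj.
have [a va] := tree_leaf tT T2; have [cT _] := tT.
have leafc b i k : valence b = 1 -> F (b, i) = F (b, k).
  by move=> vb; apply: lad_leaf_const => // n pn; apply: hub; rewrite pn.
have dpos i x y : F (x, i) != F (y, i) -> 0 < d i.
  move=> xy; have [e ce] := @connected_cross _ (fun x => F (x, i)) _ _ cT xy.
  by apply/card_gt0P; exists e; rewrite inE.
(* If two leaves had different colours, each of the three copies of the tree would contain a crossed
   edge. *)
have leaves b i : valence b = 1 -> F (b, i) = F (a, ord0).
  move=> vb; apply: contraTeq C2 => ba; rewrite -ltnNge.
  have dk k : 0 < d k by apply: (dpos k b a); rewrite (leafc b k i) // (leafc a k ord0).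
  by rewrite sd; have := dk ord0; have := dk (lift ord0 ord0); have := dk ord_max; lia.
suff main (y : vert lad) : valence y != 2 -> F y = F (a, ord0) by move=> y z /main-> /main->.
case: y => x i vx; apply: contraTeq C2 => xa; rewrite -ltnNge.
pose X := [set x | F (x, i) != F (a, ord0)].
have X0 : X != set0 by apply/set0Pn; exists x; rewrite inE.
have Xnl z : z \in X -> 2 <= valence z.
  rewrite inE => zX; have := lad_pos_ge1 z; rewrite leq_eqVlt => /orP[/eqP vz|//].
  by rewrite leaves ?eqxx // in zX.
have dX : d i = #|[set e | cross (mem X) e]|.
  apply: eq_card => f; rewrite !inE; have [b [c E]] := ends_pair f.
  by rewrite !(cross_pair _ E) /= !inE; case: (F (b, i)); case: (F (c, i)); case: (F (a, ord0)).
have := tree_cross_ge tT X0; rewrite -dX (bigD1 x) /=; last by rewrite inE.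
have cX : #|X| = #|[set z in X | z != x]|.+1.
  rewrite (cardsD1 x X) inE xa add1n; congr _.+1; apply: eq_card => z; rewrite !inE; by rewrite andbC.
have : \sum_(z in X | z != x) 2 <= \sum_(z in X | z != x) valence z.
  by apply: leq_sum => z /andP[/Xnl].
have -> : \sum_(z in X | z != x) 2 = 2 * #|[set z in X | z != x]|.
  by rewrite mulnC -sum_nat_const; apply: eq_bigl => z; rewrite !inE.
have dle k : k != i -> d i + d k <= D.
  by move=> ki; rewrite DE (bigD1 i) //= (bigD1 k) //= addnA leq_addr.
have xX : x \in X by rewrite inE.
have := Xnl _ xX; rewrite leq_eqVlt => /orP[/eqP vx2|vx3]; last first.
  have : d i <= D by rewrite DE (bigD1 i) //= leq_addr.
  lia.
move=> h1 h2; have d2 : 2 <= d i by lia.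
have [n pn _] := lad_val2 (esym vx2).
have [k kn ki] : exists2 k, k \in pr n & k != i.
  have [b Eb] := pair3 (pr2 n); have [k /andP[kb ki]] := third3 b i.
  by exists k; rewrite // Eb !inE.
(* Copy [i] already has two crossed edges. The third is in copy [k], or copy [k] has the colour of
   the leaves throughout and the rung [n] is crossed. *)
have [ki0|ki0] := posnP (d k); last by have := dle _ ki; lia.
have Fk : F (x, k) = F (a, ord0).
  rewrite -(leaves a k va); apply/eqP; apply: contraT => /dpos; by rewrite ki0.
have in_ : i \in pr n.
  move: vx; rewrite lad_valence -vx2; case: (boolP (i \in pr n)) => // ni.
  rewrite (_ : [set _ | _] = set0) ?cards0 ?addn0 ?eqxx //.
  apply/setP => m; rewrite !inE; apply/negP => /andP[/eqP pm].
  have [n0 _ all] := lad_val2 (esym vx2).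
  by rewrite (all m pm) -(all n pn) (negbTE ni).
have cn : cross F (inr n : edge lad).
  apply: contraNT xa => /crossPn c; apply/eqP; rewrite -Fk; apply: c; by rewrite mem_lad_inr pn eqxx.
have : 0 < M by rewrite ME; apply/card_gt0P; exists n; rewrite inE.
have : d i <= D by rewrite DE (bigD1 i) //= leq_addr.
lia.
Qed.

Lemma lad_connected : connected_graph lad.
Proof.
have [[T0 _] _] := tT; have [cT _] := tT; apply: colour_connected.
  have [r _] := tree_root tT; by apply/card_gt0P; exists (r, ord0).
move=> F cF; have [a va] := tree_leaf tT T2.
suff h z : F z = F (a, ord0) by move=> y z; rewrite !h.
case: z => x i; rewrite (@connected_colour _ _ (fun x => F (x, i)) cT _ x a).
  by apply: lad_leaf_const => // n _; apply/crossPn/cF.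
move=> e; have [b [c E]] := ends_pair e; rewrite E; apply: const_on_pair.
by apply: (cF (inl (e, i))); rewrite (lad_ends_inl i E) !inE eqxx ?orbT.
Qed.

Section Smoothed.
Variables (K : graph) (s : smoothing K lad).

Lemma lad_smoothed_valence (u : vert K) : valence u = 3.
Proof.
have := smoothed_valence s u; rewrite -(smooth_vert_valence s).
by have [->|->] := lad_valence_cases (smooth_vert s u).
Qed.

(** Of the two rungs over a leaf, [n] has an end on the copy [b] that [m] misses. That end has
    valence 2, so [n] lies in the same smoothed edge as the tree edge in copy [b]. *)
Lemma lad_piece_nonhub k : exists2 h, smooth_piece s h k &
  forall n, h = inr n -> valence (pos n) != 1.
Proof.
have ph := smooth_rep_piece s k.
case E : (smooth_rep s k) ph => [p|n] ph; first by exists (inl p).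
case: (eqVneq (valence (pos n)) 1) => vn; last by exists (inr n) => // _ [<-].
have [n1 [n2 [n12 pn1 pn2 prn all]]] := lad_leaf vn.
have [m [mn pm prm] allm] : exists2 m, [/\ m != n, pos m = pos n & pr m != pr n] &
    forall l, pos l = pos n -> l = n \/ l = m.
  have [nE|nE] := all n erefl.
    exists n2; first by split; [rewrite nE eq_sym| |rewrite nE eq_sym].
    by move=> l /all[]; rewrite -?nE; auto.
  exists n1; first by split; [rewrite nE| |rewrite nE].
  by move=> l /all[]; rewrite -?nE; auto.
have [b Eb] := pair3 (pr2 m); have [c Ec] := pair3 (pr2 n).
have bn : b \in pr n.
  by rewrite Ec !inE; apply: contraNneq prm => bc; rewrite Eb Ec bc.
have vb : valence ((pos n, b) : vert lad) = 2.
  rewrite lad_valence vn (_ : [set _ | _] = [set n]) ?cards1 //.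
  apply/setP => l; rewrite !inE; apply/andP/eqP => [[/eqP/allm[->//|->]]|->]; last by rewrite eqxx.
  by rewrite Eb !inE eqxx.
have [f xf] := tree_valence_edge tT T2 (pos n).
exists (inl (f, b)) => //; apply: (smooth_piece_adj vb) ph.
  by rewrite mem_lad_inr eqxx.
by rewrite mem_lad_inl xf eqxx.
Qed.

(** Removed edges of [K] are represented by one piece each, chosen off the rungs over leaves.
    [smooth_extend] turns a colouring of [K] into one of the ladder that crosses these pieces only,
    and [lad_three_conn] applies to it. *)
Lemma lad_smoothed_conn : three_edge_connected K.
Proof.
move=> S S2; split.
  have [r _] := tree_root tT; have [i vi] := lad_valence3 r.
  have [|u _] := smooth_vert_onto s (x := (r, i)); first by rewrite vi.
  by apply/card_gt0P; exists u.
have [rho rhoP] : exists rho : edge K -> edge lad, forall k,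
    smooth_piece s (rho k) k /\ forall n, rho k = inr n -> valence (pos n) != 1.
  apply: (fin_all_exists (P := fun k h => smooth_piece s h k /\ forall n, h = inr n -> valence (pos n) != 1)).
  by move=> k; have [h] := lad_piece_nonhub k; exists h.
move=> x y; apply: colour_connect => c cS.
have [|F Fc FS] := smooth_extend (s := s) (S := ~: (rho @: S)) (c := c).
  move=> k kS; apply: cS; apply/negP => kS'.
  by have := kS (rho k) (proj1 (rhoP k)); rewrite inE imset_f.
have sub : [set e | cross F e] \subset rho @: S.
  apply/subsetP => e; rewrite inE => ce; apply: contraTT ce => eS; apply/crossPn/FS.
  by rewrite inE.
rewrite -!Fc; apply: lad_three_conn.
- by apply: leq_trans (subset_leq_card sub) _; apply: leq_trans (leq_imset_card _ _) S2.
- move=> n vn; apply/negP => cn.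
  have /imsetP[k _ kE] : inr n \in rho @: S by apply: (subsetP sub); rewrite inE.
  by have [_ /(_ n (esym kE))] := rhoP k; rewrite vn eqxx.
- by rewrite smooth_vert_valence (smoothed_valence s).
- by rewrite smooth_vert_valence (smoothed_valence s).
Qed.

End Smoothed.

End Lad.

(** * Ladder graphs are maximal *)

Lemma giso_comp (G1 G2 G3 : graph) (a : giso G1 G2) (b : giso G2 G3) :
  {c : giso G1 G3 | gisoV c = gisoV b \o gisoV a & gisoE c = gisoE b \o gisoE a}.
Proof.
have Ec e : ends (gisoE b (gisoE a e)) = [set gisoV b (gisoV a x) | x in ends e].
  by rewrite !giso_ends -imset_comp.
by exists (GIso (bij_comp (gisoV_bij b) (gisoV_bij a)) (bij_comp (gisoE_bij b) (gisoE_bij a)) Ec).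
Defined.

(** A trigonal type asks for a stabilization to [weightless G], which for zero weights is only
    isomorphic to [G]; vertices and pieces have to be followed through the transport. *)
Lemma smoothing_iso (K' K : graph) (a : giso K' K) G (s : smoothing K G) :
  {s' : smoothing K' G | (forall k, smooth_vert s' k = smooth_vert s (gisoV a k)) /\
    (forall h k, smooth_piece s' h k = smooth_piece s h (gisoE a k))}.
Proof.
elim: s => {G} [G b nv|G x y e f vx ney Ee xf nef s [s' [sv sp]]].
  have [c cV cE] := giso_comp a b.
  by exists (SmoothDone c nv) => /=; split=> [k|h k]; rewrite ?cV ?cE.
exists (SmoothStep vx ney Ee xf nef s') => /=; split=> [k|h k]; first by rewrite sv.
by rewrite sp.
Qed.

Lemma smoothing_card (K G : graph) (s : smoothing K G) :
  #|edge K| + #|vert G| = #|edge G| + #|vert K|.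
Proof.
have [S [q c]] := contr_smoothing s.
by rewrite (contr_card c) (contr_card_edge c); lia.
Qed.

Section WeightlessIso.
Variable G : wgraph.
Hypothesis w0 : forall v : vert G, wt v = 0.

Lemma weightless_no_loop : {v : vert G & 'I_(wt v)} -> False.
Proof. by move=> [v i]; have := w0 v; case: (wt v) i => [[]|]. Qed.

Definition weightless_edge_inv (e : weightless_edge G) : edge G :=
  match e with inl e' => e' | inr l => False_rect _ (weightless_no_loop l) end.

Lemma weightless_giso : {a : giso (weightless G) G |
  gisoV a = id & forall e, gisoE a (inl e) = e}.
Proof.
have bE : bijective weightless_edge_inv.
  by exists inl => // -[e|l] //; case: (weightless_no_loop l).
have Ee e : ends (weightless_edge_inv e) = [set x | x in weightless_ends e].
  case: e => [e|l] /=; first by rewrite imset_id.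
  by case: (weightless_no_loop l).
have bV : bijective (fun v : vert G => v) by exists id.
by exists (@GIso (weightless G) G _ _ bV bE Ee).
Qed.

End WeightlessIso.

(** * The trigonal type given by the projection of a ladder to its tree *)

Section LadType.
Variables (T : graph) (N : finType) (pos : N -> vert T) (pr : N -> {set 'I_3}).
Hypothesis pr2 : forall n, #|pr n| = 2.
Hypothesis v : lad_valid pos pr.
Local Notation lad := (lad pos pr2).
Let tT := lad_tree v.
Let T2 := lad_T2 v.

Definition lad_morE (e : edge lad) : vert T + edge T :=
  match e with inl p => inr p.1 | inr n => inl (pos n) end.
Definition lad_index (e : edge lad) : nat := if e is inl _ then 1 else 0.

Lemma lad_mor_ends (e : edge lad) :
  match lad_morE e with
  | inl t => [set x.1 | x in ends e] = [set t]
  | inr e' => [set x.1 | x in ends e] = ends e'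
  end.
Proof.
case: e => [[f i]|n] /=.
  by rewrite -imset_comp /= imset_id.
rewrite -imset_comp /=; apply/setP => x; rewrite inE.
apply/imsetP/eqP => [[k _ ->] //|->].
have /card_gt0P[k kn] : 0 < #|pr n| by rewrite pr2.
by exists k.
Qed.

Lemma lad_index_eq0 (e : edge lad) : lad_index e = 0 <-> exists t, lad_morE e = inl t.
Proof. by case: e => [p|n]; split=> //= h; [case: h|exists (pos n)]. Qed.

Definition lad_mor : morphism lad T := Morphism lad_mor_ends lad_index_eq0.

Lemma lad_local_degree (x : vert lad) f : morV lad_mor x \in ends f ->
  local_degree lad_mor x f = 1.
Proof.
case: x => x i /= xf; rewrite /local_degree (bigD1 (inl (f, i))) /=; last first.
  by rewrite eqxx andbT -/(lad_ends pos pr (inl (f, i))) (mem_lad_inl pos pr2 f i) xf eqxx.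
rewrite big1 // => -[[f' i']|n] //= /andP[/andP[h /eqP[ff']] ne].
have := mem_lad_inl pos pr2 f' i' x i; rewrite /= h => /esym/andP[_ /eqP ii'].
by rewrite ff' ii' eqxx in ne.
Qed.

Lemma lad_harmonic : harmonic lad_mor.
Proof. by move=> x e1 e2 h1 h2; rewrite !lad_local_degree. Qed.

Lemma lad_nonloop (e : edge lad) : ~~ loop e.
Proof.
case: e => [[f i]|n]; last exact: lad_nonloop_inr.
have [a [b [E ab]]] := tree_edge_ends tT f.
by rewrite (pair_loop (lad_ends_inl pos pr2 i E)) xpair_eqE negb_and ab.
Qed.

Lemma lad_nondegenerate : Defs.nondegenerate lad_mor.
Proof.
split=> [e|x e' h]; first by rewrite (negbTE (lad_nonloop e)).
by rewrite lad_local_degree.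
Qed.

Lemma lad_degree : has_degree lad_mor 3.
Proof.
split; first by have [_ h] := tT; rewrite -ltnS -h.
move=> f; rewrite big_sumType /= [X in _ + X]big_pred0 // addn0.
rewrite (eq_bigl (fun p : edge T * 'I_3 => (p.1 == f) && true)); last by move=> p; rewrite andbT.
rewrite -(pair_big (fun g => g == f) predT (fun _ _ => 1)) /= big_pred1_eq.
by rewrite sum1_card card_ord.
Qed.

Lemma lad_no_leaf (x : vert lad) : valence x != 1.
Proof. by have := lad_valence_ge2 v x; case: valence => [|[]]. Qed.

Variables (G : wgraph) (s : smoothing G lad).
Hypothesis w0 : forall x : vert G, wt x = 0.

Definition lad_smoothing := smoothing_iso (s2val (weightless_giso w0)) s.
Definition lad_stab : stabilization (weightless G) lad :=
  PruneDone lad_no_leaf (sval lad_smoothing).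

Lemma lad_stab_vert u : stab_vert lad_stab u = smooth_vert s u.
Proof.
rewrite /= (proj1 (svalP lad_smoothing)).
by rewrite (s2valP (weightless_giso w0)).
Qed.

Lemma lad_stab_piece h k : stab_piece lad_stab h (inl k) = smooth_piece s h k.
Proof.
rewrite /= (proj2 (svalP lad_smoothing)).
by rewrite (s2valP' (weightless_giso w0)).
Qed.

Lemma lad_smoothed_stable : stable G.
Proof. by move=> u; rewrite (lad_smoothed_valence v s). Qed.

Lemma lad_surj (t : vert T) : exists u : vert (weightless G), morV lad_mor (stab_vert lad_stab u) = t.
Proof.
have [i vi] := lad_valence3 pr2 v t.
have [|u E] := smooth_vert_onto s (x := (t, i)); first by rewrite vi.
by exists u; rewrite lad_stab_vert E.
Qed.

Definition lad_type : trigonal_type G :=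
  @TrigonalType G lad T lad_mor lad_stab (lad_smoothed_conn v s) lad_smoothed_stable
    (lad_connected pr2 v) tT lad_harmonic lad_nondegenerate lad_degree lad_surj.

Lemma lad_trace (S : {set edge lad}) : trace (tau := lad_type) S = full_pieces s S.
Proof.
apply/setP => k; rewrite !inE; apply: eq_forallb => h.
by rewrite -lad_stab_piece.
Qed.

(** Over a tree with n vertices the rungs number 3n - 2(n - 1) = n + 2, which together with 3(n - 1)
    tree edges makes 4n - 1 edges. *)
Lemma lad_card : #|vert lad| = 3 * #|vert T| /\ #|edge lad| + 1 = 4 * #|vert T|.
Proof.
have [_ eT] := tT.
have cN : #|N| + 2 * #|edge T| = 3 * #|vert T|.
  rewrite -handshake -sum1_card (partition_big pos predT) //= -big_split /=.
  rewrite mulnC -sum_nat_const; apply: eq_bigr => x _.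
  rewrite -(lad_three v x) addnC; congr (_ + _).
  by rewrite -sum1_card; apply: eq_bigl => n; rewrite inE.
have -> : #|vert lad| = #|vert T| * 3 by rewrite /= card_prod card_ord.
have -> : #|edge lad| = #|edge T| * 3 + #|N| by rewrite /= card_sum card_prod card_ord.
lia.
Qed.

Lemma lad_smoothed_card :
  #|edge G| + 1 = #|vert G| + #|vert T| /\ #|edge G| + 3 = 3 * #|vert T|.
Proof.
have [cV cE] := lad_card; have := smoothing_card s; rewrite cV.
have : 3 * #|vert G| = 2 * #|edge G|.
  rewrite -handshake mulnC -sum_nat_const; apply: eq_bigr => x _.
  by rewrite (lad_smoothed_valence v s).
lia.
Qed.

Lemma lad_genus : genus G = Posz #|vert T|.
Proof.
have [h _] := lad_smoothed_card.
rewrite /genus big1 => [|x _]; last exact: w0.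
lia.
Qed.

Lemma lad_trigonal : trigonal_graph #|vert T| G.
Proof. by split; [constructor; exact: lad_type | exact: lad_genus]. Qed.

End LadType.

(** Stability gives [3 <= 2 * wt v + valence v] at each vertex; summing, the handshake identity and
    the genus formula give the bound 3g - 3. *)
Lemma stable_card (G : wgraph) g : stable G -> genus G = Posz g -> #|edge G| + 3 <= 3 * g.
Proof.
move=> st; rewrite /genus.
have h (v : vert G) : 3 <= 2 * wt v + valence v.
  have [] := st v; case: (wt v) => [|[|n]]; [by move=> /(_ erefl)|by move=> _ /(_ erefl); lia|lia].
have : \sum_(v : vert G) 3 <= \sum_(v : vert G) (2 * wt v + valence v).
  by apply: leq_sum => v _; apply: h.
rewrite big_split /= -big_distrr /= handshake.
have -> : \sum_(v : vert G) 3 = 3 * #|vert G| by rewrite sum_nat_const mulnC.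
move: (\sum_v wt v) (#|vert G|) (#|edge G|) => a b c.
lia.
Qed.

Lemma wcontraction_card (H G : wgraph) (S : {set edge G}) (c : wcontraction H S) :
  #|edge G| = #|edge H| + #|S|.
Proof.
elim: c => {G S} [G S -> a|G S e v eS ve c IH].
  by rewrite cards0 addn0; apply/esym/bij_eq_card/(gisoE_bij a).
have cE : #|edge (wcontract e v)|.+1 = #|edge G|.
  have -> : #|edge (wcontract e v)| = #|predC1 e| by rewrite /= card_sig; apply: eq_card.
  by rewrite cardC1 prednK //; apply/card_gt0P; exists e.
rewrite -cE IH -addnS; congr (_ + _).
rewrite [RHS](cardsD1 e) eS add1n; congr _.+1.
rewrite -(card_imset _ val_inj); apply: eq_card => h; rewrite !inE.
apply/imsetP/andP => [[k]|[he hS]]; first by rewrite inE => kS ->; rewrite (valP k).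
by exists (exist _ h he); rewrite ?inE.
Qed.

Lemma wiso_sym (G H : wgraph) : wiso G H -> inhabited (wiso H G).
Proof.
move=> a; have [psi psiK c] := contr_giso a; have [b _ bV] := giso_contr c.
constructor; exists b => v.
by rewrite -(wiso_wt a) bV.
Qed.

(** The edges of [G'] are those of [G] together with the contracted ones, and [stable_card] leaves
    no room for the latter. *)
Lemma trigonal_maximal g (G : wgraph) :
  trigonal_graph g G -> #|edge G| + 3 = 3 * g -> maximal_trigonal g G.
Proof.
move=> tG eG; split=> // G' [[tau'] gG'] [[tau S clS c]].
have := wcontraction_card c; have := stable_card (trig_stable tau') gG'.
move=> h1 h2; have S0 : #|trace S| = 0 by lia.
case: c h2 => [_ a _|e v eS _ _ _]; first exact: wiso_sym a.
by rewrite (cardsD1 e) eS in S0.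
Qed.

Section Ladder.
Variables (T : graph) (r : rungs T).
Hypotheses (r_valid : valid_rungs r) (tT : is_tree T) (T2 : 1 < #|vert T|)
  (T3 : forall j : vert T, valence j <= 3).

Definition rung : finType := {p : vert T * {set 'I_3} | p.2 \in r p.1}.
Definition rung_pos (p : rung) : vert T := (val p).1.
Definition rung_pair (p : rung) : {set 'I_3} := (val p).2.

Lemma rung_pair2 p : #|rung_pair p| = 2.
Proof. by case: p => [[j P] /= Pj]; have [/(_ _ Pj)] := r_valid j. Qed.

(** The two graphs have convertible data and differ only in the proof of the bound on ends, a family
    of proofs of Boolean equalities. *)
Lemma ladder_lad : ladder r_valid = lad rung_pos rung_pair2.
Proof.
rewrite /ladder /lad; have -> // : card_ladder_ends r_valid = card_lad_ends rung_pos rung_pair2.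
by apply: functional_extensionality_dep => e; apply: bool_irrelevance.
Qed.

Lemma rung_valid : lad_valid rung_pos rung_pair.
Proof.
split=> // [j|[p hp] [q hq] /= E].
  have [_ rj] := r_valid j.
  have -> : #|[set n | rung_pos n == j]| = #|r j|.
    have inj : {in [set n | rung_pos n == j] &, injective rung_pair}.
      move=> [[x P] Px] [[y Q] Qy]; rewrite !inE /rung_pos /rung_pair /= => /eqP xj /eqP yj PQ.
      by apply: val_inj => /=; rewrite xj yj PQ.
    rewrite -(card_in_imset inj); apply: eq_card => P.
    apply/imsetP/idP => [[[[x Q] Qx]]|Pj].
      by rewrite inE /rung_pos /rung_pair /= => /eqP xj ->; rewrite -xj.
    by exists (exist _ (j, P) Pj); rewrite ?inE.
  have := T3 j; have := tree_valence_gt0 tT T2 j; rewrite rj.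
  by case: valence => [|[|[|[]]]].
apply: val_inj => /=; move: E; rewrite /rung_pos /rung_pair /=.
by case: p hp => ? ? ?; case: q hq => ? ? ? /= [-> ->].
Qed.

End Ladder.

Lemma stabilization_smoothing (K G : graph) : (forall x : vert G, valence x != 1) ->
  stabilization K G -> smoothing K G.
Proof. by move=> nl [//|x y e vx]; have := nl x; rewrite vx. Qed.

Lemma ladder_maximal g (G : wgraph) : ladder_graph g G -> maximal_trigonal g G.
Proof.
move=> [w0 [T [r [r_valid [[tT T2] T3 _ gT [st]]]]]].
have v := rung_valid r_valid tT T2 T3.
rewrite ladder_lad in st.
have s := stabilization_smoothing (lad_no_leaf v) st.
have tG := lad_trigonal v s w0; have [_ eG] := lad_smoothed_card v s.
by rewrite gT in tG eG; apply: trigonal_maximal tG eG.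
Qed.

(** * The structure of trigonal types *)

(** Elements of the same rank in the two enumerated fibres are paired. This is the device that
    numbers the edges over a tree edge consistently with the sheets already numbered at one end. *)
Lemma match_fibres (A B X : finType) (f : A -> X) (g : B -> X) (D : {set B}) (b0 : B) :
  (forall x, #|[set a | f a == x]| = #|[set b in D | g b == x]|) ->
  exists beta : A -> B, [/\ injective beta, forall a, beta a \in D & forall a, g (beta a) = f a].
Proof.
move=> h; pose s1 x := enum [set a | f a == x]; pose s2 x := enum [set b in D | g b == x].
pose beta a := nth b0 (s2 (f a)) (index a (s1 (f a))).
have in1 a : a \in s1 (f a) by rewrite mem_enum inE.
have lt a : index a (s1 (f a)) < size (s2 (f a)).
  by rewrite -cardE -h cardE index_mem in1.
have in2 a : beta a \in [set b in D | g b == f a] by rewrite -mem_enum mem_nth.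
have gb a : g (beta a) = f a by have := in2 a; rewrite !inE => /andP[_ /eqP].
exists beta; split=> // [a a' E|a]; last by have := in2 a; rewrite !inE => /andP[].
have ff : f a = f a' by rewrite -!gb E.
move: E; rewrite /beta ff => /eqP.
rewrite nth_uniq ?enum_uniq // => [/eqP/(congr1 (nth a (s1 (f a'))))|]; last by rewrite -ff lt.
by rewrite !nth_index // -ff in1.
Qed.

Section StabPiece.
Variable K : graph.

Lemma stab_piece_fun G (s : stabilization K G) h k k' :
  stab_piece s h k -> stab_piece s h k' -> k = k'.
Proof.
elim: s h => {G} [G nl s|G x y e vx ney Ee s IH] /= h.
  by have [k0 kP] := smooth_piece_fun s h; rewrite !kP => /eqP-> /eqP->.
by case: insubP => // h' _ _; apply: IH.
Qed.

Lemma smooth_colour (C : Type) G (s : smoothing K G) (f : vert G -> C) k :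
  (forall h, smooth_piece s h k -> const_on f (ends h)) ->
  const_on (f \o smooth_vert s) (ends k).
Proof.
elim: s f => {G} [G a nv|G x y e f vx ney Ee xf nef s IH] /= c cP.
  apply: (const_on_comp (g := gisoV a)); rewrite -giso_ends.
  by apply: cP; rewrite eqxx.
apply: (IH (c \o val)) => h ph.
have cv a : a \in ends (val h) -> c (val (contract_proj e y a)) = c a.
  rewrite (val_proj ney Ee); case: eqP => // -> xh.
  have hf : val h = f.
    have [E|//] := val2_edges vx ney Ee xf nef xh.
    by have := valP h; rewrite E eqxx.
  apply: (cP e); rewrite ?Ee ?inE ?eqxx ?orbT // -/(smooth_cast nef e).
  suff -> : smooth_cast nef e = h by [].
  by apply: val_inj; rewrite val_smooth_cast eqxx hf.
move=> u v /imsetP[a ah ->] /imsetP[b bh ->] /=; rewrite !cv //.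
by apply: cP ah bh; rewrite -/(smooth_cast nef _) smooth_castK.
Qed.

Lemma stab_colour (C : Type) G (s : stabilization K G) (f : vert G -> C) k :
  (forall h, stab_piece s h k -> const_on f (ends h)) ->
  const_on (f \o stab_vert s) (ends k).
Proof.
elim: s f => {G} [G nl s|G x y e vx ney Ee s IH] /= c cP.
  exact: smooth_colour.
apply: (IH (c \o val)) => h ph.
have cv a : a \in ends (val h) -> c (val (contract_proj e y a)) = c a.
  rewrite (val_proj ney Ee); case: eqP => // -> xh.
  have eh : e != val h by rewrite eq_sym (valP h).
  have := deg2_le_valence x eh; rewrite vx -deg_gt0 in xh *.
  have : 0 < deg e x by rewrite deg_gt0 Ee !inE eqxx.
  lia.
move=> u v /imsetP[a ah ->] /imsetP[b bh ->] /=; rewrite !cv //.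
by apply: (cP (val h)) ah bh; rewrite valK.
Qed.

End StabPiece.

(* A trigonal type as three copies of the tree with some vertices over a common
   vertex identified and some vertical edges added. *)
Record sheets (G : graph) : Type := Sheets {
  sh_T : graph;
  sh_src : graph;
  sh_smooth : smoothing G sh_src;
  sh_map : vert sh_src -> vert sh_T;
  sh_L : vert sh_T -> 'I_3 -> vert sh_src;
  sh_K : edge sh_T -> 'I_3 -> edge sh_src;
  sh_tree : is_tree sh_T;
  sh_T2 : 1 < #|vert sh_T|;
  sh_val2 : forall x : vert sh_src, 2 <= valence x;
  sh_LK : forall t i, sh_map (sh_L t i) = t;
  sh_onto : forall x, exists i, x = sh_L (sh_map x) i;
  sh_inj : forall e e' i i', sh_K e i = sh_K e' i' -> e = e' /\ i = i';
  sh_ends : forall e i, ends (sh_K e i) = [set sh_L t i | t in ends e];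
  sh_vertical : forall h, (forall e i, h != sh_K e i) -> ~~ loop h /\
    exists t, forall x, x \in ends h -> sh_map x = t;
  sh_surj : forall t, exists2 x, sh_map x = t & 3 <= valence x }.

Section Structure.
Variables (G : wgraph) (tau : trigonal_type G).
Local Notation Gam := (source tau).
Local Notation T := (target tau).
Local Notation f := (phi tau).
Local Notation st := (stab tau).
Let tT : is_tree T := trig_tree tau.

Definition over (e : edge T) : {set edge Gam} := [set h | morE f h == inr e].

Lemma trig_T2 : 1 < #|vert T|.
Proof. by have [h _] := trig_degree tau; have [_ ->] := tT. Qed.

Lemma over_index h e : h \in over e -> 0 < Defs.index f h.
Proof.
rewrite inE => /eqP E; rewrite lt0n; apply/eqP => /index_eq0[t].
by rewrite E.
Qed.

Lemma sum_over e : \sum_(h in over e) Defs.index f h = 3.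
Proof.
have [_ dg] := trig_degree tau; rewrite -(dg e).
by apply: eq_bigl => h; rewrite inE.
Qed.

Lemma over_le3 e : #|over e| <= 3.
Proof.
rewrite -(sum_over e) -sum1_card; apply: leq_sum => h; exact: over_index.
Qed.

Lemma over_ends h e : h \in over e -> [set morV f x | x in ends h] = ends e.
Proof. by rewrite inE => /eqP E; have := mor_ends f h; rewrite E. Qed.

(* The T-edge e separates T, hence the edges of G above e separate V(G). *)
Lemma edges_over e :
  3 <= #|[set k : edge G | [exists h in over e, piece h k]]|.
Proof.
set S := [set k | _]; rewrite ltnNge; apply/negP => S2.
have [X XP] := tree_cut tT e.
have [_ conn] := trig_3conn tau S2.
have [a [b [E ab]]] := tree_edge_ends tT e.
have cX : X a != X b by rewrite -(cross_pair X E) XP eqxx.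
have [u Eu] := @trig_surj G tau a; have [v Ev] := @trig_surj G tau b.
have /(connect_colour (F := fun x : vert G => X (morV f (stab_vert st (x : vert (weightless G)))))) := conn u v.
rewrite Eu Ev => h; move: cX; rewrite h ?eqxx // => k kS.
apply: (@stab_colour _ _ _ st (X \o morV f) (inl k)) => h' ph'.
have nh : morE f h' != inr e.
  apply: contraNneq kS => hE; rewrite inE; apply/exists_inP; exists h' => //.
  by rewrite inE hE.
apply: const_on_comp; have := mor_ends f h'; case: (morE f h') nh => [t|e'] nh ->.
  by move=> x y; rewrite !inE => /eqP-> /eqP->.
by apply/crossPn; rewrite XP; apply: contraNneq nh => ->.
Qed.

(** Choosing a piece over [e] for each edge counted in [edges_over] is injective, as a piece belongs
    to one edge only. So at least 3 elements of [over e] are pieces of edges of [G], and the degree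
    allows no further element. *)
Lemma over_card_piece e : #|over e| = 3 /\
  forall h, h \in over e -> exists k : edge G, piece h k.
Proof.
set S := [set k : edge G | [exists h in over e, piece h k]].
have S3 : 3 <= #|S| := edges_over e.
pose D := [set h in over e | [exists k : edge G, piece h k]].
have /card_gt0P[k0 k0S] : 0 < #|S| by apply: leq_trans S3.
have h0 : edge Gam by move: k0S; rewrite inE => /exists_inP/sig2W[h _ _]; exact: h.
pose c k := odflt h0 [pick h | (h \in over e) && piece h k].
have cP k : k \in S -> (c k \in over e) && piece (c k) k.
  rewrite inE => /exists_inP[h ho ph]; rewrite /c; case: pickP => //= /(_ h).
  by rewrite ho ph.
have inj : {in S &, injective c}.
  move=> k k' /cP/andP[_ p1] /cP/andP[_ p2] E; rewrite E in p1.
  by have := stab_piece_fun p1 p2 => -[].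
have le1 : #|S| <= #|D|.
  rewrite -(card_in_imset inj); apply/subset_leq_card/subsetP => h /imsetP[k kS ->].
  rewrite inE; have /andP[-> pk] := cP _ kS; by apply/existsP; exists k.
have sub : D \subset over e by apply/subsetP => h; rewrite inE => /andP[].
have le2 := subset_leq_card sub; have le3 := over_le3 e.
have /eqP DE : D == over e by rewrite eqEcard sub; lia.
split; first lia.
by move=> h; rewrite -DE inE => /andP[_ /existsP].
Qed.

Lemma over_card e : #|over e| = 3. Proof. by have [] := over_card_piece e. Qed.

Lemma over_piece e h : h \in over e -> exists k : edge G, piece h k.
Proof. by have [_] := over_card_piece e; apply. Qed.

Lemma over_index1 e h : h \in over e -> Defs.index f h = 1.
Proof.
move=> ho; have := sum_over e; rewrite (bigD1 h) //=.
have := over_card e; rewrite (cardsD1 h) ho => -[c2].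
have : \sum_(i in over e | i != h) 1 <= \sum_(i in over e | i != h) Defs.index f i.
  by apply: leq_sum => i /andP[io _]; apply: over_index io.
have -> : \sum_(i in over e | i != h) 1 = #|over e :\ h|.
  by rewrite -sum1_card; apply: eq_bigl => i; rewrite !inE andbC.
have := over_index ho; lia.
Qed.

Lemma local_degree_over x e : local_degree f x e = #|[set h in over e | x \in ends h]|.
Proof.
rewrite /local_degree -sum1_card; apply: eq_big => [h|h /andP[_ ho]].
  by rewrite !inE andbC.
by apply: (@over_index1 e); rewrite inE.
Qed.

Lemma over_at (x : vert Gam) : exists e h, [/\ morV f x \in ends e, h \in over e & x \in ends h].
Proof.
have [e xe] := tree_valence_edge tT trig_T2 (morV f x).
have [_ nd] := trig_nondegenerate tau.
have := nd x e xe; rewrite local_degree_over => /card_gt0P[h].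
by rewrite inE => /andP[ho xh]; exists e, h.
Qed.

(** By non-degeneracy every vertex lies on an edge over an edge of [T]. At a leaf this would be the
    pruned edge, which is a piece of nothing, against [over_piece]. *)
Lemma stab_smoothing : exists nl s, st = PruneDone nl s.
Proof.
case E : st => [nl s|x y e vx ney Ee s]; first by exists nl, s.
have [e' [h [_ ho xh]]] := over_at x.
have [k] := over_piece ho; rewrite /piece E /=.
have he : h = e.
  apply/eqP; apply: contraT => he; have := deg2_le_valence x he; rewrite vx.
  have : 0 < deg h x by rewrite deg_gt0.
  have : 0 < deg e x by rewrite deg_gt0 Ee !inE eqxx.
  lia.
by rewrite he insubN // eqxx.
Qed.

Lemma source_val2 (x : vert Gam) : 2 <= valence x.
Proof.
have [e [h [_ _ xh]]] := over_at x; have [nl _] := stab_smoothing.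
have := nl x; have := deg_le_valence h x; have : 0 < deg h x by rewrite deg_gt0.
by case: valence => [|[|]] //; lia.
Qed.

(** A positive weight gives a loop [k] of [G^w], none of whose pieces lies over an edge of [T]. A
    piece is not a loop, because contracted loops are excluded, so one of its ends is a subdivision
    vertex of valence 2. There an edge over [T] exists, and it is a piece of [k] as well. *)
Lemma trig_weightless (v : vert G) : wt v = 0.
Proof.
have [nl [s stE]] := stab_smoothing.
case wv : (wt v) => [//|n].
have lt : 0 < wt v by rewrite wv.
pose k : edge (weightless G) := inr (existT _ v (Ordinal lt)).
have hor h e : smooth_piece s h k -> h \notin over e.
  move=> ph; apply/negP => /over_piece[k']; rewrite /piece stE /= => pk'.
  have [k0 k0P] := smooth_piece_fun s h; move: ph pk'.
  by rewrite !k0P => /eqP<- /eqP.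
pose h := smooth_rep s k; have ph : smooth_piece s h k := smooth_rep_piece s k.
have [x [y E]] := ends_pair h.
have xy : x != y.
  rewrite -(pair_loop E); apply/negP => lh.
  have [nd _] := trig_nondegenerate tau; have [e he] := nd h lh.
  by have := hor h e ph; rewrite inE he eqxx.
have [z zh vz] : exists2 z, z \in ends h & valence z = 2.
  case: (eqVneq (valence x) 2) => [vx|vx]; first by exists x; rewrite // E !inE eqxx.
  case: (eqVneq (valence y) 2) => [vy|vy]; first by exists y; rewrite // E !inE eqxx orbT.
  have [u Eu] := smooth_vert_onto s vx; have [w Ew] := smooth_vert_onto s vy.
  have : u \in ends k by apply: smooth_piece_ends ph _; rewrite Eu E !inE eqxx.
  have : w \in ends k by apply: smooth_piece_ends ph _; rewrite Ew E !inE eqxx orbT.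
  rewrite /= !inE => /eqP wE /eqP uE.
  by rewrite -Eu -Ew uE wE eqxx in xy.
have [e [h2 [_ ho zh2]]] := over_at z.
by have := hor h2 e (smooth_piece_adj vz zh zh2 ph); rewrite ho.
Qed.

(** The local degree at [x], a plain count because all indices are 1, read at an arbitrary edge of
    [T]. The default 0 is never reached, as every vertex of [T] has an edge. *)
Definition mdeg (x : vert Gam) : nat :=
  if [pick e | morV f x \in ends e] is Some e then #|[set h in over e | x \in ends h]| else 0.

Lemma mdegE x e : morV f x \in ends e -> #|[set h in over e | x \in ends h]| = mdeg x.
Proof.
move=> xe; rewrite /mdeg; case: pickP => [e' xe'|/(_ e)]; last by rewrite xe.
by rewrite -!local_degree_over; apply: trig_harmonic.
Qed.

Lemma source_vert : exists x : vert Gam, True.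
Proof.
have [r _] := tree_root tT; have [u _] := @trig_surj G tau r.
by exists (stab_vert st u).
Qed.

(** [o t h] is the end of [h] over [t]. It is unique because the two ends of [h] lie over the two
    distinct ends of [e]. *)
Lemma end_over : exists o : vert T -> edge Gam -> vert Gam,
  forall e h a b, h \in over e -> ends e = [set a; b] -> a != b ->
    [/\ ends h = [set o a h; o b h], morV f (o a h) = a &
        forall x, x \in ends h -> morV f x = a -> x = o a h].
Proof.
have [x0 _] := source_vert.
exists (fun t h => odflt x0 [pick x | (x \in ends h) && (morV f x == t)]).
move=> e h a b ho E ab.
have oP t x : t \in ends e -> x \in ends h -> morV f x = t ->
  odflt x0 [pick x | (x \in ends h) && (morV f x == t)] = x.
  move=> te xh xt; have [u [w Eh]] := ends_pair h.
  have Ei : [set morV f u; morV f w] = [set a; b].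
    by rewrite -E -(over_ends ho) Eh imsetU1 imset_set1.
  have uw : morV f u != morV f w.
    by apply: contraNneq ab => uw; move: Ei; rewrite uw setUid => /setP Ei;
      have := Ei a; have := Ei b; rewrite !inE !eqxx orbT => /eqP-> /eqP->.
  case: pickP => [x'|/(_ x)]; last by rewrite xh xt eqxx.
  move: xh; rewrite Eh !inE => xh /andP[x'h /eqP x't] /=; move: uw xt x't.
  by case/orP: xh => /eqP-> ; case/orP: x'h => /eqP-> // uw e1 e2;
    rewrite e1 e2 eqxx in uw.
have ex t : t \in ends e -> exists2 x, x \in ends h & morV f x = t.
  by rewrite -(over_ends ho) => /imsetP[x xh ->]; exists x.
have ae : a \in ends e by rewrite E !inE eqxx.
have be : b \in ends e by rewrite E !inE eqxx orbT.
have [x xh xa] := ex a ae; have [y yh yb] := ex b be.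
rewrite (oP a x) // (oP b y) //; split=> // [|x' x'h x'a]; last by rewrite -(oP a x') // (oP a x).
have xy : x != y by apply: contraNneq ab => xy; rewrite -xa -yb xy.
apply/esym/eqP; rewrite eqEcard subUset !sub1set xh yh cards2 xy.
by have /andP[] := card_ends h.
Qed.

(** Sheets are numbered along the growing tree. The invariant is that a vertex [x] lies on exactly
    [mdeg x] sheets; as harmonicity makes this number the same at all edges, the numbering extends
    over the next edge. *)
Lemma labelling : exists (L : vert T -> 'I_3 -> vert Gam) (K : edge T -> 'I_3 -> edge Gam),
  [/\ forall t i, morV f (L t i) = t,
      forall x, exists i, x = L (morV f x) i,
      forall e, injective (K e),
      forall e i, K e i \in over e &
      forall e i, ends (K e i) = [set L t i | t in ends e]].
Proof.
have [r _] := tree_root tT; have [x0 _] := source_vert.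
have [o oP] := end_over.
have [e0 re0] := tree_valence_edge tT trig_T2 r.
have [h0 _] : exists h, h \in over e0 by apply/card_gt0P; rewrite over_card.
pose good (A : {set vert T}) (B : {set edge T}) (L : vert T -> 'I_3 -> vert Gam) (K : edge T -> 'I_3 -> edge Gam) :=
  [/\ forall t i, t \in A -> morV f (L t i) = t,
      forall x, morV f x \in A -> #|[set i | L (morV f x) i == x]| = mdeg x &
      forall e, e \in B -> [/\ injective (K e), forall i, K e i \in over e &
         forall i, ends (K e i) = [set L t i | t in ends e]]].
have count e (beta : 'I_3 -> edge Gam) a b x : injective beta -> (forall i, beta i \in over e) ->
    ends e = [set a; b] -> a != b -> morV f x = a ->
    #|[set i | o a (beta i) == x]| = #|[set h in over e | x \in ends h]|.
  move=> bi bO E ab xa; rewrite -(card_imset _ bi); apply: eq_card => h.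
  have ev h' : h' \in over e -> (o a h' == x) = (x \in ends h').
    move=> h'o; have [Eh _ u] := oP e h' a b h'o E ab.
    by apply/eqP/idP => [<-|/u/(_ xa) //]; rewrite Eh !inE eqxx.
  rewrite [RHS]inE; apply/imsetP/andP => [[i]|[ho xh]].
    by rewrite inE => ix ->; rewrite -ev.
  have /setP/(_ h) : [set beta i | i : 'I_3] = over e.
    apply/eqP; rewrite eqEcard card_imset // card_ord over_card andbT.
    by apply/subsetP => h' /imsetP[i _ ->].
  by rewrite ho => /imsetP[i _ hi]; exists i; rewrite // inE -hi ev.
have := tree_ind tT (r := r) (Q := fun A B => exists L K, good A B L K).
case=> [|A B a b e aA bA eB E sB [L [K [LA LC KB]]]|L [K [LA LC KB]]].
- have [b Eb] := other_end re0.
  have rb : r != b by rewrite -(pair_loop Eb) (negbTE (tree_nonloop tT e0)).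
  have [|beta [binj bO _]] := @match_fibres 'I_3 _ unit (fun _ => tt) (fun _ => tt) (over e0) h0.
    move=> []; have -> : [set a : 'I_3 | tt == tt] = setT by apply/setP => i; rewrite !inE.
    have -> : [set h in over e0 | tt == tt] = over e0 by apply/setP => i; rewrite inE andbT.
    by rewrite cardsT card_ord over_card.
  exists (fun _ i => o r (beta i)), (fun _ => beta); split.
  + by move=> t i; rewrite inE => /eqP->; have [_ ->] := oP _ _ _ _ (bO i) Eb rb.
  + move=> x; rewrite inE => /eqP xr; rewrite -(@mdegE x e0) ?xr //.
    by apply: (count e0 _ r b).
  + by move=> e; rewrite inE.
- have ab : a != b by apply: contraNneq bA => <-.
  have [h _] : exists h, h \in over e by apply/card_gt0P; rewrite over_card.
  (* Over each [x] above [a], the sheets through [x] and the edges over [e] at [x] both number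
     [mdeg x]. So sheet [i] can be continued along an edge [beta i] that starts at [L a i]; its
     other end becomes [L b i]. *)
  have [|beta [binj bO bg]] := @match_fibres 'I_3 _ _ (L a) (o a) (over e) h.
    move=> x; case: (eqVneq (morV f x) a) => xa.
      have -> : #|[set i | L a i == x]| = mdeg x by rewrite -LC ?xa.
      rewrite -(@mdegE x e); last by rewrite xa E !inE eqxx.
      apply: eq_card => h'; rewrite !inE; case: (boolP (h' \in over e)) => h'o; rewrite !inE in h'o; rewrite ?h'o ?(negbTE h'o) //=.
      have [|Eh _ u] := oP e h' a b _ E ab; first by rewrite inE.
      by apply/idP/eqP => [/u/(_ xa) //|<-]; rewrite Eh !inE eqxx.
    have -> : [set i | L a i == x] = set0.
      by apply/setP => i; rewrite !inE; apply: contraNF xa => /eqP<-; rewrite LA.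
    have -> : [set h in over e | o a h == x] = set0.
      apply/setP => h'; rewrite !inE; apply: contraNF xa => /andP[h'o /eqP<-].
      by have [|_ ->] := oP e h' a b _ E ab; first by rewrite inE.
    by rewrite !cards0.
  exists (fun t i => if t == b then o b (beta i) else L t i), (fun e' => if e' == e then beta else K e').
  have E' : ends e = [set b; a] by rewrite setUC.
  have ba : b != a by rewrite eq_sym.
  split.
  + move=> t i; rewrite !inE; case: (eqVneq t b) => [-> _|_]; last exact: LA.
    by have [_ ->] := oP _ _ _ _ (bO i) E' ba.
  + move=> x; rewrite !inE; case: (eqVneq (morV f x) b) => [xb _|_]; last exact: LC.
    rewrite -(@mdegE x e); last by rewrite xb E !inE eqxx orbT.
    by apply: (count e _ b a).
  + move=> e'; rewrite !inE; case: (eqVneq e' e) => [-> _|ee' /= e'B].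
      split=> // i; have [-> _ _] := oP _ _ _ _ (bO i) E ab.
      by rewrite E imsetU1 imset_set1 eqxx (negbTE ab) bg.
    have [KI KO KE] := KB _ e'B; split=> // i; rewrite KE.
    apply: eq_in_imset => t te; case: eqP => // tb.
    by have /subsetP/(_ _ te) := sB _ e'B; rewrite tb (negbTE bA).
- exists L, K; split.
  + by move=> t i; apply: LA; rewrite inE.
  + move=> x; have := LC x; rewrite inE => /(_ isT) c.
    have [e xe] := tree_valence_edge tT trig_T2 (morV f x).
    have [_ nd] := trig_nondegenerate tau.
    have := nd x e xe; rewrite local_degree_over mdegE // -c => /card_gt0P[i].
    by rewrite inE => /eqP xi; exists i.
  + by move=> e; have [] := KB e (in_setT e).
  + by move=> e; have [] := KB e (in_setT e).
  + by move=> e; have [] := KB e (in_setT e).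
Qed.

Lemma trigonal_sheets : inhabited (sheets G) /\ forall v : vert G, wt v = 0.
Proof.
split; last exact: trig_weightless.
have [nl [s stE]] := stab_smoothing.
have [a aV _] := weightless_giso trig_weightless.
have [psi psiK c] := contr_giso a; have [b _ bV] := giso_contr c.
have [s' [sv' _]] := smoothing_iso b s.
have [L [K [LA LO Kinj KO KE]]] := labelling.
constructor; apply: (@Sheets G T Gam s' (morV f) L K) => //.
- exact: trig_T2.
- exact: source_val2.
- move=> e e' i i' E; have := KO e i; have := KO e' i'; rewrite -E !inE => /eqP-> /eqP[ee'].
  by move: E; rewrite ee' => /Kinj.
- move=> h hK; case hE : (morE f h) => [t|e].
    split; last first.
      exists t => x xh; have := mor_ends f h; rewrite hE => /setP/(_ (morV f x)).
      by rewrite imset_f // inE => /esym/eqP.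
    apply/negP => lh; have [nd _] := trig_nondegenerate tau; have [e he] := nd h lh.
    by rewrite hE in he.
  have : [set K e i | i : 'I_3] = over e.
    apply/eqP; rewrite eqEcard card_imset // card_ord over_card andbT.
    by apply/subsetP => h' /imsetP[i _ ->].
  move/setP/(_ h); rewrite [in RHS]inE hE eqxx => /imsetP[i _ hi].
  by have := hK e i; rewrite hi eqxx.
- move=> t; have [u Eu] := @trig_surj G tau t; rewrite stE /= in Eu.
  exists (smooth_vert s u) => //; rewrite smooth_vert_valence.
  have := smoothed_valence s u; have := source_val2 (smooth_vert s u).
  by rewrite smooth_vert_valence; case: valence => [|[|[]]].
Qed.

End Structure.

(** * Expanding the tree *)

Lemma card_option_set (I : finType) (P : pred (option I)) :
  #|[set o | P o]| = P None + #|[set i | P (Some i)]|.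
Proof.
have -> : [set o | P o] = (if P None then [set None] else set0) :|: Some @: [set i | P (Some i)].
  apply/setP => -[i|]; rewrite !inE.
    rewrite mem_imset; last by move=> x y [].
    by rewrite inE; case: (P None); rewrite !inE.
  have -> : (None \in Some @: [set i | P (Some i)]) = false by apply/negP => /imsetP[].
  by case: (P None); rewrite !inE.
rewrite cardsU card_imset; last by move=> x y [].
rewrite (_ : _ :&: _ = set0) ?cards0 ?subn0.
  by case: (P None); rewrite ?cards1 ?cards0.
apply/setP => -[i|]; rewrite !inE; first by case: (P None); rewrite !inE.
by apply/negP => /andP[_ /imsetP[]].
Qed.

Section Split.
Variables (T : graph) (t : vert T) (A : {set edge T}).
Hypothesis tT : is_tree T.
Hypothesis At : forall e, e \in A -> t \in ends e.

Definition split_vert (e : edge T) (u : vert T) : option (vert T) :=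
  if (e \in A) && (u == t) then None else Some u.

Definition split_ends (e : option (edge T)) : {set option (vert T)} :=
  match e with
  | None => [set None; Some t]
  | Some e => [set split_vert e u | u in ends e]
  end.

Lemma split_vert_inj e : injective (split_vert e).
Proof.
move=> u w; rewrite /split_vert; case: (e \in A) => /= [|[] //].
by case: eqP => [->|_]; case: eqP => [->|_] // [].
Qed.

Lemma card_split_ends e : 0 < #|split_ends e| <= 2.
Proof.
case: e => [e|] /=; last by rewrite cards2.
by rewrite card_imset ?card_ends //; apply: split_vert_inj.
Qed.

(* The new vertex None takes over from t the edges in A. *)
Definition split_tree : graph := Graph card_split_ends.

Definition split_proj (x : vert split_tree) : vert T := odflt t x.

Lemma split_projK e u : split_proj (split_vert e u) = u.
Proof. by rewrite /split_proj /split_vert; case: andP => [[_ /eqP->]|]. Qed.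

Lemma split_connected : connected_graph split_tree.
Proof.
have [cT _] := tT; apply: colour_connected; first by apply/card_gt0P; exists None.
move=> F cF.
have Ft : F None = F (Some t) by apply: (cF None); rewrite !inE ?eqxx ?orbT.
have Fp x : F x = F (Some (split_proj x)) by case: x.
have FS u w : F (Some u) = F (Some w).
  apply: (connected_colour (F := fun u => F (Some u)) cT) => e u' w' ue we.
  have := cF (Some e) (split_vert e u') (split_vert e w').
  rewrite (Fp (split_vert e u')) (Fp (split_vert e w')) !split_projK.
  by apply; apply: imset_f.
by move=> x y; rewrite Fp (Fp y).
Qed.

Lemma split_is_tree : is_tree split_tree.
Proof. by split; [exact: split_connected | rewrite /= !card_option; have [_ ->] := tT]. Qed.

Lemma mem_split_None e : (None \in ends (Some e : edge split_tree)) = (e \in A).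
Proof.
apply/imsetP/idP => [[u _]|eA]; first by rewrite /split_vert; case: (e \in A).
by exists t; [exact: At | rewrite /split_vert eA eqxx].
Qed.

Lemma mem_split_Some e u : (Some u \in ends (Some e : edge split_tree)) =
  (u \in ends e) && ~~ ((e \in A) && (u == t)).
Proof.
apply/imsetP/andP => [[w we]|[ue h]].
  by rewrite /split_vert; case: ifP => // h [->]; rewrite h.
by exists u; rewrite // /split_vert (negbTE h).
Qed.

Lemma split_valence_None : valence (None : vert split_tree) = #|A|.+1.
Proof.
rewrite (tree_valence split_is_tree) card_option_set /= !inE eqxx /= add1n; congr _.+1.
by apply: eq_card => e; rewrite inE mem_split_None.
Qed.

Lemma split_valence_Some u : valence (Some u : vert split_tree) =
  if u == t then (valence t - #|A|).+1 else valence u.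
Proof.
rewrite (tree_valence split_is_tree) card_option_set.
have -> : (Some u \in ends (None : edge split_tree)) = (u == t) by rewrite !inE.
rewrite (_ : [set i | _] = [set e | u \in ends e] :\: [set e | (e \in A) && (u == t)]); last first.
  by apply/setP => e; rewrite [LHS]inE mem_split_Some !inE andbC.
case: eqP => [->|_]; last first.
  rewrite (_ : [set e | _ && false] = set0) ?setD0 -?tree_valence //.
  by apply/setP => e; rewrite !inE andbF.
rewrite add1n; congr _.+1; rewrite (tree_valence tT) cardsD; congr (_ - _).
apply: eq_card => e; rewrite !inE andbT andbC.
by case: (boolP (e \in A)) => // /At ->.
Qed.

Lemma split_contr : contr ([set None] : {set edge split_tree}) split_proj (Some : edge T -> edge split_tree).
Proof.
split.
- by move=> z; exists (Some z).
- by move=> e e' [].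
- move=> [e|]; rewrite inE; last by apply/esym/negP => /codomP[].
  by apply/esym/negbTE; rewrite negbK; apply/codomP; exists e.
- move=> e /=; rewrite -imset_comp -[LHS]imset_id; apply: eq_imset => u /=.
  by rewrite split_projK.
- by move=> e; rewrite inE => /eqP->; apply: const_on_pair.
- move=> x y xy; apply: in_colour_connect => F cF.
  have Ft : F None = F (Some t) by apply: (cF None); rewrite !inE ?eqxx ?orbT.
  have Fp z : F z = F (Some (split_proj z)) by case: z.
  by rewrite Fp xy -Fp.
- by rewrite /= card_option cards1 addn1.
Qed.

End Split.

Section Rungs.
Variables (N : finType) (pr : N -> {set 'I_3}).

Definition at_vert (T : graph) (pos : N -> vert T) (t : vert T) : {set N} := [set n | pos n == t].

(** What survives from [lad_valid] before the tree is expanded: too many rungs and too high valences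
    are tolerated. [pl_leaf] makes the last two rungs over a leaf non-parallel in the end. *)
Record prelad (T : graph) (pos : N -> vert T) : Prop := Prelad {
  pl_tree : is_tree T;
  pl_T2 : 1 < #|vert T|;
  pl_three : forall t, 3 <= valence t + #|at_vert pos t|;
  pl_leaf : forall t, valence t = 1 -> exists n n', [/\ pos n = t, pos n' = t & pr n != pr n'] }.

Lemma sum_at_vert (T : graph) (pos : N -> vert T) : \sum_t #|at_vert pos t| = #|N|.
Proof.
rewrite -[RHS]sum1_card (partition_big pos predT) //=; apply: eq_bigr => t _.
by rewrite -sum1_card; apply: eq_bigl => n; rewrite inE.
Qed.

(** Summing [pl_three] over the tree bounds its size by the fixed number of rungs, so the expansion
    terminates. *)
Lemma prelad_card (T : graph) (pos : N -> vert T) : prelad pos -> #|vert T| + 2 <= #|N|.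
Proof.
move=> p; have [sv svE] : exists s, s = \sum_(x : vert T) valence x by eexists.
have := sum_tree_valence (pl_tree p) (pl_T2 p); rewrite -svE.
have : \sum_(t : vert T) 3 <= \sum_t (valence t + #|at_vert pos t|).
  by apply: leq_sum => t _; apply: pl_three.
rewrite big_split /= sum_at_vert -svE.
have -> : \sum_(t : vert T) 3 = 3 * #|vert T| by rewrite sum_nat_const mulnC.
by move: #|vert T| #|N| => a b; lia.
Qed.

(** Two items, edges or rungs, move to the new vertex, which with the new edge has total 3. The old
    vertex loses two and gains one, hence the bound 4. If it keeps no old edge it becomes a leaf,
    and two rungs with different pairs must stay there. *)
Lemma split_prelad (T : graph) (pos : N -> vert T) (t : vert T) (A : {set edge T}) (M : {set N}) :
  prelad pos -> (forall e, e \in A -> t \in ends e) -> (forall n, n \in M -> pos n = t) ->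
  0 < #|A| -> #|A| + #|M| = 2 -> 4 <= valence t + #|at_vert pos t| ->
  (valence t = #|A| -> exists n n', [/\ pos n = t, pos n' = t, n \notin M, n' \notin M & pr n != pr n']) ->
  @prelad (split_tree t A) (fun n => if n \in M then None else Some (pos n)).
Proof.
move=> p At Mt A0 AM t4 leaf; set pos' : N -> vert (split_tree t A) := fun n => _.
have tT := pl_tree p; have tT' := split_is_tree t A tT.
have Av : #|A| <= valence t.
  by rewrite (tree_valence tT); apply/subset_leq_card/subsetP => e /At; rewrite inE.
have cN : at_vert pos' None = M.
  by apply/setP => n; rewrite inE /pos'; case: (n \in M).
have cS u : u != t -> at_vert pos' (Some u) = at_vert pos u.
  move=> ut; apply/setP => n; rewrite !inE /pos'; case: (boolP (n \in M)) => // nM.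
  by rewrite (Mt n nM) [RHS]eq_sym (negbTE ut).
have ct : #|at_vert pos' (Some t)| = #|at_vert pos t| - #|M|.
  have -> : at_vert pos' (Some t) = at_vert pos t :\: M.
    by apply/setP => n; rewrite !inE /pos'; case: (n \in M).
  rewrite cardsD; congr (_ - _); apply: eq_card => n; rewrite !inE andbC.
  by case: (boolP (n \in M)) => // /Mt ->; rewrite eqxx.
have cM : #|M| <= #|at_vert pos t|.
  by apply/subset_leq_card/subsetP => n /Mt; rewrite inE => ->.
split=> //.
- by rewrite /= card_option; have := pl_T2 p; lia.
- case=> [u|]; last by rewrite split_valence_None // cN; lia.
  rewrite split_valence_Some //; case: (eqVneq u t) => [->|ut].
    by rewrite ct; lia.
  by rewrite cS //; apply: pl_three.
- case=> [u|]; last by rewrite split_valence_None //; lia.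
  rewrite split_valence_Some //; case: (eqVneq u t) => [->|ut].
    move=> E; have [|n [n' [pn pn' nM n'M pp]]] := leaf; first by lia.
    by exists n, n'; rewrite /pos' (negbTE nM) (negbTE n'M) pn pn'.
  move=> /(pl_leaf p)[n [n' [pn pn' pp]]]; exists n, n'; split=> //.
    by rewrite /pos' ifN ?pn //; apply: contraNN ut => /Mt <-; rewrite pn.
  by rewrite /pos' ifN ?pn' //; apply: contraNN ut => /Mt <-; rewrite pn'.
Qed.

(** Without rungs at [t], two edges move; at a non-leaf with a rung, one edge and one rung move; at
    a leaf there are at least three rungs, and one moves that is neither of the two given by
    [pl_leaf]. *)
Lemma split_step (T : graph) (pos : N -> vert T) (t : vert T) :
  prelad pos -> 4 <= valence t + #|at_vert pos t| ->
  exists (A : {set edge T}) (pos' : N -> vert (split_tree t A)),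
    prelad pos' /\ forall n, split_proj (pos' n) = pos n.
Proof.
move=> p t4; have tT := pl_tree p.
suff [A [M [At Mt A0 AM leaf]]] : exists (A : {set edge T}) (M : {set N}),
    [/\ forall e, e \in A -> t \in ends e, forall n, n \in M -> pos n = t,
        0 < #|A|, #|A| + #|M| = 2 & valence t = #|A| -> exists n n',
          [/\ pos n = t, pos n' = t, n \notin M, n' \notin M & pr n != pr n']].
  exists A; eexists; split; first exact: (split_prelad p At Mt A0 AM t4 leaf).
  by move=> n /=; case: ifP => // /Mt.
have [e0 te0] := tree_valence_edge tT (pl_T2 p) t.
have e1A e : e \in [set e0] -> t \in ends e by rewrite inE => /eqP->.
have [c0|/card_gt0P[n0]] := posnP #|at_vert pos t|; last rewrite inE => /eqP pn0.
  rewrite c0 addn0 (tree_valence tT) in t4.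
  have [e1 te1 e10] : exists2 e1, t \in ends e1 & e1 != e0.
    have : 0 < #|[set e | t \in ends e] :\ e0|.
      by move: t4; rewrite (cardsD1 e0) inE te0; lia.
    by case/card_gt0P => e1; rewrite !inE => /andP[]; exists e1.
  exists [set e0; e1], set0; rewrite !cards2 eq_sym e10 cards0; split=> //.
  - by move=> e; rewrite !inE => /orP[]/eqP->.
  - by move=> n; rewrite inE.
  - by rewrite (tree_valence tT); lia.
case: (eqVneq (valence t) 1) => vt; last first.
  exists [set e0], [set n0]; rewrite !cards1; split=> // [n|v1]; first by rewrite inE => /eqP->.
  by rewrite v1 in vt.
have [n [n' [pn pn' pp]]] := pl_leaf p vt.
have nn' : n != n' by apply: contraNneq pp => ->.
have [m [pm mn mn']] : exists m, [/\ pos m = t, m != n & m != n'].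
  have : 0 < #|at_vert pos t :\ n :\ n'|.
    move: t4; rewrite vt (cardsD1 n) inE pn eqxx (cardsD1 n' (_ :\ n)) !inE pn' eqxx eq_sym nn' /=.
    lia.
  by case/card_gt0P => m; rewrite !inE => /and3P[? ? /eqP ?]; exists m.
exists [set e0], [set m]; rewrite !cards1; split=> // [l|_]; first by rewrite inE => /eqP->.
by exists n, n'; rewrite !inE eq_sym mn eq_sym mn'.
Qed.

Lemma prelad_expand (T : graph) (pos : N -> vert T) : prelad pos ->
  exists (T' : graph) (pos' : N -> vert T') S q psi,
    [/\ @contr T' T S q psi, forall n, q (pos' n) = pos n & lad_valid pos' pr].
Proof.
have [k] := ubnP (#|N| - #|vert T|); elim: k T pos => // k IH T pos Tk p.
have [/existsP[t t4]|/existsPn all3] := boolP [exists t, 4 <= valence t + #|at_vert pos t|].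
  have [A [pos1 [p1 pos1E]]] := split_step p t4.
  have cN := prelad_card p.
  have [|T' [pos' [S [q [psi [c qE v]]]]]] := IH _ pos1 _ p1.
    have -> : #|vert (split_tree t A)| = #|vert T|.+1 by rewrite /= card_option.
    lia.
  do 5 eexists; split; last exact: v.
    exact: contr_comp c (split_contr t A).
  by move=> n /=; rewrite qE pos1E.
have three t : valence t + #|at_vert pos t| = 3.
  by have := all3 t; have := pl_three p t; lia.
have [psi _ c] := contr_giso (giso_refl T).
exists T, pos, set0, id, psi; split=> //.
have tT := pl_tree p.
split=> // [|n n' [pE prE]]; first exact: pl_T2 p.
(* Two parallel rungs in a total of 3 leave valence 1, so they are all the rungs of a leaf, against
   [pl_leaf]. *)
apply/eqP; apply: contraT => nn'.
have sub : [set n; n'] \subset at_vert pos (pos n).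
  by apply/subsetP => m; rewrite !inE => /orP[]/eqP->; rewrite ?pE eqxx.
have := subset_leq_card sub; rewrite cards2 nn' => c2.
have v1 : valence (pos n) = 1.
  by have := three (pos n); have := tree_valence_gt0 tT (pl_T2 p) (pos n); lia.
have /eqP E : [set n; n'] == at_vert pos (pos n).
  by rewrite eqEcard sub cards2 nn'; have := three (pos n); lia.
have [m [m' [pm pm' pp]]] := pl_leaf p v1.
have : m \in [set n; n'] by rewrite E inE pm.
have : m' \in [set n; n'] by rewrite E inE pm'.
by move: pp; rewrite !inE => pp /orP[]/eqP mE /orP[]/eqP m'E; move: pp; rewrite mE m'E ?prE eqxx.
Qed.

End Rungs.

(** * Every trigonal graph is a contraction of a ladder graph *)

Section SheetsLad.
Variables (G : graph) (sh : sheets G).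
Local Notation T := (sh_T sh).
Local Notation Gam := (sh_src sh).
Local Notation mp := (sh_map (s := sh)).
Local Notation L := (sh_L (s := sh)).
Local Notation K := (sh_K (s := sh)).

(** A chosen sheet among those that meet sheet [i] over [t]. It depends only on the vertex [L t i],
    so joining each sheet to its representative gives stars. *)
Definition sheet_rep (t : vert T) (i : 'I_3) : 'I_3 := odflt i [pick j | L t j == L t i].

Lemma sheet_repL t i : L t (sheet_rep t i) = L t i.
Proof. by rewrite /sheet_rep; case: pickP => [j /eqP|]. Qed.

Lemma eq_sheet_rep t i j : L t i = L t j -> sheet_rep t i = sheet_rep t j.
Proof.
move=> E; rewrite /sheet_rep.
have -> : [pick k | L t k == L t i] = [pick k | L t k == L t j].
  by apply: eq_pick => k; rewrite E.
by case: pickP => // /(_ j); rewrite eqxx.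
Qed.

Lemma sheet_LE t t' i j : L t i = L t' j -> t = t'.
Proof. by move=> E; rewrite -(sh_LK (s := sh) t i) E sh_LK. Qed.

Definition vertical (h : edge Gam) : bool := [forall e, forall i, h != K e i].

Lemma verticalPn h : reflect (exists e i, h = K e i) (~~ vertical h).
Proof.
apply: (iffP idP) => [|[e [i ->]]].
  rewrite negb_forall => /existsP[e]; rewrite negb_forall => /existsP[i /negPn/eqP ->].
  by exists e, i.
by apply/negP => /forallP/(_ e)/forallP/(_ i); rewrite eqxx.
Qed.

Lemma vertical_ends h : vertical h -> exists tij : vert T * ('I_3 * 'I_3),
  ends h = [set L tij.1 tij.2.1; L tij.1 tij.2.2] /\ tij.2.1 != tij.2.2.
Proof.
move=> vh; have [|nl [t tP]] := sh_vertical (s := sh) (h := h).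
  by move=> e i; move/forallP: vh => /(_ e)/forallP.
have [x [y E]] := ends_pair h.
have xt : mp x = t by apply: tP; rewrite E !inE eqxx.
have yt : mp y = t by apply: tP; rewrite E !inE eqxx orbT.
have [i xi] := sh_onto x; have [j yj] := sh_onto y.
exists (t, (i, j)); rewrite /= -{1}xt -{1}yt -xi -yj; split=> //.
apply: contraNneq nl => ij; rewrite (pair_loop E) xi yj ij xt yt eqxx //.
Qed.

(** The left summand has one rung for each sheet that is not its own representative; contracting it
    restores the identification. The right summand consists of the vertical edges. *)
Definition srung : finType :=
  ({p : vert T * 'I_3 | sheet_rep p.1 p.2 != p.2} + {h : edge Gam | vertical h})%type.

Variable vij : {h : edge Gam | vertical h} -> vert T * ('I_3 * 'I_3).
Hypothesis vijP : forall h, ends (val h) = [set L (vij h).1 (vij h).2.1; L (vij h).1 (vij h).2.2] /\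
  (vij h).2.1 != (vij h).2.2.

Definition srung_pos (n : srung) : vert T :=
  match n with inl p => (val p).1 | inr h => (vij h).1 end.
Definition srung_pair (n : srung) : {set 'I_3} :=
  match n with
  | inl p => [set (val p).2; sheet_rep (val p).1 (val p).2]
  | inr h => [set (vij h).2.1; (vij h).2.2]
  end.

Lemma srung_pair2 n : #|srung_pair n| = 2.
Proof.
case: n => [[[t i] p]|h] /=; rewrite cards2; first by rewrite eq_sym p.
by have [_ ->] := vijP h.
Qed.

Lemma sheet_valence t l : (forall n, srung_pos n = t -> l \notin srung_pair n) ->
  valence (L t l) = valence t.
Proof.
move=> nl.
have uniq i : L t i = L t l -> i = l.
  move=> E; have r := eq_sheet_rep E.
  case: (eqVneq (sheet_rep t l) l) => rl; last first.
    by have := nl (inl (exist _ (t, l) rl)) erefl; rewrite /= !inE eqxx.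
  apply/eqP; apply: contraT => il.
  have ri : sheet_rep t i != i by rewrite r rl eq_sym.
  by have := nl (inl (exist _ (t, i) ri)) erefl; rewrite /= !inE r rl eqxx orbT.
have inc h : (L t l \in ends h) = (h \in [set K e l | e in [set e | t \in ends e]]).
  apply/idP/imsetP => [|[e]]; last first.
    by rewrite inE => te ->; rewrite sh_ends; apply: imset_f.
  case: (boolP (vertical h)) => [vh|/verticalPn[e [i ->]]].
    have [E _] := vijP (exist _ h vh); rewrite /= in E; rewrite E !inE => hL.
    have tE : (vij (exist _ h vh)).1 = t by case/orP: hL => /eqP/sheet_LE ->.
    have := nl (inr (exist _ h vh)) tE; rewrite /= !inE.
    by rewrite tE in hL; case/orP: hL => /eqP/esym/uniq->; rewrite eqxx ?orbT.
  rewrite sh_ends => /imsetP[t' te E]; have tt := sheet_LE E; rewrite -tt in E te.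
  by exists e; rewrite ?inE // (uniq _ (esym E)).
have Kinj : injective (K^~ l) by move=> e e' /sh_inj[].
rewrite (tree_valence (sh_tree sh)) -(card_imset _ Kinj) valenceE -sum1_card [RHS]big_mkcond.
apply: eq_bigr => h _; rewrite -inc /deg.
case: (boolP (L t l \in ends h)) => //; rewrite mul1n inc => /imsetP[e _ ->].
have [a [b [E ab]]] := tree_edge_ends (sh_tree sh) e.
have -> : loop (K e l) = (L a l == L b l).
  by apply: pair_loop; rewrite sh_ends E imsetU1 imset_set1.
by rewrite ifN //; apply: contraNneq ab => /sheet_LE ->.
Qed.

(** Over a leaf each copy must meet a rung, since otherwise the source would have valence 1 there.
    As one rung misses a copy, a second rung with a different pair exists. Over a vertex of valence
    2 the source has a vertex of valence at least 3, which forces a rung. *)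
Lemma sheets_prelad : prelad srung_pair srung_pos.
Proof.
have tT := sh_tree sh; have T2 := sh_T2 sh.
have leaf t : valence t = 1 -> exists n n', [/\ srung_pos n = t, srung_pos n' = t & srung_pair n != srung_pair n'].
  move=> vt.
  have cov l : exists2 n, srung_pos n = t & l \in srung_pair n.
    have [/existsP[n /andP[/eqP pn ln]]|/existsPn no] := boolP [exists n, (srung_pos n == t) && (l \in srung_pair n)].
      by exists n.
    have := sh_val2 (L t l); rewrite sheet_valence ?vt // => n pn.
    by have := no n; rewrite pn eqxx.
  have [n pn _] := cov ord0; have [k Ek] := pair3 (srung_pair2 n).
  have [n' pn' kn'] := cov k; exists n, n'; split=> //.
  by apply: contraTneq kn' => <-; rewrite Ek !inE eqxx.
split=> // t; have := tree_valence_gt0 tT T2 t.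
case E : (valence t) => [//|[|[|m]]] _ //.
  have [n [n' [pn pn' pp]]] := leaf t E.
  have nn' : n != n' by apply: contraNneq pp => ->.
  have : #|[set n; n']| <= #|at_vert srung_pos t|.
    by apply/subset_leq_card/subsetP => m; rewrite !inE => /orP[]/eqP->; apply/eqP.
  by rewrite cards2 nn'.
have [no|] := posnP #|at_vert srung_pos t|; last by lia.
have [x xt] := sh_surj (s := sh) t; have [l xl] := sh_onto x.
rewrite xl xt sheet_valence ?E // => n pn.
by move/cards0_eq/setP: no => /(_ n); rewrite !inE pn eqxx.
Qed.

Section Expanded.
Variables (T' : graph) (pos' : srung -> vert T') (ST : {set edge T'})
  (qT : vert T' -> vert T) (psiT : edge T -> edge T').
Hypotheses (cT : contr ST qT psiT) (posE : forall n, qT (pos' n) = srung_pos n)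
  (tT' : is_tree T').
Local Notation Lam := (lad pos' srung_pair2).

Definition sheets_q (x : vert Lam) : vert Gam := L (qT x.1) x.2.

Lemma sheets_psi_ex (h : edge Gam) : exists x : edge Lam,
  (exists e i, h = K e i /\ x = inl (psiT e, i)) \/
  (exists v : {h | vertical h}, h = val v /\ x = inr (inr v)).
Proof.
case: (boolP (vertical h)) => [vh|/verticalPn[e [i ->]]].
  by exists (inr (inr (exist _ h vh))); right; exists (exist _ h vh).
by exists (inl (psiT e, i)); left; exists e, i.
Qed.

Variable psi : edge Gam -> edge Lam.
Hypothesis psiP : forall h,
  (exists e i, h = K e i /\ psi h = inl (psiT e, i)) \/
  (exists v : {h | vertical h}, h = val v /\ psi h = inr (inr v)).

Definition sheets_S : {set edge Lam} := [set e | e \notin codom psi].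

Lemma vertical_K e i : ~~ vertical (K e i).
Proof. by apply/verticalPn; exists e, i. Qed.

Lemma psi_K e i : psi (K e i) = inl (psiT e, i).
Proof.
case: (psiP (K e i)) => [[e' [i' [/sh_inj[-> ->]]]] //|[v [E _]]].
by have := valP v; rewrite -E (negbTE (vertical_K e i)).
Qed.

Lemma psi_v v : psi (val v) = inr (inr v).
Proof.
case: (psiP (val v)) => [[e [i [E _]]]|[w [/val_inj-> ->//]]].
by have := valP v; rewrite E (negbTE (vertical_K e i)).
Qed.

Lemma sheets_S_inl f i : ((inl (f, i) : edge Lam) \in sheets_S) = (f \in ST).
Proof.
rewrite inE (contr_in cT); congr (~~ _); apply/codomP/codomP => [[h]|[e ->]].
  by case: (psiP h) => [[e [j [_ ->]]] [-> _]|[v [_ ->]] //]; exists e.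
by exists (K e i); rewrite psi_K.
Qed.

Lemma sheets_S_inr n : ((inr n : edge Lam) \in sheets_S) = if n is inl _ then true else false.
Proof.
rewrite inE; case: n => [p|v]; last by apply/negbTE; rewrite negbK; apply/codomP; exists (val v); rewrite psi_v.
by apply/codomP => -[h]; case: (psiP h) => [[e [j [_ ->]]]|[v [_ ->]]].
Qed.

Lemma sheets_psi_inj : injective psi.
Proof.
move=> h h'; case: (psiP h) => [[e [i [-> ->]]]|[v [-> ->]]];
  case: (psiP h') => [[e' [i' [-> ->]]]|[v' [-> ->]]] //.
  by case=> /(contr_inj cT)-> ->.
by case=> ->.
Qed.

Lemma card_sheet_vert : #|vert Gam| + #|{: {p : vert T * 'I_3 | sheet_rep p.1 p.2 != p.2}}| = 3 * #|vert T|.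
Proof.
rewrite card_sig; pose D := [set p : vert T * 'I_3 | sheet_rep p.1 p.2 == p.2].
have -> : #|vert Gam| = #|D|.
  have inj : {in D &, injective (fun p => L p.1 p.2)}.
    move=> [t i] [t' i']; rewrite !inE /= => /eqP ri /eqP ri' E.
    by have tt := sheet_LE E; rewrite -tt in E ri' *; rewrite -ri -ri' (eq_sheet_rep E).
  rewrite -(card_in_imset inj) -cardsT; congr #|pred_of_set _|; apply/esym/setP => x; rewrite inE.
  have [i xi] := sh_onto x; apply/imsetP; exists (mp x, sheet_rep (mp x) i) => /=; last by rewrite sheet_repL.
  by rewrite inE /=; apply/eqP/eq_sheet_rep; rewrite sheet_repL.
have -> : 3 * #|vert T| = #|{: vert T * 'I_3}| by rewrite card_prod card_ord mulnC.
rewrite -(cardsC D); congr (_ + _).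
by apply: eq_card => p; rewrite !inE.
Qed.

Lemma card_sheet_edge : #|edge Gam| = 3 * #|edge T| + #|{: {h : edge Gam | vertical h}}|.
Proof.
rewrite card_sig -(cardsC [set h | vertical h]) addnC; congr (_ + _); last first.
  by apply: eq_card => h; rewrite inE.
rewrite mulnC -{1}(card_ord 3) -card_prod.
have inj : injective (fun p : edge T * 'I_3 => K p.1 p.2).
  by move=> [e i] [e' i'] /sh_inj /= [-> ->].
rewrite -(card_imset _ inj); apply: eq_card => h; rewrite !inE.
apply/verticalPn/imsetP => [[e [i ->]]|[[e i] _ ->]]; first by exists (e, i).
by exists e, i.
Qed.

(** The contracted edges are the three copies of the forest [ST] and the identification rungs. That
    they form a forest follows by counting vertices and edges, both trees having one edge less than
    vertices. *)
Lemma sheets_contr : contr sheets_S sheets_q psi.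
Proof.
split.
- move=> x; have [i xi] := sh_onto x; have [t tE] := contr_onto cT (mp x).
  by exists (t, i); rewrite /sheets_q /= tE -xi.
- exact: sheets_psi_inj.
- by move=> e; rewrite inE.
- move=> h; case: (psiP h) => [[e [i [-> ->]]]|[v [-> ->]]].
    by rewrite sh_ends (contr_ends cT) /= -!imset_comp.
  have [-> _] := vijP v; rewrite /= -imset_comp imsetU1 imset_set1 /= /sheets_q /= posE //.
- case=> [[f i]|n]; rewrite ?sheets_S_inl ?sheets_S_inr.
    move=> fS x y; have [a [b E]] := ends_pair f; rewrite (lad_ends_inl pos' srung_pair2 i E).
    have qab : qT a = qT b by apply: (contr_const cT fS); rewrite E !inE eqxx ?orbT.
    by apply: const_on_pair; rewrite /sheets_q /= qab.
  case: n => // p _; rewrite /= imsetU1 imset_set1; apply: const_on_pair.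
  by rewrite /sheets_q /= posE /= sheet_repL.
- move=> [x i] [y j]; rewrite /sheets_q /= => E; have qxy := sheet_LE E.
  apply: (@in_colour_connect Lam) => F cF.
  have Fq k z w : qT z = qT w -> F (z, k) = F (w, k).
    move=> /(contr_fib cT) zw; apply: (in_connect_colour (F := fun z => F (z, k)) _ zw).
    move=> f fS a b af bf; apply: (cF (inl (f, k))); rewrite ?sheets_S_inl //.
      by rewrite mem_lad_inl af eqxx.
    by rewrite mem_lad_inl bf eqxx.
  have Fr z k : F (z, k) = F (z, sheet_rep (qT z) k).
    case: (eqVneq (sheet_rep (qT z) k) k) => [->//|rk].
    pose p : {p : vert T * 'I_3 | sheet_rep p.1 p.2 != p.2} := exist _ (qT z, k) rk.
    have zp : qT z = qT (pos' (inl p)) by rewrite posE.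
    rewrite (Fq _ _ _ zp) (Fq (sheet_rep _ _) _ _ zp).
    apply: (cF (inr (inl p))); rewrite ?sheets_S_inr // mem_lad_inr eqxx /= !inE eqxx ?orbT //.
  rewrite (Fq i _ _ qxy) Fr (Fr y j); congr (F (_, _)).
  by apply: eq_sheet_rep; rewrite -{1}qxy.
- have cS : #|edge Lam| = #|edge Gam| + #|sheets_S|.
    rewrite -(cardsC sheets_S) addnC; congr (_ + _).
    rewrite -(card_codom sheets_psi_inj); apply: eq_card => e; by rewrite !inE negbK.
  have cV := card_sheet_vert; have cE := card_sheet_edge.
  have [_ eT] := sh_tree sh; have [_ eT'] := tT'.
  have c1 : #|vert Lam| = #|vert T'| * 3 by rewrite /= card_prod card_ord.
  have c2 : #|edge Lam| = #|edge T'| * 3 + (#|{: {p : vert T * 'I_3 | sheet_rep p.1 p.2 != p.2}}| + #|{: {h : edge Gam | vertical h}}|).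
    by rewrite /= card_sum card_prod card_ord card_sum.
  rewrite c1; move: cS cV cE; rewrite c2 eT eT'.
  move: #|edge Gam| #|sheets_S| #|vert Gam| #|edge T| #|edge T'| => *; lia.
Qed.

End Expanded.
End SheetsLad.

Lemma maximal_lad g (G : wgraph) : maximal_trigonal g G ->
  (forall x : vert G, wt x = 0) /\
  exists (T : graph) (N : finType) (pos : N -> vert T) (pr : N -> {set 'I_3})
    (pr2 : forall n, #|pr n| = 2),
    [/\ lad_valid pos pr, #|vert T| = g & inhabited (smoothing G (lad pos pr2))].
Proof.
move=> [[[tau] gG] maxG]; have [[sh] w0] := trigonal_sheets tau; split=> //.
have G3 (z : vert G) : 3 <= valence z by have [/(_ (w0 z))] := trig_stable tau z.
have [vij vijP] : exists vij : {h : edge (sh_src sh) | vertical h} -> vert (sh_T sh) * ('I_3 * 'I_3), forall h,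
    ends (val h) = [set sh_L (vij h).1 (vij h).2.1; sh_L (vij h).1 (vij h).2.2] /\
    (vij h).2.1 != (vij h).2.2.
  apply: (fin_all_exists (P := fun h : {h | vertical h} => fun tij => ends (val h) = [set sh_L tij.1 tij.2.1; sh_L tij.1 tij.2.2] /\ tij.2.1 != tij.2.2)).
  by move=> h; apply: vertical_ends (valP h).
have [T' [pos' [ST [qT [psiT [cT posE v]]]]]] := prelad_expand (sheets_prelad vijP).
have tT' := lad_tree v.
have [psi psiP] := fin_all_exists (sheets_psi_ex vijP pos' psiT).
have c := sheets_contr cT posE tT' psiP.
set S := sheets_S psi in c.
pose Lam := lad pos' (srung_pair2 vijP).
have [t0 _] := tree_root tT'; have [i0 vi0] := lad_valence3 (srung_pair2 vijP) v t0.
have [|H [s]] := @smoothing_exists _ Lam (leqnn _) (lad_connected _ v).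
  by exists (t0, i0); rewrite vi0.
pose Hw := @WGraph H (fun _ => 0); have wH (x : vert Hw) : wt x = 0 by [].
have s' : smoothing Hw Lam := s.
have [q' [psi' cHG]] := contr_full_pieces G3 s' (sh_smooth sh) (lad_valence_ge2 v) c.
have [tH gH] : trigonal_graph #|vert T'| Hw := lad_trigonal v s' wH.
(* Contracting a forest keeps the difference between edges and vertices, hence the genus. *)
have gT : #|vert T'| = g.
  have cV := contr_card cHG; have cE := contr_card_edge cHG.
  move: gG gH; rewrite /genus !big1 => [|x _|x _]; [|exact: wH|exact: w0].
  by move: cV cE; rewrite /=; lia.
(* [S] contains all three copies of a tree edge or none, and each rung is a class by itself. *)
have clS : sim_closed (tau := lad_type v s' wH) S.
  move=> e1 e2 [->//|[e' []]] /=.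
  case: e1 => [[f i]|n] //= [->]; case: e2 => [[f' i']|n'] //= [->].
  by rewrite !(sheets_S_inl cT psiP).
have [w] := wcontraction_contr (leqnn _) wH w0 cHG.
have {}w : wcontraction G (trace (tau := lad_type v s' wH) S) by rewrite lad_trace.
have [|a] := maxG Hw _ (inhabits (TrigonalContraction clS w)).
  by rewrite -gT; split.
have [b] := wiso_sym a.
have [s2 _] := smoothing_iso b s'.
by exists T', _, pos', _, (srung_pair2 vijP); split.
Qed.

(** * Moving a rung over a path *)

Lemma giso_sym (G H : graph) : giso G H -> inhabited (giso H G).
Proof.
by move=> a; have [psi _ c] := contr_giso a; have [b _ _] := giso_contr c.
Qed.

(** The contraction factors through a smoothing of the ladder, which already has the number of edges
    of [G]; nothing remains to be contracted. *)
Lemma lad_smoothing_of_contr (T : graph) (N : finType) (pos : N -> vert T) (pr : N -> {set 'I_3})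
    (pr2 : forall n, #|pr n| = 2) (G : graph) U (q : vert (lad pos pr2) -> vert G) psi :
  lad_valid pos pr -> (forall z : vert G, 3 <= valence z) -> #|edge G| + 3 = 3 * #|vert T| ->
  contr U q psi -> inhabited (smoothing G (lad pos pr2)).
Proof.
move=> v G3 eG c.
have [t0 _] := tree_root (lad_tree v); have [i0 vi0] := lad_valence3 pr2 v t0.
have [|H [s]] := @smoothing_exists _ (lad pos pr2) (leqnn _) (lad_connected _ v).
  by exists (t0, i0); rewrite vi0.
have [q' [psi' c']] := smooth_contr G3 s c.
have [_ eH] := lad_smoothed_card v (G := @WGraph H (fun _ => 0)) s.
have S0 : full_pieces s U = set0.
  apply/eqP; rewrite -cards_eq0; have := contr_card_edge c'; move: eH eG => /=; lia.
rewrite S0 in c'; have [a _ _] := giso_contr c'.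
by have [s' _] := smoothing_iso a s.
Qed.

Lemma set3 (i j k : 'I_3) : i != j -> i != k -> j != k -> [set~ k] = [set i; j].
Proof.
move=> ij ik jk; apply/esym/eqP; rewrite eqEcard cardsC1 card_ord cards2 ij andbT.
by apply/subsetP => l; rewrite !inE => /orP[]/eqP->.
Qed.

Lemma contr_force (G L : graph) (U : {set edge L}) (q : vert L -> vert G) psi x y e f :
  (forall z : vert G, 3 <= valence z) -> contr U q psi ->
  valence x = 2 -> y != x -> ends e = [set x; y] -> x \in ends f -> f != e ->
  exists U' q' psi', [/\ @contr L G U' q' psi', e \in U' &
    forall h, h != e -> h != f -> (h \in U') = (h \in U)].
Proof.
move=> G3 c vx ney Ee xf nef; case: (boolP (e \in U)) => eU; first by exists U, q, psi.
have fU := contr_val2 G3 c vx ney Ee xf nef eU.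
have [q' [psi' c']] := contr_exchange vx ney Ee xf nef eU fU c.
exists (e |: U :\ f), q', psi'; split=> //; first by rewrite !inE eqxx.
by move=> h he hf; rewrite !inE (negbTE he) hf.
Qed.

Section LadLadder.
Variables (T : graph) (N : finType) (pos : N -> vert T) (pr : N -> {set 'I_3})
  (pr2 : forall n, #|pr n| = 2).
Hypothesis v : lad_valid pos pr.

Definition lad_rungs : rungs T := fun j => [set pr n | n in [set n | pos n == j]].

Lemma lad_rungs_valid : valid_rungs lad_rungs.
Proof.
move=> j; split=> [P /imsetP[n _ ->] //|].
have -> : #|lad_rungs j| = #|[set n | pos n == j]|.
  apply: card_in_imset => n n'; rewrite !inE => /eqP pn /eqP pn' E.
  by apply: (lad_inj v); rewrite pn pn' E.
by have := lad_three v j; have := lad_pos_ge1 v j; case: valence => [|[|[|[|]]]] //=; lia.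
Qed.

Lemma lad_valence_le3 (j : vert T) : valence j <= 3.
Proof. by have := lad_three v j; lia. Qed.

Lemma lad_rung_mem n : pr n \in lad_rungs (pos n).
Proof. by apply: imset_f; rewrite inE. Qed.

Lemma ladder_giso : inhabited (giso (ladder lad_rungs_valid) (lad pos pr2)).
Proof.
have [nu nuP] : exists nu : rung lad_rungs -> N, forall p, pos (nu p) = rung_pos p /\ pr (nu p) = rung_pair p.
  apply: (fin_all_exists (P := fun p n => pos n = rung_pos p /\ pr n = rung_pair p)).
  by move=> [[j P] /= Pj]; have /imsetP[n] := Pj; rewrite inE => /eqP pn Pn; exists n.
apply: giso_sym; rewrite ladder_lad.
pose gE (e : edge (lad pos pr2)) : edge (lad (rung_pos (r := lad_rungs)) (rung_pair2 lad_rungs_valid)) :=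
  match e with inl p => inl p | inr n => inr (exist _ (pos n, pr n) (lad_rung_mem n)) end.
have bE : bijective gE.
  exists (fun e => match e with inl p => inl p | inr p => inr (nu p) end).
    case=> //= n; congr inr; apply: (lad_inj v).
    by have [-> ->] := nuP (exist _ (pos n, pr n) (lad_rung_mem n)).
  case=> //= p; congr inr; apply: val_inj => /=; have [-> ->] := nuP p.
  by case: p => [[]].
have bV : bijective (fun x : vert T * 'I_3 => x) by exists id.
have Ee e : ends (gE e) = [set x | x in ends e].
  by rewrite imset_id; case: e => [[f i]|n].
exact: @GIso (lad pos pr2) (lad _ _) _ gE bV bE Ee.
Qed.

(** The isomorphism concerns the graph being smoothed, where [smoothing_iso] does not apply; the
    smoothing is turned into a contraction, composed, and turned back. *)
Lemma ladder_smoothing G : (forall z : vert G, 3 <= valence z) ->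
  #|edge G| + 3 = 3 * #|vert T| -> smoothing G (lad pos pr2) ->
  inhabited (smoothing G (ladder lad_rungs_valid)).
Proof.
move=> G3 eG s; have [a] := ladder_giso; have [U [q c]] := contr_smoothing s.
have [psi _ ca] := contr_giso a; have := contr_comp ca c.
clear ca; move: (gisoV a) psi; rewrite ladder_lad => aV psi' cc.
apply: lad_smoothing_of_contr cc => //.
apply: rung_valid => //; [exact: lad_rungs_valid|exact: lad_tree v|exact: lad_T2 v|exact: lad_valence_le3].
Qed.

End LadLadder.

(* Over a leaf a of a path, the three copies of a and the rung over the
   neighbour b of a form a triangle of G. Any of its three vertices can play the
   role of the leaf; choosing (b, p2) moves the rung over b to another pair of
   copies. *)
Section Swap.
Variables (T : graph) (N : finType) (pos : N -> vert T) (pr : N -> {set 'I_3})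
  (pr2 : forall n, #|pr n| = 2).
Hypothesis v : lad_valid pos pr.
Variables (a b : vert T) (f f2 : edge T) (nb n1 n2 : N) (l p1 p2 : 'I_3).
Hypotheses (va : valence a = 1) (vb : valence b = 2) (ab : a != b)
  (Ef : ends f = [set a; b]) (bf2 : b \in ends f2) (f2f : f2 != f)
  (pnb : pos nb = b) (prb : pr nb = [set~ l])
  (pn1 : pos n1 = a) (pn2 : pos n2 = a) (n12 : n1 != n2)
  (p12 : p1 != p2) (p1l : p1 != l) (p2l : p2 != l).
Local Notation E := (edge T * 'I_3 + N)%type.
Let tT := lad_tree v.

(** In the new ladder [(b, p2)] instead of [(b, l)] is the copy of [b] without a rung. The pairs
    chosen over [a] are any two different ones. *)
Definition swap_pair (n : N) : {set 'I_3} :=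
  if n == nb then [set~ p2] else if n == n1 then [set~ l] else if n == n2 then [set~ p1] else pr n.

Lemma swap_pair2 n : #|swap_pair n| = 2.
Proof. by rewrite /swap_pair; do 3 (case: ifP => _; first by rewrite cardsC1 card_ord). Qed.

Lemma swap_at_a n : pos n = a -> n = n1 \/ n = n2.
Proof.
move=> pn; have [m [m' [_ _ _ _ all]]] := lad_leaf v va.
move: (n12); have [->|->] := all n pn; have [->|->] := all n1 pn1; have [->|->] := all n2 pn2;
  by rewrite ?eqxx; auto.
Qed.

Lemma swap_at_b n : pos n = b -> n = nb.
Proof. by move=> pn; have [m _ all] := lad_val2 v vb; rewrite (all n pn) (all nb pnb). Qed.

Lemma nb1 : n1 != nb. Proof. by apply: contraNneq ab => E; rewrite -pn1 E pnb. Qed.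
Lemma nb2 : n2 != nb. Proof. by apply: contraNneq ab => E; rewrite -pn2 E pnb. Qed.

Lemma swap_nb : swap_pair nb = [set p1; l].
Proof. by rewrite /swap_pair eqxx; apply: set3 => //; rewrite eq_sym. Qed.
Lemma swap_n1 : swap_pair n1 = [set p1; p2].
Proof. by rewrite /swap_pair (negbTE nb1) eqxx; apply: set3. Qed.
Lemma swap_n2 : swap_pair n2 = [set p2; l].
Proof.
by rewrite /swap_pair (negbTE nb2) eq_sym (negbTE n12) eqxx; apply: set3; rewrite // eq_sym.
Qed.

Lemma swap_other n : pos n != a -> n != nb -> swap_pair n = pr n.
Proof.
move=> pa nnb; rewrite /swap_pair (negbTE nnb).
by case: eqP => [nE|_]; [|case: eqP => [nE|_] //]; rewrite nE ?pn1 ?pn2 eqxx in pa.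
Qed.

Lemma swap_valid : (forall j : vert T, valence j <= 2) -> lad_valid pos swap_pair.
Proof.
move=> path; split; [exact: tT|exact: lad_T2 v|exact: lad_three v|].
move=> n n' [pE sE]; case: (eqVneq (pos n) a) => [pa|pa].
  have pa' : pos n' = a by rewrite -pE.
  have ne : swap_pair n1 != swap_pair n2.
    apply/eqP => /setP/(_ p1); rewrite swap_n1 swap_n2 !inE eqxx (negbTE p12) (negbTE p1l) //.
  by move: sE ne; have [->|->] := swap_at_a pa; have [->|->] := swap_at_a pa' => // ->; rewrite eqxx.
have [v1|v1] := eqVneq (valence (pos n)) 1.
  have na : n != n1 by apply: contraNneq pa => ->; rewrite pn1.
  have na' : n != n2 by apply: contraNneq pa => ->; rewrite pn2.
  have nb_ : n != nb by apply/eqP => E; move: v1; rewrite E pnb vb.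
  have nb_' : n' != nb by apply/eqP => E; move: v1; rewrite pE E pnb vb.
  apply: (lad_inj v); rewrite pE; congr (_, _).
  by rewrite -swap_other // sE swap_other // -pE.
have v2 : valence (pos n) = 2.
  by have := path (pos n); have := lad_pos_ge1 v (pos n); case: valence v1 => [|[|[]]].
by have [m _ all] := lad_val2 v v2; rewrite (all n) // (all n') // pE.
Qed.

Lemma swap_edge_a g : a \in ends g -> g = f.
Proof.
move=> ag; have : #|[set e : edge T | a \in ends e]| = 1 by rewrite -tree_valence.
move/eqP/cards1P => [h hE].
have : g \in [set e : edge T | a \in ends e] by rewrite inE.
have : f \in [set e : edge T | a \in ends e] by rewrite inE Ef !inE eqxx.
by rewrite hE !inE => /eqP-> /eqP.
Qed.

Lemma swap_third i : [\/ i = p1, i = p2 | i = l].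
Proof.
have := set3 p12 p1l p2l => /setP/(_ i); rewrite !inE.
case: (eqVneq i l) => [->|_ /esym/orP[]/eqP->]; by [constructor 3|constructor 1|constructor 2].
Qed.

Lemma lad_ends_inr (prx : N -> {set 'I_3}) (prx2 : forall n, #|prx n| = 2) n i j :
  prx n = [set i; j] -> ends (inr n : edge (lad pos prx2)) = [set (pos n, i); (pos n, j)].
Proof. by move=> /= ->; rewrite imsetU1 imset_set1. Qed.

Section Contr.
Variables (G : graph) (U : {set E}) (q : vert T * 'I_3 -> vert G) (psi : edge G -> E).
Hypothesis c : @contr (lad pos pr2) G U q psi.
Hypotheses (G3 : forall z : vert G, valence z = 3)
  (n1U : inr n1 \in U) (n2U : inr n2 \in U) (flU : inl (f, l) \in U).

Let sf : ends (inl (f, l) : edge (lad pos pr2)) = [set (a, l); (b, l)].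
Proof. exact: lad_ends_inl Ef. Qed.

Lemma swap_hub i : q (a, i) = q (b, l).
Proof.
have hub j : q (a, i) = q (a, j).
  have [m [m' [_ pm pm' prm all]]] := lad_leaf v va.
  have mU n : pos n = a -> (inr n : E) \in U by move=> /swap_at_a[->|->].
  have [k Ek] := pair3 (pr2 m); have [k' Ek'] := pair3 (pr2 m').
  have kk' : k != k' by apply: contraNneq prm => kk; rewrite Ek Ek' kk.
  have [w /andP[wk wk']] := third3 k k'.
  have cw u : q (a, u) = q (a, w).
    case: (eqVneq u k) => uk.
      by apply: (contr_const c (mU _ pm')); rewrite mem_lad_inr pm' eqxx Ek' !inE ?uk.
    by apply: (contr_const c (mU _ pm)); rewrite mem_lad_inr pm eqxx Ek !inE.
  by rewrite !cw.
by rewrite (hub l); apply: (contr_const c flU); rewrite sf !inE eqxx ?orbT.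
Qed.

Lemma swap_valence_b i : i != l -> valence ((b, i) : vert (lad pos pr2)) = 3.
Proof.
move=> il; rewrite lad_valence vb (_ : [set _ | _] = [set nb]) ?cards1 //.
apply/setP => n; rewrite !inE; apply/andP/eqP => [[/eqP/swap_at_b //]|->].
by rewrite pnb prb !inE eqxx.
Qed.

(** Contracting this edge would merge [(b, i)] with a copy of [a] of valence 3, and [G] would have a
    vertex of valence at least 4. *)
Lemma swap_fU i : i != l -> (inl (f, i) : E) \notin U.
Proof.
move=> il; apply/negP => fU.
have [m vm] := lad_valence3 pr2 v a.
have E1 : q (a, i) = q (b, i).
  by apply: (contr_const c fU); rewrite (lad_ends_inl pos pr2 i Ef) !inE eqxx ?orbT.
have E2 : q (a, m) = q (b, i) by rewrite -E1 !swap_hub.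
have := contr_valence_ge4 c (lad_valence_ge2 v) _ E2.
by rewrite G3 vm swap_valence_b // xpair_eqE (negbTE ab) => /(_ isT isT isT).
Qed.

Lemma swap_nbU : (inr nb : E) \notin U.
Proof.
apply/negP => nU.
have E1 : q (b, p1) = q (b, p2).
  by apply: (contr_const c nU); rewrite mem_lad_inr pnb eqxx prb !inE.
have := contr_valence_ge4 c (lad_valence_ge2 v) _ E1.
by rewrite G3 !swap_valence_b // xpair_eqE (negbTE p12) andbF => /(_ isT isT isT).
Qed.

Definition swap_q (x : vert T * 'I_3) : vert G := if x.1 == a then q (b, p2) else q x.

(** The relabelling of the triangle. From the new hub [(b, p2)] the edge to [(b, p1)] is the old
    rung and the edge to [(b, l)] is the old [(f, p2)]; the old [(f, p1)] is the new rung. The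
    contracted edge moves from [(f, l)] to [(f, p2)]. *)
Definition swap_perm : {perm E} :=
  (tperm (inr nb) (inl (f, p1)) * tperm (inl (f, p2)) (inl (f, l)))%g.

Lemma swap_perm_nb : swap_perm (inr nb) = inl (f, p1).
Proof. by rewrite permM tpermL tpermD //; apply/eqP => -[/eqP]; rewrite eq_sym ?(negbTE p12) ?(negbTE p1l) // eq_sym (negbTE p1l). Qed.
Lemma swap_perm_p1 : swap_perm (inl (f, p1)) = inr nb.
Proof. by rewrite permM tpermR tpermD. Qed.
Lemma swap_perm_p2 : swap_perm (inl (f, p2)) = inl (f, l).
Proof.
rewrite permM; have -> : tperm (inr nb) (inl (f, p1)) (inl (f, p2)) = inl (f, p2) :> E.
  by apply: tpermD => //; apply/eqP => -[/eqP]; rewrite (negbTE p12).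
exact: tpermL.
Qed.
Lemma swap_perm_l : swap_perm (inl (f, l)) = inl (f, p2).
Proof.
rewrite permM; have -> : tperm (inr nb) (inl (f, p1)) (inl (f, l)) = inl (f, l) :> E.
  by apply: tpermD => //; apply/eqP => -[/eqP]; rewrite (negbTE p1l).
exact: tpermR.
Qed.
Lemma swap_perm_inl g i : g != f -> swap_perm (inl (g, i)) = inl (g, i).
Proof.
by move=> gf; rewrite permM !tpermD //; apply/eqP => -[/eqP]; rewrite eq_sym (negbTE gf).
Qed.
Lemma swap_perm_inr n : n != nb -> swap_perm (inr n) = inr n.
Proof.
by move=> nn; rewrite permM !tpermD //; apply/eqP => -[/eqP]; rewrite eq_sym (negbTE nn).
Qed.

Lemma swap_perm_cases (P : E -> Prop) :
  P (inr nb) -> P (inl (f, p1)) -> P (inl (f, p2)) -> P (inl (f, l)) ->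
  P (inr n1) -> P (inr n2) ->
  (forall e, swap_perm e = e -> (forall x, x \in ends (e : edge (lad pos pr2)) -> x.1 != a) ->
    ends (e : edge (lad pos swap_pair2)) = ends (e : edge (lad pos pr2)) -> P e) -> forall e, P e.
Proof.
move=> Pnb Pp1 Pp2 Pl Pn1 Pn2 Po [[g i]|n].
  case: (eqVneq g f) => [->|gf]; first by case: (swap_third i) => ->.
  apply: Po => //; first exact: swap_perm_inl.
  move=> [x j]; rewrite mem_lad_inl => /andP[xg _] /=.
  by apply: contraNneq gf => xa; apply/eqP/swap_edge_a; rewrite -xa.
case: (eqVneq n nb) => [->//|nn].
case: (eqVneq (pos n) a) => [/swap_at_a[->|->] //|pa].
apply: Po; first exact: swap_perm_inr.
  by move=> [x j]; rewrite mem_lad_inr => /andP[/eqP-> _].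
by rewrite /= swap_other.
Qed.

Lemma swap_permK e : swap_perm (swap_perm e) = e.
Proof.
move: e; apply: swap_perm_cases.
- by rewrite swap_perm_nb swap_perm_p1.
- by rewrite swap_perm_p1 swap_perm_nb.
- by rewrite swap_perm_p2 swap_perm_l.
- by rewrite swap_perm_l swap_perm_p2.
- by rewrite !swap_perm_inr ?nb1.
- by rewrite !swap_perm_inr ?nb2.
- by move=> e E _ _; rewrite !E.
Qed.

Definition swap_S : {set E} := [set e | swap_perm e \in U].

Lemma swap_contr : @contr (lad pos swap_pair2) G swap_S swap_q (swap_perm \o psi).
Proof.
have ba : b != a by rewrite eq_sym.
split.
- move=> z; have [[x i] xz] := contr_onto c z.
  case: (eqVneq x a) => xa; last by exists (x, i); rewrite /swap_q /= (negbTE xa).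
  by exists (b, l); rewrite /swap_q /= (negbTE ba) -xz xa swap_hub.
- exact: inj_comp perm_inj (contr_inj c).
- move=> e; rewrite inE (contr_in c); congr (~~ _); apply/codomP/codomP => -[h hE]; exists h.
    by rewrite /= -hE swap_permK.
  by rewrite hE /= swap_permK.
- move=> h; rewrite (contr_ends c) /=.
  have : psi h \notin U := contr_psi c h.
  move: (psi h); apply: (swap_perm_cases (P := fun e : E => e \notin U ->
     q @: ends (e : edge (lad pos pr2)) = swap_q @: ends (swap_perm e : edge (lad pos swap_pair2)))).
  + move=> _; rewrite swap_perm_nb (lad_ends_inl pos swap_pair2 p1 Ef).
    rewrite (lad_ends_inr pr2 (i := p1) (j := p2)); last by rewrite prb; apply: set3.
    by rewrite !imsetU1 !imset_set1 /swap_q /= eqxx (negbTE ba) pnb setUC.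
  + move=> _; rewrite swap_perm_p1 (lad_ends_inl pos pr2 p1 Ef).
    rewrite (lad_ends_inr swap_pair2 (i := p1) (j := l)); last exact: swap_nb.
    by rewrite !imsetU1 !imset_set1 /swap_q /= pnb (negbTE ba) swap_hub setUC.
  + move=> _; rewrite swap_perm_p2 (lad_ends_inl pos pr2 p2 Ef) (lad_ends_inl pos swap_pair2 l Ef).
    by rewrite !imsetU1 !imset_set1 /swap_q /= eqxx (negbTE ba) swap_hub setUC.
  + by rewrite flU.
  + by rewrite n1U.
  + by rewrite n2U.
  + move=> e eE na EE _; rewrite eE EE; apply: eq_in_imset => x xe.
    by rewrite /swap_q (negbTE (na _ xe)).
- apply: (swap_perm_cases (P := fun e : E => e \in swap_S -> const_on swap_q (ends (e : edge (lad pos swap_pair2))))).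
  + by rewrite inE swap_perm_nb (negbTE (swap_fU p1l)).
  + by rewrite inE swap_perm_p1 (negbTE swap_nbU).
  + move=> _; rewrite (lad_ends_inl pos swap_pair2 p2 Ef); apply: const_on_pair.
    by rewrite /swap_q /= eqxx (negbTE ba).
  + by rewrite inE swap_perm_l (negbTE (swap_fU p2l)).
  + by move=> _ x y /imsetP[i _ ->] /imsetP[j _ ->]; rewrite /swap_q /= pn1 eqxx.
  + by move=> _ x y /imsetP[i _ ->] /imsetP[j _ ->]; rewrite /swap_q /= pn2 eqxx.
  + move=> e eE na EE; rewrite inE eE EE => eU x y xe ye.
    rewrite /swap_q (negbTE (na _ xe)) (negbTE (na _ ye)); exact: (contr_const c eU).
- move=> x y xy; apply: in_colour_connect => F cF.
  have S1 : inr n1 \in swap_S by rewrite inE swap_perm_inr ?nb1.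
  have S2 : inr n2 \in swap_S by rewrite inE swap_perm_inr ?nb2.
  have Sp2 : inl (f, p2) \in swap_S by rewrite inE swap_perm_p2.
  have e1 := lad_ends_inr swap_pair2 swap_n1; have e2 := lad_ends_inr swap_pair2 swap_n2.
  rewrite pn1 in e1; rewrite pn2 in e2.
  have Fa i : F (a, i) = F (b, p2).
    have -> : F (b, p2) = F (a, p2).
      by apply: (cF _ Sp2); rewrite (lad_ends_inl pos swap_pair2 p2 Ef) !inE eqxx ?orbT.
    case: (swap_third i) => -> //.
      by apply: (cF _ S1); rewrite e1 !inE eqxx ?orbT.
    by apply: (cF _ S2); rewrite e2 !inE eqxx ?orbT.
  (* In the old ladder the copies of [a] belong to the fibre of [(b, l)], in the new one to that of
     [(b, p2)]: [F'] adapts the colouring to the former, [rho] the vertices to the latter. *)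
  pose F' (x : vert (lad pos pr2)) := if x.1 == a then F (b, l) else F x.
  have F'q u w : q u = q w -> F' u = F' w.
    move=> /(contr_fib c); apply: in_connect_colour.
    apply: (swap_perm_cases (P := fun e : E => e \in U -> const_on F' (ends (e : edge (lad pos pr2))))).
    + by rewrite (negbTE swap_nbU).
    + by rewrite (negbTE (swap_fU p1l)).
    + by rewrite (negbTE (swap_fU p2l)).
    + by move=> _; rewrite sf; apply: const_on_pair; rewrite /F' /= eqxx (negbTE ba).
    + by move=> _ z z' /imsetP[i _ ->] /imsetP[j _ ->]; rewrite /F' /= pn1 eqxx.
    + by move=> _ z z' /imsetP[i _ ->] /imsetP[j _ ->]; rewrite /F' /= pn2 eqxx.
    + move=> e eE na EE eU z z' ze ze'; rewrite /F' (negbTE (na _ ze)) (negbTE (na _ ze')).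
      by apply: (cF e); rewrite ?inE ?eE ?EE.
  pose rho (x : vert (lad pos pr2)) : vert (lad pos pr2) := if x.1 == a then (b, p2) else x.
  have Frho z : F z = F' (rho z).
    rewrite /F' /rho; case: z => z i /=; case: (eqVneq z a) => [->|za] /=.
      by rewrite (negbTE ba) Fa.
    by rewrite (negbTE za).
  rewrite !Frho; apply: F'q; move: xy; rewrite /swap_q /rho.
  by case: ifP; case: ifP.
- have -> : #|swap_S| = #|U|.
    rewrite -(card_imset _ (@perm_inj _ swap_perm)); apply: eq_card => e.
    apply/imsetP/idP => [[e']|eU]; first by rewrite inE => eU ->.
    by exists (swap_perm e); rewrite ?inE swap_permK.
  exact: contr_card c.
Qed.

End Contr.

(** [swap_contr] needs both rungs over [a] and the edge [(f, l)] in the contracted forest. Each of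
    them has an end of valence 2, namely [(a, k1)], [(a, k2)] and [(b, l)], so [contr_force] brings
    them in one after another; the edges it may exchange out are copies of tree edges other than
    [(f, l)]. *)
Lemma swap_smoothing G : (forall j : vert T, valence j <= 2) -> smoothing G (lad pos pr2) ->
  inhabited (smoothing G (lad pos swap_pair2)).
Proof.
move=> path s.
have G3 := lad_smoothed_valence v s.
have G3' (z : vert G) : 3 <= valence z by rewrite G3.
have [_ eG] := lad_smoothed_card v (G := @WGraph G (fun _ => 0)) s.
have [U [q c]] := contr_smoothing s; move: (smooth_rep s) c => psi c.
have prn : pr n1 != pr n2.
  by apply: contraNneq n12 => prE; apply/eqP/(lad_inj v); rewrite pn1 pn2 prE.
have [k1 E1] := pair3 (pr2 n1); have [k2 E2] := pair3 (pr2 n2).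
have k12 : k1 != k2 by apply: contraNneq prn => kk; rewrite E1 E2 kk.
have [w /andP[wk1 wk2]] := third3 k1 k2.
have val2 k m m' : m = n1 /\ m' = n2 \/ m = n2 /\ m' = n1 -> pr m = [set~ k] -> k \in pr m' ->
    valence ((a, k) : vert (lad pos pr2)) = 2.
  move=> mm Em km; rewrite lad_valence va (_ : [set _ | _] = [set m']) ?cards1 //.
  have pm' : pos m' = a by case: mm => -[_ ->].
  apply/setP => n; rewrite !inE; apply/andP/eqP => [[/eqP/swap_at_a nn kn]|->]; last by rewrite pm' eqxx.
  have : n = m \/ n = m' by case: nn => ->; case: mm => -[-> ->]; auto.
  by case=> // nm; rewrite nm Em !inE eqxx in kn.
have v1 : valence ((a, k1) : vert (lad pos pr2)) = 2.
  by apply: (val2 k1 n1 n2); auto; rewrite E2 !inE.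
have v2 : valence ((a, k2) : vert (lad pos pr2)) = 2.
  by apply: (val2 k2 n2 n1); auto; rewrite E1 !inE eq_sym.
have e2 : ends (inr n2 : edge (lad pos pr2)) = [set (a, k1); (a, w)].
  by rewrite -pn2; apply: lad_ends_inr; rewrite E2; apply: set3; rewrite // eq_sym.
have e1 : ends (inr n1 : edge (lad pos pr2)) = [set (a, k2); (a, w)].
  by rewrite -pn1; apply: lad_ends_inr; rewrite E1; apply: set3; rewrite // eq_sym.
have af : a \in ends f by rewrite Ef !inE eqxx.
have bf : b \in ends f by rewrite Ef !inE eqxx orbT.
have aw k : w != k -> (a, w) != (a, k) by move=> wk; rewrite xpair_eqE (negbTE wk) andbF.
have ain k : (a, k) \in ends (inl (f, k) : edge (lad pos pr2)) by rewrite mem_lad_inl af eqxx.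
have lr (p : edge T * 'I_3) n : (inl p : edge (lad pos pr2)) != inr n by [].
have [U1 [q1 [psi1 [c1 n2U1 _]]]] := contr_force G3' c v1 (aw _ wk1) e2 (ain _) (lr _ _).
have [U2 [q2 [psi2 [c2 n1U2 U2E]]]] := contr_force G3' c1 v2 (aw _ wk2) e1 (ain _) (lr _ _).
have n2U2 : inr n2 \in U2.
  by rewrite U2E //; apply/eqP => -[nn]; move: (n12); rewrite nn eqxx.
have vbl : valence ((b, l) : vert (lad pos pr2)) = 2.
  rewrite lad_valence vb (_ : [set _ | _] = set0) ?cards0 //.
  apply/setP => n; rewrite !inE; apply/negP => /andP[/eqP/swap_at_b ->].
  by rewrite prb !inE eqxx.
have efl : ends (inl (f, l) : edge (lad pos pr2)) = [set (b, l); (a, l)].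
  by rewrite (lad_ends_inl pos pr2 l Ef) setUC.
have abl : (a, l) != (b, l) by rewrite xpair_eqE (negbTE ab).
have bin : (b, l) \in ends (inl (f2, l) : edge (lad pos pr2)) by rewrite mem_lad_inl bf2 eqxx.
have ff2 : (inl (f2, l) : edge (lad pos pr2)) != inl (f, l).
  by apply/eqP => -[/eqP]; rewrite (negbTE f2f).
have [U3 [q3 [psi3 [c3 flU3 U3E]]]] := contr_force G3' c2 vbl abl efl bin ff2.
have n1U3 : inr n1 \in U3 by rewrite U3E.
have n2U3 : inr n2 \in U3 by rewrite U3E.
apply: (lad_smoothing_of_contr (swap_valid path) G3' eG (swap_contr c3 G3 n1U3 n2U3 flU3)).
Qed.

End Swap.

Lemma maximal_ladder g (G : wgraph) : maximal_trigonal g G -> ladder_graph g G.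
Proof.
move=> /maximal_lad[w0 [T [N [pos [pr [pr2 [v gT [s]]]]]]]]; split=> //.
have tT := lad_tree v; have T2 := lad_T2 v.
have finish (prx : N -> {set 'I_3}) (prx2 : forall n, #|prx n| = 2) (vx : lad_valid pos prx) (sx : smoothing G (lad pos prx2)) :
    (is_path T -> (exists2 r' : rungs T, valid_rungs r' & ~ all_same_copies r') ->
       ~ all_same_copies (lad_rungs pos prx)) ->
    exists (T : graph) (r : rungs T) (r_valid : valid_rungs r),
    [/\ is_tree T /\ 1 < #|vert T|, forall j : vert T, valence j <= 3,
        is_path T -> (exists2 r' : rungs T, valid_rungs r' & ~ all_same_copies r') -> ~ all_same_copies r,
        #|vert T| = g & inhabited (stabilization G (ladder r_valid))].
  move=> same; exists T, (lad_rungs pos prx), (lad_rungs_valid prx2 vx); split=> //.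
    exact: lad_valence_le3 vx.
  have G3 (z : vert G) : 3 <= valence z by rewrite (lad_smoothed_valence vx sx).
  have [_ eG] := lad_smoothed_card vx sx.
  have [s'] := ladder_smoothing vx G3 eG sx.
  constructor; apply: PruneDone s' => x; rewrite ladder_lad in x *.
  apply: lad_no_leaf x; apply: rung_valid => //; first exact: lad_rungs_valid.
  exact: lad_valence_le3 vx.
have [same|ns] := boolp.pselect (is_path T /\ (exists2 r' : rungs T, valid_rungs r' & ~ all_same_copies r') /\
    all_same_copies (lad_rungs pos pr)); last first.
  by apply: finish v s _ => p ex a; apply: ns.
have [path [[r' r'v r'ns] [P allP]]] := same.
(* With a single vertex of valence 2 its own pair would be common to all such vertices, and with
   none any set would do, here [set0]; so no choice of rungs could avoid the same pair. *)
have two : exists b j : vert T, [/\ valence b = 2, valence j = 2 & b != j].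
  apply: boolp.contrapT => no; apply: r'ns.
  have [[b vb]|nb] := boolp.pselect (exists b : vert T, valence b = 2); last first.
    by exists set0 => j vj; case: nb; exists j.
  have [_] := r'v b; rewrite vb eqxx => /eqP/cards1P[Q QE]; exists Q => j vj.
  suff -> : j = b by [].
  by apply/eqP; apply: boolp.contrapT => /negP jb; apply: no; exists j, b.
have [a va] := tree_leaf tT T2; have [f af] := tree_valence_edge tT T2 a.
have [b Ef] := other_end af.
have ab : a != b by rewrite -(pair_loop Ef) (negbTE (tree_nonloop tT f)).
have bf : b \in ends f by rewrite Ef !inE eqxx orbT.
have edge1 (z : vert T) : valence z = 1 -> z \in ends f -> forall g, z \in ends g -> g = f.
  rewrite (tree_valence tT) => /eqP/cards1P[h hE] zf g' zg.
  have : g' \in [set e : edge T | z \in ends e] by rewrite inE.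
  have : f \in [set e : edge T | z \in ends e] by rewrite inE.
  by rewrite hE !inE => /eqP-> /eqP.
(* Otherwise [b] is a leaf too, the tree is the single edge [f], and it has no vertex of valence
   2. *)
have vb : valence b = 2.
  have := path b; have := tree_valence_gt0 tT T2 b; case vb : (valence b) => [|[|[|]]] // _ _.
  have [b0 [_ [vb0 _ _]]] := two.
  have [cT _] := tT.
  have : (b0 \in [set a; b]) = (a \in [set a; b]).
    apply: (connected_colour (F := fun z => z \in [set a; b]) cT) => e.
    case: (eqVneq e f) => [->|ef].
      by rewrite Ef; apply: const_on_pair; rewrite !inE !eqxx orbT.
    have no z : z \in ends e -> (z \in [set a; b]) = false.
      move=> ze; apply: contraNF ef; rewrite !inE => /orP[]/eqP zE; rewrite zE in ze.
        by rewrite (edge1 a va af _ ze).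
      by rewrite (edge1 b vb bf _ ze).
    by move=> z z' /no-> /no->.
  by rewrite !inE eqxx /= => /orP[]/eqP E; move: vb0; rewrite E ?va ?vb.
have [f2 bf2 f2f] : exists2 f2, b \in ends f2 & f2 != f.
  have : #|[set e : edge T | b \in ends e] :\ f| = 1.
    by move: vb; rewrite (tree_valence tT) (cardsD1 f) inE bf => -[].
  by move/eqP/cards1P => [f2 /setP/(_ f2)]; rewrite !inE eqxx => /andP[]; exists f2.
have [nb pnb allb] := lad_val2 v vb.
have [n1 [n2 [n12 pn1 pn2 _ _]]] := lad_leaf v va.
have [l El] := pair3 (pr2 nb).
have [p1 /andP[p1l _]] := third3 l l.
have [p2 /andP[p2p1 p2l]] := third3 p1 l.
have p12 : p1 != p2 by rewrite eq_sym.
have [j vj jb] : exists2 j : vert T, valence j = 2 & j != b.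
  have [b0 [j0 [vb0 vj0 bj0]]] := two.
  case: (eqVneq b0 b) => [E|]; last by exists b0.
  by exists j0; rewrite // eq_sym -E.
have [s'] := swap_smoothing (nb := nb) (n1 := n1) (n2 := n2) (l := l) v va vb ab Ef bf2 f2f pnb El pn1 pn2 n12 p12 p1l p2l path s.
apply: finish (swap_valid (nb := nb) (n1 := n1) (n2 := n2) (l := l) v va vb ab pnb pn1 pn2 n12 p12 p1l p2l path) s' _.
(* The rung over [j] is untouched and still has the old common pair, the complement of [l], while
   the rung over [b] now has the complement of [p2]. *)
move=> _ _ [Q allQ].
have rb : swap_pair pr nb n1 n2 l p1 p2 nb = Q.
  have : swap_pair pr nb n1 n2 l p1 p2 nb \in lad_rungs pos (swap_pair pr nb n1 n2 l p1 p2) b.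
    by rewrite -pnb; apply: lad_rung_mem.
  by rewrite allQ // inE => /eqP.
have [nj pnj _] := lad_val2 v vj.
have rj : pr nj = Q.
  have : swap_pair pr nb n1 n2 l p1 p2 nj \in lad_rungs pos (swap_pair pr nb n1 n2 l p1 p2) j.
    by rewrite -pnj; apply: lad_rung_mem.
  rewrite allQ // inE => /eqP <-; rewrite (swap_other _ _ _ _ pn1 pn2) //.
    by rewrite pnj; apply/eqP => ja; move: vj; rewrite ja va.
  by apply: contraNneq jb => E; rewrite -pnj E pnb.
have PE n : valence (pos n) = 2 -> pr n = P.
  by move=> vn; have := lad_rung_mem pos pr n; rewrite allP // inE => /eqP.
have : swap_pair pr nb n1 n2 l p1 p2 nb = [set~ l].
  by rewrite rb -rj -El !PE ?pnb ?pnj.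
rewrite /swap_pair eqxx => /setP/(_ l); rewrite !inE eqxx eq_sym p2l //.
Qed.

Theorem theorem4p9 (R : realType) (g : nat) (hg : 3 <= g) :
  (forall G : wgraph, maximal_trigonal g G <-> ladder_graph g G) /\
  (forall C : (curve R -> Prop) -> Prop,
     maximal_cell g C <-> exists2 G : wgraph, ladder_graph g G & C = cell g G).
Proof.
have main G : maximal_trigonal g G <-> ladder_graph g G.
  by split; [apply: maximal_ladder | apply: ladder_maximal].
split=> // C; split=> -[G mG ->]; exists G => //; exact/main.
Qed.
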